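(* Fix $0<\gamma<1$ and a small parameter $\epsilon>0$, and let $\Psi:\mathbb R\to\mathbb R$ be a smooth function satisfying the decay assumption $$|\Psi^{(i+1)}(u)|\lesssim \Lambda^{-\frac12}(u)\,\langle u\rangle^{-\frac{1+\epsilon}{2}},\qquad i\ge 0 .$$ Suppose there exist functions $f,\underline f\in C^\infty(\mathbb R)$ satisfying $$\int_{\mathbb R}\Lambda(x)\left(|f^{(k)}(x)|^2+|\underline f^{(k)}(x)|^2\right)dx\le I\qquad\text{for all } k\in\mathbb Z_{\ge0},$$ for some constant $I$ (which can be arbitrarily large), such that the data $(F,G)$ obey $$F'(x)+G(x)=\delta f(x),\qquad G(x)-F'(x)=2\underline f(x)-\delta\,(\Psi'(-x))^2 f(x).$$ Then, if $\delta>0$ is small enough (depending on the data bound $I$), the Cauchy problem $$\Box_{g(\partial\phi)}\phi=S_0(\partial^2\phi,\partial\phi),\qquad (\phi,\partial_t\phi)|_{t=0}=(F(x),G(x)),$$ admits a unique and globally smooth solution $\phi\in C^\infty(\mathbb R^+\times\mathbb R)$. Moreover, for all $i,j\ge0$, $$|\partial_u\partial_u^i\partial_{\underline u}^j\phi|\lesssim\Lambda^{-\frac12}(u),\qquad |\partial_{\underline u}\partial_u^i\partial_{\underline u}^j\phi|\lesssim\delta\,\underline\Lambda^{-\frac12}(\underline u).$$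
   Context: Notation: $\langle x\rangle=\sqrt{1+x^2}$, $\Lambda(u)=\langle u\rangle^{2+2\gamma}$, $\underline\Lambda(\underline u)=\langle\underline u\rangle^{2+2\gamma}$; $h^{(k)}$ is the $k$-th derivative; $A\lesssim B$ means $A\le CB$ for a positive constant $C$. Coordinates: $(t,x)$ are the standard coordinates on $\mathbb R^{1+1}$ and $$u=t-x,\qquad \underline u=\frac{t+x}{2}-\frac12\int_0^{t-x}(\Psi'(\tau))^2d\tau .$$ The vector fields $\partial_u,\partial_{\underline u}$ are the coordinate derivatives of $(u,\underline u)$: $\partial_{\underline u}=\partial_t+\partial_x$ and $\partial_u=\frac{(\Psi'(u))^2+1}{2}\partial_t+\frac{(\Psi'(u))^2-1}{2}\partial_x$. ($\Psi(t-x)$ is a plane wave solution of the relativistic string equation and $\phi$ is its perturbation: $\varphi=\phi+\Psi(t-x)$.) Metrics: $$\mathring g_{\mu\nu}=-du\otimes d\underline u-d\underline u\otimes du+d\Psi\otimes d\phi+d\phi\otimes d\Psi,\qquad d\Psi=\Psi'(u)\,du,\qquad g_{\mu\nu}=\mathring g_{\mu\nu}+d\phi\otimes d\phi .$$ $\mathring g$ and $g$ (without indices) are the absolute values of the determinants of $\mathring g_{\mu\nu}$ and $g_{\mu\nu}$ in the coordinates $\{u,\underline u\}$: $$\mathring g=(1-\Psi'(u)\partial_{\underline u}\phi)^2,\qquad g=1-2\partial_u\phi\,\partial_{\underline u}\phi-2\Psi'(u)\partial_{\underline u}\phi+(\Psi'(u))^2(\partial_{\underline u}\phi)^2 .$$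 $g^{\mu\nu}$ is the inverse of $g_{\mu\nu}$, and $\Box_{g(\partial\phi)}\phi=\frac1{\sqrt g}\partial_\mu(\sqrt g\,g^{\mu\nu}\partial_\nu\phi)$ with $\mu,\nu\in\{u,\underline u\}$. The source term is $$\begin{aligned}S_0(\partial^2\phi,\partial\phi)={}&\frac{\mathring g}{g^2}(1-g)(\Psi'(u))^2\partial_{\underline u}^2\phi+\frac1{g^2}(\mathring g-g)\Psi'(u)\,\partial_u\phi\,\partial_{\underline u}^2\phi-\frac{\mathring g}{g^2}(\Psi'(u))^3\partial_{\underline u}\phi\,\partial_{\underline u}^2\phi\\&+\frac{\mathring g}{g^2}\Psi'(u)\,\partial_{\underline u}\phi\,\partial_{\underline u}\partial_u\phi+\frac{\mathring g-1}{g}2\,\partial_u\partial_{\underline u}\phi+\frac1g\Psi'(u)\,\partial_{\underline u}\phi\,\partial_u\partial_{\underline u}\phi+\frac1g\Psi''(u)(\partial_{\underline u}\phi)^2\\&-\frac{\mathring g}{\sqrt g}(\Psi'(u))^2\partial_{\underline u}\phi\,\partial_{\underline u}(\sqrt g)^{-1}+\frac{\mathring g-1}{\sqrt g}\partial_{\underline u}\phi\,\partial_u(\sqrt g)^{-1}+\frac{\mathring g-1}{\sqrt g}\partial_u\phi\,\partial_{\underline u}(\sqrt g)^{-1}\\&+\frac1{\sqrt g}\Psi'(u)(\partial_{\underline u}\phi)^2\partial_u(\sqrt g)^{-1}-\frac1{\sqrt g}\Psi'(u)\,\partial_{\underline u}\phi\,\partial_u\phi\,\partial_{\underline u}(\sqrt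 g)^{-1}.\end{aligned}$$ *)

(* Defs.v *)
From Stdlib Require Import Reals Lra.
From Coquelicot Require Import Coquelicot.
Open Scope R_scope.

Definition jap (x : R) : R := sqrt (1 + x ^ 2).

(* Both Lambda and its underlined version are this function of one real
   variable; they differ only in the variable (u or ub) they are applied to. *)
Definition Lambda (gamma x : R) : R := Rpower (jap x) (2 + 2 * gamma).

Definition smooth1 (f : R -> R) : Prop := forall (k : nat) (x : R), ex_derive_n f k x.

(* Functions on R^{1+1} take the arguments (t, x) in this order. *)
Definition smooth2 (f : R -> R -> R) : Prop :=
  forall (n : nat) (t x : R), ex_diff_n f n t x.

Definition Dt (f : R -> R -> R) (t x : R) : R := Derive (fun s => f s x) t.
Definition Dx (f : R -> R -> R) (t x : R) : R := Derive (fun y => f t y) x.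

Definition u_ (t x : R) : R := t - x.
Definition ub_ (Psi : R -> R) (t x : R) : R :=
  (t + x) / 2 - / 2 * RInt (fun tau => (Derive Psi tau) ^ 2) 0 (t - x).

Definition d_u (Psi : R -> R) (f : R -> R -> R) (t x : R) : R :=
  ((Derive Psi (u_ t x)) ^ 2 + 1) / 2 * Dt f t x
  + ((Derive Psi (u_ t x)) ^ 2 - 1) / 2 * Dx f t x.
Definition d_ub (f : R -> R -> R) (t x : R) : R := Dt f t x + Dx f t x.

Inductive coord : Set := cu | cub.

Definition d_ (Psi : R -> R) (mu : coord) (f : R -> R -> R) : R -> R -> R :=
  match mu with cu => d_u Psi f | cub => d_ub f end.

Definition sumc (F : coord -> R) : R := F cu + F cub.

(* Components in the coframe (du, d ub) of du, d ub, d Psi = Psi'(u) du. *)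
Definition du (mu : coord) : R := match mu with cu => 1 | cub => 0 end.
Definition dub (mu : coord) : R := match mu with cu => 0 | cub => 1 end.
Definition dPsi (Psi : R -> R) (mu : coord) (t x : R) : R := Derive Psi (u_ t x) * du mu.

Definition gr_metric (Psi : R -> R) (phi : R -> R -> R) (mu nu : coord) (t x : R) : R :=
  - (du mu * dub nu) - dub mu * du nu
  + dPsi Psi mu t x * d_ Psi nu phi t x + d_ Psi mu phi t x * dPsi Psi nu t x.

Definition g_metric (Psi : R -> R) (phi : R -> R -> R) (mu nu : coord) (t x : R) : R :=
  gr_metric Psi phi mu nu t x + d_ Psi mu phi t x * d_ Psi nu phi t x.

Definition det2 (h : coord -> coord -> R) : R :=
  h cu cu * h cub cub - h cu cub * h cub cu.

Definition inv2 (h : coord -> coord -> R) (mu nu : coord) : R :=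
  match mu, nu with
  | cu, cu => h cub cub / det2 h
  | cub, cub => h cu cu / det2 h
  | _, _ => - h mu nu / det2 h
  end.

Definition gr_ (Psi : R -> R) (phi : R -> R -> R) (t x : R) : R :=
  Rabs (det2 (fun mu nu => gr_metric Psi phi mu nu t x)).
Definition g_ (Psi : R -> R) (phi : R -> R -> R) (t x : R) : R :=
  Rabs (det2 (fun mu nu => g_metric Psi phi mu nu t x)).
Definition ginv (Psi : R -> R) (phi : R -> R -> R) (mu nu : coord) (t x : R) : R :=
  inv2 (fun mu' nu' => g_metric Psi phi mu' nu' t x) mu nu.

(* A symmetric nondegenerate 2x2 form has signature (1,1) iff its determinant
   is negative; this is what makes 1/sqrt g and g^{mu nu} meaningful. *)
Definition lorentzian (Psi : R -> R) (phi : R -> R -> R) (t x : R) : Prop :=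
  det2 (fun mu nu => g_metric Psi phi mu nu t x) < 0.

Definition box_g (Psi : R -> R) (phi : R -> R -> R) (t x : R) : R :=
  / sqrt (g_ Psi phi t x) *
  sumc (fun mu =>
    d_ Psi mu (fun s y =>
      sumc (fun nu =>
        sqrt (g_ Psi phi s y) * ginv Psi phi mu nu s y * d_ Psi nu phi s y)) t x).

Definition S0 (Psi : R -> R) (phi : R -> R -> R) (t x : R) : R :=
  let g := g_ Psi phi t x in
  let gr := gr_ Psi phi t x in
  let P1 := Derive_n Psi 1 (u_ t x) in
  let P2 := Derive_n Psi 2 (u_ t x) in
  let pu := d_u Psi phi t x in
  let pb := d_ub phi t x in
  let pbb := d_ub (d_ub phi) t x in
  let pbu := d_ub (d_u Psi phi) t x in
  let pub := d_u Psi (d_ub phi) t x in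
  let isg := fun s y => / sqrt (g_ Psi phi s y) in
  let isg_u := d_u Psi isg t x in
  let isg_b := d_ub isg t x in
    gr / g ^ 2 * (1 - g) * P1 ^ 2 * pbb
  + / g ^ 2 * (gr - g) * P1 * pu * pbb
  - gr / g ^ 2 * P1 ^ 3 * pb * pbb
  + gr / g ^ 2 * P1 * pb * pbu
  + (gr - 1) / g * 2 * pub
  + / g * P1 * pb * pub
  + / g * P2 * pb ^ 2
  - gr / sqrt g * P1 ^ 2 * pb * isg_b
  + (gr - 1) / sqrt g * pb * isg_u
  + (gr - 1) / sqrt g * pu * isg_b
  + / sqrt g * P1 * pb ^ 2 * isg_u
  - / sqrt g * P1 * pb * pu * isg_b.

(* An element of C^oo([0,oo) x R) is represented by a smooth function on R^2
   extending it; the derivatives at points with t >= 0 do not depend on the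
   extension, and only the restriction to t >= 0 is meaningful. *)
Definition cauchy_solution (Psi F G : R -> R) (phi : R -> R -> R) : Prop :=
  smooth2 phi /\
  (forall t x, 0 <= t ->
     lorentzian Psi phi t x /\ box_g Psi phi t x = S0 Psi phi t x) /\
  (forall x, phi 0 x = F x /\ Dt phi 0 x = G x).

Definition decay (gamma eps : R) (Psi : R -> R) : Prop :=
  forall i : nat, exists C : R, 0 < C /\
    forall u : R,
      Rabs (Derive_n Psi (S i) u)
      <= C * (Rpower (Lambda gamma u) (- / 2) * Rpower (jap u) (- ((1 + eps) / 2))).

(* The integrand is continuous and nonnegative, so the improper Riemann
   integral used here is its Lebesgue integral. *)
Definition energy_bound (gamma I0 : R) (f fb : R -> R) : Prop :=
  forall k : nat, exists E : R,
    is_RInt_gen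
      (fun x => Lambda gamma x * ((Rabs (Derive_n f k x)) ^ 2 + (Rabs (Derive_n fb k x)) ^ 2))
      (Rbar_locally m_infty) (Rbar_locally p_infty) E
    /\ E <= I0.

Definition admissible_data (Psi : R -> R) (delta : R) (f fb F G : R -> R) : Prop :=
  forall x : R,
    ex_derive F x /\
    Derive F x + G x = delta * f x /\
    G x - Derive F x = 2 * fb x - delta * (Derive Psi (- x)) ^ 2 * f x.

Lemma jap_gt0 (x : R) : 0 < jap x.
Proof. apply sqrt_lt_R0. pose proof (pow2_ge_0 x). lra. Qed.

Lemma gr_E Psi phi t x :
  gr_ Psi phi t x = (1 - Derive Psi (u_ t x) * d_ub phi t x) ^ 2.
Proof.
unfold gr_. rewrite <- Rabs_Ropp.
transitivity (Rabs ((1 - Derive Psi (u_ t x) * d_ub phi t x) ^ 2)).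
- f_equal. unfold det2, gr_metric, dPsi. simpl. ring.
- apply Rabs_pos_eq, pow2_ge_0.
Qed.

Lemma g_det Psi phi t x :
  det2 (fun mu nu => g_metric Psi phi mu nu t x) =
  - (1 - 2 * d_u Psi phi t x * d_ub phi t x
     - 2 * Derive Psi (u_ t x) * d_ub phi t x
     + (Derive Psi (u_ t x)) ^ 2 * (d_ub phi t x) ^ 2).
Proof. unfold det2, g_metric, gr_metric, dPsi. simpl. ring. Qed.

Lemma g_E Psi phi t x : lorentzian Psi phi t x ->
  g_ Psi phi t x =
  1 - 2 * d_u Psi phi t x * d_ub phi t x
  - 2 * Derive Psi (u_ t x) * d_ub phi t x
  + (Derive Psi (u_ t x)) ^ 2 * (d_ub phi t x) ^ 2.
Proof.
unfold lorentzian, g_. intros H. rewrite Rabs_left by exact H.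
rewrite g_det. ring.
Qed.

Lemma ginv_E Psi phi mu nu t x : lorentzian Psi phi t x ->
  sumc (fun la => ginv Psi phi mu la t x * g_metric Psi phi la nu t x)
  = match mu, nu with cu, cu | cub, cub => 1 | _, _ => 0 end.
Proof.
unfold lorentzian. intros H.
unfold sumc, ginv, inv2.
set (D := det2 _) in *.
assert (HD : D <> 0) by lra.
assert (Hs : g_metric Psi phi cub cu t x = g_metric Psi phi cu cub t x)
  by (unfold g_metric, gr_metric, dPsi; simpl; ring).
assert (DE : D = g_metric Psi phi cu cu t x * g_metric Psi phi cub cub t x
               - g_metric Psi phi cu cub t x * g_metric Psi phi cub cu t x)
  by reflexivity.
destruct mu, nu; apply (Rmult_eq_reg_r D); auto; field_simplify; auto;
  rewrite ?DE, ?Hs; ring.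
Qed.

(* d_u and d_ub are the coordinate vector fields of (u, ub). *)
Lemma d_u_coord Psi mu t x : d_ Psi mu u_ t x = du mu.
Proof.
assert (Ht : Dt u_ t x = 1)
  by (unfold Dt, u_; apply is_derive_unique; auto_derive; auto; ring).
assert (Hx : Dx u_ t x = -1)
  by (unfold Dx, u_; apply is_derive_unique; auto_derive; auto; ring).
destruct mu; simpl; unfold d_u, d_ub; rewrite Ht, Hx; field.
Qed.

Lemma d_ub_coord Psi mu t x : smooth1 Psi -> d_ Psi mu (ub_ Psi) t x = dub mu.
Proof.
intros HP.
assert (Hc : forall z, continuous (fun tau => (Derive Psi tau) ^ 2) z).
{ intros z. apply (ex_derive_continuous (fun tau => (Derive Psi tau) ^ 2)).
  auto_derive. exact (HP 2%nat z). }
assert (HI : forall z, is_derive (fun b => RInt (fun tau => (Derive Psi tau) ^ 2) 0 b) z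
                         ((Derive Psi z) ^ 2)).
{ intros z. apply (is_derive_RInt (fun tau => (Derive Psi tau) ^ 2) _ 0).
  - apply filter_forall. intros b. apply (RInt_correct (V:=R_CompleteNormedModule)).
    apply (ex_RInt_continuous (V:=R_CompleteNormedModule)). intros w _. apply Hc.
  - apply Hc. }
pose (J := fun b => RInt (fun tau => (Derive Psi tau) ^ 2) 0 b).
assert (HJ : forall z, Derive J z = (Derive Psi z) ^ 2)
  by (intros z; apply is_derive_unique, HI).
assert (HJe : forall z, ex_derive J z) by (intros z; eexists; apply HI).
assert (Ht : Dt (ub_ Psi) t x = / 2 - / 2 * (Derive Psi (u_ t x)) ^ 2).
{ unfold Dt. change (fun s => ub_ Psi s x) with (fun s => (s + x) / 2 - / 2 * J (s - x)).
  apply is_derive_unique. auto_derive; [apply HJe|].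
  unfold u_. rewrite <- HJ. change (t + - x) with (t - x).
  change (fun x0 => J x0) with J. field. }
assert (Hx : Dx (ub_ Psi) t x = / 2 + / 2 * (Derive Psi (u_ t x)) ^ 2).
{ unfold Dx. change (fun y => ub_ Psi t y) with (fun y => (t + y) / 2 - / 2 * J (t - y)).
  apply is_derive_unique. auto_derive; [apply HJe|].
  unfold u_. rewrite <- HJ. change (t + - x) with (t - x).
  change (fun x0 => J x0) with J. field. }
destruct mu; simpl; unfold d_u, d_ub; rewrite Ht, Hx; field.
Qed.

(* Main.v *)
From Stdlib Require Import Reals Lra Lia Bool FunctionalExtensionality ClassicalEpsilon Ranalysis5.
From Coquelicot Require Import Coquelicot.
Require Import Defs.
Open Scope R_scope.

(** The metric g is the one induced on the graph of the total field
phi + Psi(t - x) in Minkowski space R^{1+2}, and the source S0 is chosen so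
that the equation says that this graph is a relativistic string.  Let U and V
be the flat null derivatives (d_t - d_x)/2 and (d_t + d_x)/2, and let p and r be
U and V of the total field.  Then g = 1 - 4pr and
[[
  box_g phi - S0 = - 4 (1 - 2 Psi' r)^2 / g^2 * ((1 - 2pr) UV + r^2 UU + p^2 VV),
]]
where the last factor is the string operator applied to the total field
([box_minus_source]).

Strings in 1+1 dimensions are integrable.  The Riemann invariants
a = 2p / (1 + sqrt g) and b = 2r / (1 + sqrt g), for which p = a / (1 + ab) and
r = b / (1 + ab), satisfy V a + b^2 U a = 0 and U b + a^2 V b = 0: each of them
is constant along one family of characteristics, whose slope is given by the
other one.  Label a point by the feet y and z on the line t = 0 of its two
characteristics.  Then a depends on y only, b on z only, and t - x, t + x and
the total field are each a primitive in y plus a primitive in z.  The solution is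
therefore explicit once the map (y, z) -> (t, x) is inverted, which is possible
globally as soon as |a(y) b(z)| <= 1/2; since a is bounded and b = O(delta), a
small delta suffices ([characteristic_coordinates_exist], [string_solution]).

Decay.  The energy bound gives pointwise bounds by Lambda^{-1/2} for the data
([weighted_sobolev]), hence for a and all its derivatives, and with an
additional factor delta for b.  The feet stay within a bounded distance of the
coordinates (y from -u, z from 2 ub), so a function of y decays in u and a
function of z decays in ub.  The derivatives of phi lie in an algebra generated
by such functions, on which d_u always produces a factor that decays in u and
d_ub a factor that decays in ub ([decaying_frame]); the estimates for all
i and j follow by induction ([phi_decay]).  To get constants that depend on the
energy bound only, the whole argument is run on families indexed by the data.

Uniqueness.  Along the characteristics of the explicit solution the differences
of its invariants and those of a competitor obey a linear system, so they vanish
on a thin strip above any set where they vanish.  The factor (1 - 2 Psi' r)^2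
could degenerate for the competitor; but it is bounded below for the explicit
solution, hence by continuity for the competitor on a thin strip, and the
induction over strips takes care of both ([invariants_agree],
[string_unique]). *)

(** * Derivatives in the null directions *)


(** With [fu], [fv] the derivatives along (d_t - d_x)/2 and (d_t + d_x)/2, the
    two conditions are d_t = U + V and d_x = V - U.  Only partial derivatives are
    involved, so that the product and composition rules hold at a single point. *)
Definition null_derive (f : R -> R -> R) (t x fu fv : R) : Prop :=
  is_derive (fun s => f s x) t (fu + fv) /\ is_derive (fun y => f t y) x (fv - fu).

Lemma null_derive_ext_loc f g t x fu fv :
  locally_2d (fun s y => f s y = g s y) t x ->
  null_derive f t x fu fv -> null_derive g t x fu fv.
Proof.
intros E [H1 H2]; split.
- apply (is_derive_ext_loc (fun s => f s x)); [|exact H1].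
  exact (locally_2d_1d_const_y _ _ _ E).
- apply (is_derive_ext_loc (fun y => f t y)); [|exact H2].
  exact (locally_2d_1d_const_x _ _ _ E).
Qed.

Lemma null_derive_ext f g t x fu fv :
  (forall s y, f s y = g s y) -> null_derive f t x fu fv -> null_derive g t x fu fv.
Proof. intros E. apply null_derive_ext_loc, locally_2d_forall, E. Qed.

Lemma null_derive_eq f t x fu fv gu gv :
  null_derive f t x fu fv -> fu = gu -> fv = gv -> null_derive f t x gu gv.
Proof. intros H <- <-. exact H. Qed.

Lemma null_derive_const c t x : null_derive (fun _ _ => c) t x 0 0.
Proof.
split; (evar_last; [apply is_derive_const|unfold zero; simpl; ring]).
Qed.

Lemma null_derive_plus f g t x fu fv gu gv :
  null_derive f t x fu fv -> null_derive g t x gu gv ->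
  null_derive (fun s y => f s y + g s y) t x (fu + gu) (fv + gv).
Proof.
intros [F1 F2] [G1 G2]; split.
- evar_last; [apply (is_derive_plus (fun s => f s x) (fun s => g s x) t _ _ F1 G1)|].
  unfold plus; simpl; ring.
- evar_last; [apply (is_derive_plus (fun y => f t y) (fun y => g t y) x _ _ F2 G2)|].
  unfold plus; simpl; ring.
Qed.

Lemma null_derive_mult f g t x fu fv gu gv :
  null_derive f t x fu fv -> null_derive g t x gu gv ->
  null_derive (fun s y => f s y * g s y) t x
    (fu * g t x + f t x * gu) (fv * g t x + f t x * gv).
Proof.
intros [F1 F2] [G1 G2]; split.
- evar_last; [apply (is_derive_mult (fun s => f s x) (fun s => g s x) t _ _ F1 G1 Rmult_comm)|].
  unfold plus, mult; simpl; ring.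
- evar_last; [apply (is_derive_mult (fun y => f t y) (fun y => g t y) x _ _ F2 G2 Rmult_comm)|].
  unfold plus, mult; simpl; ring.
Qed.

Lemma null_derive_comp (k : R -> R) f t x fu fv l :
  is_derive k (f t x) l -> null_derive f t x fu fv ->
  null_derive (fun s y => k (f s y)) t x (l * fu) (l * fv).
Proof.
intros K [F1 F2]; split.
- evar_last; [apply (is_derive_comp k (fun s => f s x) t _ _ K F1)|].
  unfold scal; simpl; unfold mult; simpl; ring.
- evar_last; [apply (is_derive_comp k (fun y => f t y) x _ _ K F2)|].
  unfold scal; simpl; unfold mult; simpl; ring.
Qed.

Lemma null_derive_scal c f t x fu fv :
  null_derive f t x fu fv -> null_derive (fun s y => c * f s y) t x (c * fu) (c * fv).
Proof.
intros F. refine (null_derive_eq _ _ _ _ _ _ _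
  (null_derive_mult _ _ _ _ _ _ _ _ (null_derive_const c t x) F) _ _); ring.
Qed.

Lemma null_derive_minus f g t x fu fv gu gv :
  null_derive f t x fu fv -> null_derive g t x gu gv ->
  null_derive (fun s y => f s y - g s y) t x (fu - gu) (fv - gv).
Proof.
intros F G.
apply (null_derive_ext (fun s y => f s y + -1 * g s y)); [intros; ring|].
refine (null_derive_eq _ _ _ _ _ _ _
  (null_derive_plus _ _ _ _ _ _ _ _ F (null_derive_scal (-1) _ _ _ _ _ G)) _ _); ring.
Qed.

Lemma null_derive_inv f t x fu fv :
  f t x <> 0 -> null_derive f t x fu fv ->
  null_derive (fun s y => / f s y) t x (- fu / f t x ^ 2) (- fv / f t x ^ 2).
Proof.
intros N F.
assert (K : is_derive Rinv (f t x) (- / f t x ^ 2))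
  by (auto_derive; [exact N|field; exact N]).
refine (null_derive_eq _ _ _ _ _ _ _ (null_derive_comp Rinv _ _ _ _ _ _ K F) _ _); field; exact N.
Qed.

Lemma null_derive_inv_sqrt f t x fu fv :
  0 < f t x -> null_derive f t x fu fv ->
  null_derive (fun s y => / sqrt (f s y)) t x
    (- fu / (2 * f t x) * / sqrt (f t x)) (- fv / (2 * f t x) * / sqrt (f t x)).
Proof.
intros N F. assert (S : 0 < sqrt (f t x)) by (apply sqrt_lt_R0; exact N).
assert (K : is_derive (fun w => / sqrt w) (f t x) (- / (2 * f t x) * / sqrt (f t x))).
{ auto_derive; [repeat split; lra|]. try rewrite sqrt_sqrt by lra. field. lra. }
refine (null_derive_eq _ _ _ _ _ _ _ (null_derive_comp _ _ _ _ _ _ _ K F) _ _);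
  field; split; lra.
Qed.

Lemma null_derive_u (k : R -> R) t x l :
  is_derive k (t - x) l -> null_derive (fun s y => k (s - y)) t x l 0.
Proof.
intros K. split.
- evar_last; [apply (is_derive_comp k (fun s => s - x) t _ 1 K); auto_derive; auto; ring|].
  unfold scal; simpl; unfold mult; simpl; ring.
- evar_last; [apply (is_derive_comp k (fun y => t - y) x _ (-1) K); auto_derive; auto; ring|].
  unfold scal; simpl; unfold mult; simpl; ring.
Qed.

Lemma Dt_null f t x fu fv : null_derive f t x fu fv -> Dt f t x = fu + fv.
Proof. intros [H _]. exact (is_derive_unique _ _ _ H). Qed.
Lemma Dx_null f t x fu fv : null_derive f t x fu fv -> Dx f t x = fv - fu.
Proof. intros [_ H]. exact (is_derive_unique _ _ _ H). Qed.

Lemma d_u_null Psi f t x fu fv :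
  null_derive f t x fu fv -> d_u Psi f t x = fu + Derive Psi (t - x) ^ 2 * fv.
Proof. intros H. unfold d_u. rewrite (Dt_null _ _ _ _ _ H), (Dx_null _ _ _ _ _ H). unfold u_. field. Qed.

Lemma d_ub_null f t x fu fv : null_derive f t x fu fv -> d_ub f t x = 2 * fv.
Proof. intros H. unfold d_ub. rewrite (Dt_null _ _ _ _ _ H), (Dx_null _ _ _ _ _ H). field. Qed.

Lemma locally_2d_pos f t x : continuity_2d_pt f t x -> 0 < f t x ->
  locally_2d (fun s y => 0 < f s y) t x.
Proof.
intros C P. destruct (C (mkposreal _ P)) as [d Hd]. exists d. intros s y Hs Hy.
specialize (Hd s y Hs Hy). simpl in Hd. apply Rabs_lt_between in Hd. lra.
Qed.

(** * The equation as a multiple of the string equation *)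
Section StringForm.
Variables (Psi : R -> R) (phi p r : R -> R -> R).
Hypothesis hPsi : smooth1 Psi.
Hypothesis hphi : forall t x, null_derive phi t x (p t x - Derive Psi (t - x)) (r t x).

Let psi t x := Derive Psi (t - x).

Lemma d_u_phi t x : d_u Psi phi t x = p t x - psi t x + psi t x ^ 2 * r t x.
Proof. apply (d_u_null _ _ _ _ _ _ (hphi t x)). Qed.
Lemma d_ub_phi t x : d_ub phi t x = 2 * r t x.
Proof. apply (d_ub_null _ _ _ _ _ (hphi t x)). Qed.

Lemma det_phi t x :
  det2 (fun mu nu => g_metric Psi phi mu nu t x) = - (1 - 4 * (p t x * r t x)).
Proof. rewrite g_det, d_u_phi, d_ub_phi. unfold u_; fold (psi t x). ring. Qed.

Lemma lorentzian_phi t x : lorentzian Psi phi t x <-> 0 < 1 - 4 * (p t x * r t x).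
Proof. unfold lorentzian. rewrite det_phi. lra. Qed.

Lemma g_phi t x : 0 < 1 - 4 * (p t x * r t x) -> g_ Psi phi t x = 1 - 4 * (p t x * r t x).
Proof. intros H. unfold g_. rewrite det_phi, Rabs_Ropp. apply Rabs_pos_eq. lra. Qed.

Lemma null_derive_psi t x : null_derive psi t x (Derive_n Psi 2 (t - x)) 0.
Proof. apply (null_derive_u (Derive Psi)). apply Derive_correct. exact (hPsi 2%nat (t - x)). Qed.

(* The two components of sqrt g * g^{mu nu} d_nu phi, in terms of p and r. *)
Let flux_u t x := - (2 * r t x * (1 - 2 * (psi t x * r t x))) * / sqrt (1 - 4 * (p t x * r t x)).
Let flux_ub t x := - ((p t x - psi t x + psi t x * (psi t x * r t x)) * (1 + 2 * (psi t x * r t x)))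
  * / sqrt (1 - 4 * (p t x * r t x)).

Lemma flux_u_E t x : 0 < 1 - 4 * (p t x * r t x) ->
  sumc (fun nu => sqrt (g_ Psi phi t x) * ginv Psi phi cu nu t x * d_ Psi nu phi t x) = flux_u t x.
Proof.
intros H. unfold sumc, ginv, inv2. rewrite det_phi, g_phi by exact H.
unfold g_metric, gr_metric, dPsi, d_, du, dub. rewrite d_u_phi, d_ub_phi. unfold u_, flux_u; fold (psi t x).
rewrite <- (sqrt_sqrt (1 - 4 * (p t x * r t x))) at 2 4 by lra.
assert (0 < sqrt (1 - 4 * (p t x * r t x))) by (apply sqrt_lt_R0; exact H).
field. lra.
Qed.

Lemma flux_ub_E t x : 0 < 1 - 4 * (p t x * r t x) ->
  sumc (fun nu => sqrt (g_ Psi phi t x) * ginv Psi phi cub nu t x * d_ Psi nu phi t x) = flux_ub t x.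
Proof.
intros H. unfold sumc, ginv, inv2. rewrite det_phi, g_phi by exact H.
unfold g_metric, gr_metric, dPsi, d_, du, dub. rewrite d_u_phi, d_ub_phi. unfold u_, flux_ub; fold (psi t x).
rewrite <- (sqrt_sqrt (1 - 4 * (p t x * r t x))) at 2 4 by lra.
assert (0 < sqrt (1 - 4 * (p t x * r t x))) by (apply sqrt_lt_R0; exact H).
field. lra.
Qed.

(** The equation is the string equation for phi + Psi times a factor that
    vanishes only where 2 Psi' r = 1.  Both sides are computed from the
    first derivatives of p and r; since p and r come from one potential,
    V p = U r, which is the single number [m]. *)
Lemma box_minus_source t x puu m rvv :
  null_derive p t x puu m -> null_derive r t x m rvv ->
  continuity_2d_pt p t x -> continuity_2d_pt r t x ->
  0 < 1 - 4 * (p t x * r t x) ->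
  box_g Psi phi t x - S0 Psi phi t x =
  - (4 * (1 - 2 * (psi t x * r t x)) ^ 2 / (1 - 4 * (p t x * r t x)) ^ 2)
  * ((1 - 2 * (p t x * r t x)) * m + r t x ^ 2 * puu + p t x ^ 2 * rvv).
Proof.
intros Hp Hr Cp Cr HG.
assert (CG : continuity_2d_pt (fun s y => 1 - 4 * (p s y * r s y)) t x).
{ apply continuity_2d_pt_minus; [apply continuity_2d_pt_const|].
  apply continuity_2d_pt_mult; [apply continuity_2d_pt_const|].
  apply continuity_2d_pt_mult; assumption. }
assert (Loc := locally_2d_pos _ _ _ CG HG). simpl in Loc.
pose proof (null_derive_psi t x) as HP.
assert (HPr := null_derive_mult _ _ _ _ _ _ _ _ HP Hr).
assert (Hpr := null_derive_mult _ _ _ _ _ _ _ _ Hp Hr).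
assert (HGd := null_derive_minus _ _ _ _ _ _ _ _ (null_derive_const 1 t x)
                (null_derive_scal 4 _ _ _ _ _ Hpr)).
assert (HI := null_derive_inv_sqrt (fun s y => 1 - 4 * (p s y * r s y)) _ _ _ _ HG HGd).
eassert (Hu : null_derive flux_u t x _ _).
{ unfold flux_u. apply null_derive_mult; [|exact HI].
  apply (null_derive_ext (fun s y => -1 * (2 * r s y * (1 - 2 * (psi s y * r s y)))));
    [intros; ring|].
  apply null_derive_scal. apply null_derive_mult.
  - apply null_derive_scal, Hr.
  - apply null_derive_minus; [apply null_derive_const|apply null_derive_scal, HPr]. }
eassert (Hub : null_derive flux_ub t x _ _).
{ unfold flux_ub. apply null_derive_mult; [|exact HI].
  apply (null_derive_ext (fun s y => -1 * ((p s y - psi s y + psi s y * (psi s y * r s y))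
       * (1 + 2 * (psi s y * r s y))))); [intros; ring|].
  apply null_derive_scal. apply null_derive_mult.
  - apply null_derive_plus.
    + apply null_derive_minus; [exact Hp|exact HP].
    + apply null_derive_mult; [exact HP|exact HPr].
  - apply null_derive_plus; [apply null_derive_const|apply null_derive_scal, HPr]. }
apply (null_derive_ext_loc _ (fun s y => sumc (fun nu =>
        sqrt (g_ Psi phi s y) * ginv Psi phi cu nu s y * d_ Psi nu phi s y))) in Hu.
2:{ apply (locally_2d_impl _ _ _ _) with (2 := Loc). apply locally_2d_forall.
    intros s y H. symmetry. apply flux_u_E, H. }
apply (null_derive_ext_loc _ (fun s y => sumc (fun nu =>
        sqrt (g_ Psi phi s y) * ginv Psi phi cub nu s y * d_ Psi nu phi s y))) in Hub.
2:{ apply (locally_2d_impl _ _ _ _) with (2 := Loc). apply locally_2d_forall.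
    intros s y H. symmetry. apply flux_ub_E, H. }
apply (null_derive_ext_loc _ (fun s y => / sqrt (g_ Psi phi s y))) in HI.
2:{ apply (locally_2d_impl _ _ _ _) with (2 := Loc). apply locally_2d_forall.
    intros s y H. rewrite g_phi; auto. }
assert (Eub : forall s y, 2 * r s y = d_ub phi s y) by (intros; symmetry; apply d_ub_phi).
assert (Eu : forall s y, p s y - psi s y + psi s y * (psi s y * r s y) = d_u Psi phi s y)
  by (intros; rewrite d_u_phi; ring).
assert (Hbb := null_derive_ext _ _ _ _ _ _ Eub (null_derive_scal 2 _ _ _ _ _ Hr)).
assert (Hbu := null_derive_ext _ _ _ _ _ _ Eu (null_derive_plus _ _ _ _ _ _ _ _
  (null_derive_minus _ _ _ _ _ _ _ _ Hp HP) (null_derive_mult _ _ _ _ _ _ _ _ HP HPr))).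
unfold box_g. unfold sumc at 1. unfold d_ at 1 3.
rewrite (d_u_null _ _ _ _ _ _ Hu), (d_ub_null _ _ _ _ _ Hub).
unfold S0. rewrite gr_E.
rewrite (d_u_null _ _ _ _ _ _ HI), (d_ub_null _ _ _ _ _ HI).
rewrite (d_u_null _ _ _ _ _ _ Hbb), (d_ub_null _ _ _ _ _ Hbb), (d_ub_null _ _ _ _ _ Hbu).
rewrite g_phi by exact HG. rewrite d_u_phi, d_ub_phi. unfold u_.
change (Derive_n Psi 1 (t - x)) with (psi t x). fold (psi t x).
set (P := psi t x). set (P2 := Derive_n Psi 2 (t - x)).
assert (HS := sqrt_sqrt (1 - 4 * (p t x * r t x)) (Rlt_le _ _ HG)).
assert (S : 0 < sqrt (1 - 4 * (p t x * r t x))) by (apply sqrt_lt_R0; exact HG).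
revert HS S HG. clearbody P P2.
generalize (p t x) (r t x). clear. intros p r HS S HG.
field [HS]. lra.
Qed.
End StringForm.

(** * Smooth functions of two variables *)
Lemma smooth2_cont f t x : smooth2 f -> continuity_2d_pt f t x.
Proof. intros H. exact (proj1 (H 1%nat t x)). Qed.

Lemma smooth2_Dt f : smooth2 f -> smooth2 (Dt f).
Proof. intros H n t x. exact (proj1 (proj2 (proj2 (proj2 (H (S n) t x))))). Qed.

Lemma smooth2_Dx f : smooth2 f -> smooth2 (Dx f).
Proof. intros H n t x. exact (proj2 (proj2 (proj2 (proj2 (H (S n) t x))))). Qed.

Definition U (f : R -> R -> R) (t x : R) : R := (Dt f t x - Dx f t x) / 2.
Definition V (f : R -> R -> R) (t x : R) : R := (Dt f t x + Dx f t x) / 2.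

Lemma smooth2_null_derive f t x : smooth2 f -> null_derive f t x (U f t x) (V f t x).
Proof.
intros H. destruct (H 1%nat t x) as (_ & H1 & H2 & _).
apply Derive_correct in H1, H2. unfold U, V. split.
- evar_last; [exact H1|]. change (Dt f t x = (Dt f t x - Dx f t x) / 2 + (Dt f t x + Dx f t x) / 2). field.
- evar_last; [exact H2|]. change (Dx f t x = (Dt f t x + Dx f t x) / 2 - (Dt f t x - Dx f t x) / 2). field.
Qed.

(** Smoothness by coinduction: it suffices to exhibit a class of continuous
    functions that is stable under both partial derivatives. *)
Lemma smooth2_by_class (P : (R -> R -> R) -> Prop) :
  (forall f, P f -> (forall t x, continuity_2d_pt f t x) /\
     exists ft fx, P ft /\ P fx /\ forall t x,
       is_derive (fun s => f s x) t (ft t x) /\ is_derive (fun y => f t y) x (fx t x)) ->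
  forall f, P f -> smooth2 f.
Proof.
intros HP f Pf n. revert f Pf. induction n as [|n IH]; intros f Pf t x;
  destruct (HP f Pf) as [C (ft & fx & Pt & Px & D)].
- split; [apply C|exact I].
- split; [apply C|]. split; [eexists; apply (D t x)|]. split; [eexists; apply (D t x)|].
  split.
  + replace (fun u v => Derive (fun z => f z v) u) with ft; [apply IH, Pt|].
    do 2 (apply functional_extensionality; intro). symmetry. apply is_derive_unique, D.
  + replace (fun u v => Derive (fun z => f u z) v) with fx; [apply IH, Px|].
    do 2 (apply functional_extensionality; intro). symmetry. apply is_derive_unique, D.
Qed.

Lemma smooth2_plus f g : smooth2 f -> smooth2 g -> smooth2 (fun t x => f t x + g t x).
Proof.
intros Hf Hg.
apply (smooth2_by_class (fun h => exists f g, smooth2 f /\ smooth2 g /\ h = fun t x => f t x + g t x)).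
2:{ exists f, g. auto. }
clear. intros h (f & g & Hf & Hg & ->). split.
{ intros t x. apply continuity_2d_pt_plus; apply smooth2_cont; auto. }
exists (fun t x => Dt f t x + Dt g t x), (fun t x => Dx f t x + Dx g t x).
split; [exists (Dt f), (Dt g); auto using smooth2_Dt|].
split; [exists (Dx f), (Dx g); auto using smooth2_Dx|].
intros t x. destruct (Hf 1%nat t x) as (_ & F1 & F2 & _), (Hg 1%nat t x) as (_ & G1 & G2 & _).
apply Derive_correct in F1, F2, G1, G2. split.
- exact (is_derive_plus (fun s => f s x) (fun s => g s x) t _ _ F1 G1).
- exact (is_derive_plus (fun y => f t y) (fun y => g t y) x _ _ F2 G2).
Qed.

Lemma smooth2_scal c f : smooth2 f -> smooth2 (fun t x => c * f t x).
Proof.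
intros Hf.
apply (smooth2_by_class (fun h => exists f, smooth2 f /\ h = fun t x => c * f t x)).
2:{ exists f. auto. }
clear. intros h (f & Hf & ->). split.
{ intros t x. apply continuity_2d_pt_mult; [apply continuity_2d_pt_const|apply smooth2_cont; auto]. }
exists (fun t x => c * Dt f t x), (fun t x => c * Dx f t x).
split; [exists (Dt f); auto using smooth2_Dt|].
split; [exists (Dx f); auto using smooth2_Dx|].
intros t x. destruct (Hf 1%nat t x) as (_ & F1 & F2 & _).
apply Derive_correct in F1, F2. split.
- exact (is_derive_scal (fun s => f s x) t c _ F1).
- exact (is_derive_scal (fun y => f t y) x c _ F2).
Qed.

Lemma smooth2_U f : smooth2 f -> smooth2 (U f).
Proof.
intros H. replace (U f) with (fun t x => / 2 * Dt f t x + (- / 2) * Dx f t x).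
- apply smooth2_plus; apply smooth2_scal; auto using smooth2_Dt, smooth2_Dx.
- do 2 (apply functional_extensionality; intro). unfold U. field.
Qed.

Lemma smooth2_V f : smooth2 f -> smooth2 (V f).
Proof.
intros H. replace (V f) with (fun t x => / 2 * Dt f t x + / 2 * Dx f t x).
- apply smooth2_plus; apply smooth2_scal; auto using smooth2_Dt, smooth2_Dx.
- do 2 (apply functional_extensionality; intro). unfold V. field.
Qed.

Lemma null_derive_unique f t x fu fv gu gv :
  null_derive f t x fu fv -> null_derive f t x gu gv -> fu = gu /\ fv = gv.
Proof.
intros F G. pose proof (Dt_null _ _ _ _ _ F). pose proof (Dx_null _ _ _ _ _ F).
pose proof (Dt_null _ _ _ _ _ G). pose proof (Dx_null _ _ _ _ _ G). lra.
Qed.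

Lemma smooth2_VU f t x : smooth2 f -> V (U f) t x = U (V f) t x.
Proof.
intros H.
assert (S : Dt (Dx f) t x = Dx (Dt f) t x).
{ unfold Dt, Dx. apply Schwarz.
  - apply locally_2d_forall. intros u v. repeat split.
    + apply (H 1%nat u v).
    + apply (H 1%nat u v).
    + exact (proj1 (proj2 (smooth2_Dx f H 1%nat u v))).
    + exact (proj1 (proj2 (proj2 (smooth2_Dt f H 1%nat u v)))).
  - exact (smooth2_cont _ t x (smooth2_Dt _ (smooth2_Dx f H))).
  - exact (smooth2_cont _ t x (smooth2_Dx _ (smooth2_Dt f H))). }
pose proof (smooth2_null_derive _ t x (smooth2_Dt f H)) as A.
pose proof (smooth2_null_derive _ t x (smooth2_Dx f H)) as B.
eassert (HU : null_derive (U f) t x _ _).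
{ apply (null_derive_ext (fun t x => / 2 * Dt f t x - / 2 * Dx f t x)); [intros; unfold U; field|].
  apply null_derive_minus; apply null_derive_scal; eassumption. }
eassert (HV : null_derive (V f) t x _ _).
{ apply (null_derive_ext (fun t x => / 2 * Dt f t x + / 2 * Dx f t x)); [intros; unfold V; field|].
  apply null_derive_plus; apply null_derive_scal; eassumption. }
destruct (null_derive_unique _ _ _ _ _ _ _ (smooth2_null_derive _ t x (smooth2_U f H)) HU) as [_ E1].
destruct (null_derive_unique _ _ _ _ _ _ _ (smooth2_null_derive _ t x (smooth2_V f H)) HV) as [E2 _].
rewrite E1, E2. revert S. unfold U, V. intros. lra.
Qed.

(** * Chain rules, Lipschitz bounds and inverse functions *)
Lemma differentiable_of_partials f f1 f2 x y :
  (forall x y, is_derive (fun s => f s y) x (f1 x y)) ->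
  is_derive (fun s => f x s) y f2 ->
  continuity_2d_pt f1 x y ->
  differentiable_pt_lim f x y (f1 x y) f2.
Proof.
intros H1 H2 C. apply filterdiff_differentiable_pt_lim.
pose proof (is_derive_filterdiff f x y f1 f2) as K.
apply K; [|exact H2|].
- apply filter_forall. intros [a b]. apply H1.
- apply continuity_2d_pt_filterlim in C. exact C.
Qed.

(** Along a curve the velocity (t', x') has the null components t' - x' and
    t' + x'; partial derivatives alone would not give a chain rule, whence the
    continuity hypotheses. *)
Lemma null_derive_curve f fu fv (T X : R -> R) s t' x' :
  (forall t x, null_derive f t x (fu t x) (fv t x)) ->
  continuity_2d_pt fu (T s) (X s) -> continuity_2d_pt fv (T s) (X s) ->
  is_derive T s t' -> is_derive X s x' ->
  is_derive (fun s => f (T s) (X s)) s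
    ((t' - x') * fu (T s) (X s) + (t' + x') * fv (T s) (X s)).
Proof.
intros H Cu Cv HT HX.
assert (D := differentiable_of_partials f (fun t x => fu t x + fv t x) _ (T s) (X s)
  (fun t x => proj1 (H t x)) (proj2 (H _ _)) (continuity_2d_pt_plus _ _ _ _ Cu Cv)).
apply is_derive_Reals in HT, HX.
evar_last; [apply is_derive_Reals, (derivable_pt_lim_comp_2d _ _ _ _ _ _ _ _ D HT HX)|].
simpl; ring.
Qed.

Lemma null_derive_uv F Fu Fv t x :
  (forall u v, is_derive (fun s => F s v) u (Fu u v)) ->
  (forall u v, is_derive (fun s => F u s) v (Fv u v)) ->
  continuity_2d_pt Fu (t - x) (t + x) ->
  null_derive (fun t x => F (t - x) (t + x)) t x (Fu (t - x) (t + x)) (Fv (t - x) (t + x)).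
Proof.
intros H1 H2 C.
assert (D := differentiable_of_partials F Fu _ (t - x) (t + x) H1 (H2 _ _) C).
assert (lin : forall (a b c : R), derivable_pt_lim (fun s => a + b * s) c b).
{ intros a b c. apply is_derive_Reals. auto_derive; auto; ring. }
split.
- apply (is_derive_ext (fun s => F (- x + 1 * s) (x + 1 * s))).
  { intros s. f_equal; ring. }
  evar_last.
  + apply is_derive_Reals, (derivable_pt_lim_comp_2d F (fun s => - x + 1 * s) (fun s => x + 1 * s) t).
    * replace (- x + 1 * t) with (t - x) by ring. replace (x + 1 * t) with (t + x) by ring. exact D.
    * apply lin.
    * apply lin.
  + simpl; ring.
- apply (is_derive_ext (fun s => F (t + -1 * s) (t + 1 * s))).
  { intros s. f_equal; ring. }
  evar_last.
  + apply is_derive_Reals, (derivable_pt_lim_comp_2d F (fun s => t + -1 * s) (fun s => t + 1 * s) x).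
    * replace (t + -1 * x) with (t - x) by ring. replace (t + 1 * x) with (t + x) by ring. exact D.
    * apply lin.
    * apply lin.
  + simpl; ring.
Qed.

Lemma Rabs_MVT f f' K a b :
  (forall x, Rmin a b <= x <= Rmax a b -> is_derive f x (f' x)) ->
  (forall x, Rmin a b <= x <= Rmax a b -> Rabs (f' x) <= K) ->
  Rabs (f b - f a) <= K * Rabs (b - a).
Proof.
intros H B. destruct (MVT_gen f a b f') as (c & Hc & E).
- intros x Hx. apply H. lra.
- intros x Hx. apply continuity_pt_filterlim, (ex_derive_continuous f). eexists. apply H, Hx.
- rewrite E, Rabs_mult. apply Rmult_le_compat_r; [apply Rabs_pos|]. apply B, Hc.
Qed.

(** Bounded partial derivatives make F Lipschitz.  This gives joint continuity
    of the inverse characteristic map before its derivatives are known to be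
    continuous. *)
Lemma continuity_2d_of_bounded_partials F F1 F2 K x y :
  (forall x y, is_derive (fun s => F s y) x (F1 x y)) ->
  (forall x y, is_derive (fun s => F x s) y (F2 x y)) ->
  (forall x y, Rabs (F1 x y) <= K) -> (forall x y, Rabs (F2 x y) <= K) ->
  continuity_2d_pt F x y.
Proof.
intros H1 H2 B1 B2 eps.
assert (HK : 0 <= K) by (eapply Rle_trans; [apply Rabs_pos|apply (B1 0 0)]).
assert (Hd : 0 < eps / (2 * K + 1)).
{ apply Rdiv_lt_0_compat; [apply cond_pos|lra]. }
exists (mkposreal _ Hd). simpl. intros u v Hu Hv.
replace (F u v - F x y) with ((F u v - F x v) + (F x v - F x y)) by ring.
eapply Rle_lt_trans; [apply Rabs_triang|].
pose proof (Rabs_MVT (fun s => F s v) (fun s => F1 s v) K x u (fun s _ => H1 s v) (fun s _ => B1 s v)).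
pose proof (Rabs_MVT (fun s => F x s) (fun s => F2 x s) K y v (fun s _ => H2 x s) (fun s _ => B2 x s)).
simpl in *.
apply Rle_lt_trans with (K * (eps / (2 * K + 1)) + K * (eps / (2 * K + 1))).
{ apply Rplus_le_compat; (eapply Rle_trans; [eassumption|]); apply Rmult_le_compat_l; lra. }
pose proof (cond_pos eps).
apply (Rmult_lt_reg_r (2 * K + 1)); [lra|]. field_simplify; lra.
Qed.

(** A slope bounded below makes f a bijection of the whole line: its growth is
    at least linear, so the intermediate value theorem reaches every value. *)
Lemma increasing_inverse f f' k :
  0 < k -> (forall x, is_derive f x (f' x)) -> (forall x, k <= f' x) ->
  exists g, (forall s, f (g s) = s) /\ (forall x, g (f x) = x) /\
    forall s, is_derive g s (/ f' (g s)).
Proof.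
intros Hk D B.
assert (grow : forall x y, x <= y -> k * (y - x) <= f y - f x).
{ intros x y H. destruct (MVT_gen f x y f') as (c & _ & E).
  - intros; apply D.
  - intros z _. apply continuity_pt_filterlim, (ex_derive_continuous f). eexists. apply D.
  - rewrite E. apply Rmult_le_compat_r; [lra|apply B]. }
assert (cont : continuity f).
{ intros z. apply continuity_pt_filterlim, (ex_derive_continuous f). eexists. apply D. }
assert (surj : forall s, {x | f x = s}).
{ intros s. set (L := (Rabs (s - f 0)) / k).
  assert (HL : 0 <= L) by (apply Rmult_le_pos; [apply Rabs_pos|apply Rlt_le, Rinv_0_lt_compat, Hk]).
  assert (EL : k * L = Rabs (s - f 0)) by (unfold L; field; lra).
  destruct (IVT_gen f (- L) L s cont) as (x & _ & E); [|exists x; exact E].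
  pose proof (grow 0 L HL) as A1. assert (A2 := grow (- L) 0 ltac:(lra)).
  pose proof (Rle_abs (s - f 0)). pose proof (Rle_abs (- (s - f 0))). rewrite Rabs_Ropp in *.
  split.
  - eapply Rle_trans; [apply Rmin_l|]. lra.
  - eapply Rle_trans; [|apply Rmax_r]. lra. }
set (g := fun s => proj1_sig (surj s)).
assert (fg : forall s, f (g s) = s) by (intros s; exact (proj2_sig (surj s))).
assert (inj : forall x y, f x = f y -> x = y).
{ intros x y E. destruct (Rtotal_order x y) as [H|[H|H]]; [|exact H|].
  - pose proof (grow x y ltac:(lra)). assert (0 < k * (y - x)) by (apply Rmult_lt_0_compat; lra). lra.
  - pose proof (grow y x ltac:(lra)). assert (0 < k * (x - y)) by (apply Rmult_lt_0_compat; lra). lra. }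
assert (gf : forall x, g (f x) = x) by (intros x; apply inj, fg).
exists g. split; [exact fg|]. split; [exact gf|].
assert (mono : forall s t, s <= t -> g s <= g t).
{ intros s t H. destruct (Rle_or_lt (g s) (g t)) as [|C]; [assumption|].
  pose proof (grow (g t) (g s) ltac:(lra)) as A. rewrite !fg in A.
  assert (0 < k * (g s - g t)) by (apply Rmult_lt_0_compat; lra). lra. }
assert (lip : forall s t, Rabs (g t - g s) <= / k * Rabs (t - s)).
{ assert (rate : forall s t, s <= t -> Rabs (g t - g s) <= / k * Rabs (t - s)).
  { intros s t H. pose proof (mono s t H). pose proof (grow (g s) (g t) H0) as A. rewrite !fg in A.
    rewrite !Rabs_pos_eq by lra. apply (Rmult_le_reg_l k); [exact Hk|].
    rewrite <- Rmult_assoc, Rinv_r by lra. lra. }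
  intros s t. destruct (Rle_or_lt s t) as [H|H]; [apply rate, H|].
  rewrite (Rabs_minus_sym (g t)), (Rabs_minus_sym t). apply rate. lra. }
assert (gcont : continuity g).
{ intros s e He. exists (k * e). split; [apply Rmult_lt_0_compat; lra|].
  intros t [_ Ht]. simpl in *. unfold R_dist in *.
  eapply Rle_lt_trans; [apply lip|]. apply (Rmult_lt_reg_l k); [exact Hk|].
  rewrite <- Rmult_assoc, Rinv_r by lra. lra. }
intros s. apply is_derive_Reals.
assert (Prf : forall a, g (s - 1) <= a <= g (s + 1) -> derivable_pt f a).
{ intros a _. exists (f' a). apply is_derive_Reals, D. }
assert (Pi : g (s - 1) <= g s <= g (s + 1)) by (split; apply mono; lra).
assert (E : derive_pt f (g s) (Prf (g s) Pi) = f' (g s)).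
{ apply derive_pt_eq_0, is_derive_Reals, D. }
pose proof (B (g s)).
replace (/ f' (g s)) with (1 / derive_pt f (g s) (Prf (g s) Pi)) by (rewrite E; field; lra).
apply (derivable_pt_lim_recip_interv f g (s - 1) (s + 1)).
- apply gcont.
- lra.
- lra.
- intros x _. unfold comp, id. apply fg.
- rewrite E. lra.
Qed.

(** * Families of functions with uniformly dominated derivatives *)

(** The index type carries the Cauchy data: the constants are uniform in [d],
    which is what makes the final constants independent of the data. *)
Fixpoint dominated_upto {D : Type} (w : D -> R -> R) (n : nat) (h : D -> R -> R) : Prop :=
  (exists C, 0 <= C /\ forall d x, Rabs (h d x) <= C * w d x) /\
  match n with
  | O => True
  | S n => (forall d x, ex_derive (h d) x) /\ dominated_upto w n (fun d => Derive (h d))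
  end.

Definition dominated {D : Type} (w : D -> R -> R) (h : D -> R -> R) : Prop :=
  forall n, dominated_upto w n h.

Definition unit_weight {D : Type} (d : D) (x : R) : R := 1.

Section Dominated.
Context {D : Type}.
Implicit Types (w h : D -> R -> R).

Lemma dominated_upto_bound w n h : dominated_upto w n h ->
  exists C, 0 <= C /\ forall d x, Rabs (h d x) <= C * w d x.
Proof. destruct n; intros H; apply H. Qed.

Lemma dominated_bound w h : dominated w h ->
  exists C, 0 <= C /\ forall d x, Rabs (h d x) <= C * w d x.
Proof. intros H. exact (dominated_upto_bound _ _ _ (H O)). Qed.

Lemma dominated_ex_derive w h d x : dominated w h -> ex_derive (h d) x.
Proof. intros H. apply (H 1%nat). Qed.

Lemma dominated_derive w h : dominated w h -> dominated w (fun d => Derive (h d)).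
Proof. intros H n. apply (H (S n)). Qed.

Lemma dominated_intro w h : (forall d, smooth1 (h d)) ->
  (forall k, exists C, 0 <= C /\ forall d x, Rabs (Derive_n (h d) k x) <= C * w d x) ->
  dominated w h.
Proof.
intros S B n. change h with (fun d => Derive_n (h d) 0).
generalize 0%nat as k. induction n as [|n IH]; intros k; (split; [apply B|]); [exact I|].
split; [intros d x; exact (S d (Datatypes.S k) x)|]. exact (IH (Datatypes.S k)).
Qed.

Lemma dominated_upto_pred w n h : dominated_upto w (S n) h -> dominated_upto w n h.
Proof.
revert h. induction n as [|n IH]; intros h H; (split; [apply H|]); [exact I|].
split; [apply H|]. apply IH, H.
Qed.

Lemma dominated_le w1 w2 K h : 0 <= K -> (forall d x, w1 d x <= K * w2 d x) ->
  dominated w1 h -> dominated w2 h.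
Proof.
intros HK Hw H n. specialize (H n). revert h H.
induction n as [|n IH]; intros h [[C [HC B]] H]; split.
2: exact I.
3: split; [apply H|apply IH, H].
all: exists (C * K); split; [apply Rmult_le_pos; auto|]; intros d x; eapply Rle_trans; [apply B|];
  rewrite Rmult_assoc; apply Rmult_le_compat_l; auto.
Qed.

Lemma dominated_upto_plus w n h1 h2 : dominated_upto w n h1 -> dominated_upto w n h2 ->
  dominated_upto w n (fun d x => h1 d x + h2 d x).
Proof.
revert h1 h2. induction n as [|n IH]; intros h1 h2 [[C1 [P1 B1]] H1] [[C2 [P2 B2]] H2]; split.
2: exact I.
3:{ split.
  - intros d x. apply (ex_derive_plus (h1 d) (h2 d)); [apply H1|apply H2].
  - replace (fun d => Derive (fun x => h1 d x + h2 d x))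
      with (fun d x => Derive (h1 d) x + Derive (h2 d) x); [apply IH; [apply H1|apply H2]|].
    do 2 (apply functional_extensionality; intro). symmetry. apply Derive_plus; [apply H1|apply H2]. }
all: exists (C1 + C2); split; [lra|]; intros d x; eapply Rle_trans; [apply Rabs_triang|];
  specialize (B1 d x); specialize (B2 d x); lra.
Qed.

Lemma dominated_plus w h1 h2 : dominated w h1 -> dominated w h2 ->
  dominated w (fun d x => h1 d x + h2 d x).
Proof. intros H1 H2 n. apply dominated_upto_plus; auto. Qed.

Lemma dominated_upto_mult w1 w2 w n h1 h2 : (forall d x, w1 d x * w2 d x <= w d x) ->
  dominated_upto w1 n h1 -> dominated_upto w2 n h2 ->
  dominated_upto w n (fun d x => h1 d x * h2 d x).
Proof.
intros Hw. revert h1 h2.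
induction n as [|n IH]; intros h1 h2 HH1 HH2; pose proof HH1 as [[C1 [P1 B1]] H1];
  pose proof HH2 as [[C2 [P2 B2]] H2]; split.
2: exact I.
3:{ split.
  - intros d x. apply (ex_derive_mult (h1 d) (h2 d)); [apply H1|apply H2].
  - replace (fun d => Derive (fun x => h1 d x * h2 d x))
      with (fun d x => Derive (h1 d) x * h2 d x + h1 d x * Derive (h2 d) x).
    + apply dominated_upto_plus; apply IH.
      * apply H1.
      * apply dominated_upto_pred, HH2.
      * apply dominated_upto_pred, HH1.
      * apply H2.
    + do 2 (apply functional_extensionality; intro). symmetry. apply Derive_mult; [apply H1|apply H2]. }
all: exists (C1 * C2); split; [apply Rmult_le_pos; auto|]; intros d x; rewrite Rabs_mult;
  apply Rle_trans with ((C1 * w1 d x) * (C2 * w2 d x));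
  [apply Rmult_le_compat; auto using Rabs_pos|];
  replace (C1 * w1 d x * (C2 * w2 d x)) with (C1 * C2 * (w1 d x * w2 d x)) by ring;
  apply Rmult_le_compat_l; [apply Rmult_le_pos; auto|auto].
Qed.

Lemma dominated_mult w1 w2 w h1 h2 : (forall d x, w1 d x * w2 d x <= w d x) ->
  dominated w1 h1 -> dominated w2 h2 -> dominated w (fun d x => h1 d x * h2 d x).
Proof. intros Hw H1 H2 n. eapply dominated_upto_mult; eauto. Qed.

Lemma dominated_mult_l w h1 h2 :
  dominated unit_weight h1 -> dominated w h2 -> dominated w (fun d x => h1 d x * h2 d x).
Proof. apply dominated_mult. intros; unfold unit_weight; lra. Qed.

Lemma dominated_const c : dominated unit_weight (fun (_ : D) _ => c).
Proof.
intros n. revert c. induction n as [|n IH]; intros c; split; try exact I.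
3:{ split; [intros; apply ex_derive_const|].
  replace (fun _ => Derive (fun _ : R => c)) with (fun (_ : D) (_ : R) => 0); [apply IH|].
  do 2 (apply functional_extensionality; intro). symmetry. apply Derive_const. }
all: exists (Rabs c); split; [apply Rabs_pos|]; intros; unfold unit_weight; lra.
Qed.

Lemma dominated_scal w c h : dominated w h -> dominated w (fun d x => c * h d x).
Proof. apply dominated_mult_l, dominated_const. Qed.

(** (1/h)' = - h' (1/h)^2 only involves 1/h itself, so the bounds on the
    derivatives of 1/h follow by induction on their order. *)
Lemma dominated_inv h k : 0 < k -> (forall d x, k <= h d x) ->
  dominated unit_weight h -> dominated unit_weight (fun d x => / h d x).
Proof.
intros Hk Hh H n. induction n as [|n IH]; split; try exact I.
3:{ split.
  - intros d x. apply (ex_derive_inv (h d)); [apply (dominated_ex_derive _ _ _ _ H)|].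
    specialize (Hh d x). lra.
  - replace (fun d => Derive (fun x => / h d x))
      with (fun d x => (-1 * Derive (h d) x) * (/ h d x * / h d x)).
    + apply (dominated_upto_mult unit_weight unit_weight); [intros; unfold unit_weight; lra| |].
      * apply (dominated_scal _ (-1) _ (dominated_derive _ _ H)).
      * apply (dominated_upto_mult unit_weight unit_weight); [intros; unfold unit_weight; lra| |]; exact IH.
    + do 2 (apply functional_extensionality; intro). rewrite Derive_inv.
      * field. specialize (Hh x x0). lra.
      * apply (dominated_ex_derive _ _ _ _ H).
      * specialize (Hh x x0). lra. }
all: exists (/ k); split; [apply Rlt_le, Rinv_0_lt_compat, Hk|]; intros d x; unfold unit_weight;
  specialize (Hh d x); rewrite Rmult_1_r, Rabs_pos_eq by (apply Rlt_le, Rinv_0_lt_compat; lra);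
  apply Rinv_le_contravar; lra.
Qed.

(** As for the inverse: the derivative of i = 1/sqrt h is - h' i^3 / 2. *)
Lemma dominated_inv_sqrt h k : 0 < k -> (forall d x, k <= h d x) ->
  dominated unit_weight h -> dominated unit_weight (fun d x => / sqrt (h d x)).
Proof.
intros Hk Hh H.
assert (P : forall d x, 0 < sqrt (h d x)) by (intros d x; apply sqrt_lt_R0; specialize (Hh d x); lra).
assert (DD : forall d x, is_derive (fun x => / sqrt (h d x)) x
   ((- / 2 * Derive (h d) x) * (/ sqrt (h d x) * (/ sqrt (h d x) * / sqrt (h d x))))).
{ intros d x. specialize (P d x). specialize (Hh d x).
  auto_derive.
  - split; [exact (dominated_ex_derive _ _ d x H)|]. repeat split; lra.
  - try rewrite sqrt_sqrt by lra. replace (fun x : R => h d x) with (h d) by reflexivity.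
    rewrite <- (sqrt_sqrt (h d x)) at 2 by lra. field. lra. }
intros n. induction n as [|n IH]; split; try exact I.
3:{ split.
  - intros d x. eexists. apply DD.
  - replace (fun d => Derive (fun x => / sqrt (h d x)))
      with (fun d x => (- / 2 * Derive (h d) x) * (/ sqrt (h d x) * (/ sqrt (h d x) * / sqrt (h d x)))).
    + apply (dominated_upto_mult unit_weight unit_weight); [intros; unfold unit_weight; lra| |].
      * apply (dominated_scal _ (- / 2) _ (dominated_derive _ _ H)).
      * apply (dominated_upto_mult unit_weight unit_weight); [intros; unfold unit_weight; lra|exact IH|].
        apply (dominated_upto_mult unit_weight unit_weight); [intros; unfold unit_weight; lra| |]; exact IH.
    + do 2 (apply functional_extensionality; intro). symmetry. apply is_derive_unique, DD. }
all: exists (/ sqrt k); (split; [apply Rlt_le, Rinv_0_lt_compat, sqrt_lt_R0, Hk|]); intros d x; unfold unit_weight;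
  specialize (Hh d x); rewrite Rmult_1_r, Rabs_pos_eq by (apply Rlt_le, Rinv_0_lt_compat; auto);
  apply Rinv_le_contravar; [apply sqrt_lt_R0, Hk|apply sqrt_le_1_alt, Hh].
Qed.
End Dominated.

(** * The weight Lambda^{-1/2} *)
Definition rate (gamma x : R) : R := Rpower (Lambda gamma x) (- / 2).

Lemma jap_sqr x : jap x * jap x = 1 + x ^ 2.
Proof. apply sqrt_sqrt. pose proof (pow2_ge_0 x). lra. Qed.

Lemma jap_ge_1 x : 1 <= jap x.
Proof. rewrite <- sqrt_1. apply sqrt_le_1_alt. pose proof (pow2_ge_0 x). lra. Qed.

Lemma jap_ge_abs x : Rabs x <= jap x.
Proof.
unfold jap. rewrite <- sqrt_Rsqr_abs. apply sqrt_le_1_alt. unfold Rsqr. simpl. lra.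
Qed.

Lemma jap_le x y A B : 0 <= A -> 0 <= B -> Rabs x <= A + B * Rabs y ->
  jap x <= (1 + A + B) * jap y.
Proof.
intros HA HB H. pose proof (jap_ge_1 y). pose proof (jap_ge_abs y).
apply Rle_trans with (1 + Rabs x).
- unfold jap. rewrite <- (sqrt_Rsqr (1 + Rabs x)) by (pose proof (Rabs_pos x); lra).
  apply sqrt_le_1_alt. unfold Rsqr. pose proof (Rabs_pos x).
  rewrite <- (pow2_abs x). simpl. nra.
- assert (B * Rabs y <= B * jap y) by (apply Rmult_le_compat_l; auto). nra.
Qed.

Lemma rate_E gamma x : rate gamma x = Rpower (jap x) (- (1 + gamma)).
Proof. unfold rate, Lambda. rewrite Rpower_mult. f_equal. field. Qed.

Lemma rate_pos gamma x : 0 < rate gamma x.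
Proof. apply exp_pos. Qed.

Lemma Rpower_1_l y : Rpower 1 y = 1.
Proof. unfold Rpower. rewrite ln_1, Rmult_0_r. apply exp_0. Qed.

Lemma Rpower_neg_le a b y : 0 < a <= b -> 0 <= y -> Rpower b (- y) <= Rpower a (- y).
Proof.
intros H Hy. rewrite !Rpower_Ropp. apply Rinv_le_contravar; [apply exp_pos|].
apply Rle_Rpower_l; lra.
Qed.

Lemma rate_le_1 gamma x : 0 < gamma -> rate gamma x <= 1.
Proof.
intros H. rewrite rate_E. apply Rle_trans with (Rpower 1 (- (1 + gamma))); [|rewrite Rpower_1_l; lra].
apply Rpower_neg_le; [|lra]. pose proof (jap_ge_1 x). lra.
Qed.

Lemma rate_comparable gamma K x y : 0 < gamma -> 0 < K -> jap x <= K * jap y ->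
  rate gamma y <= Rpower K (1 + gamma) * rate gamma x.
Proof.
intros Hg HK H. rewrite !rate_E. pose proof (jap_gt0 x). pose proof (jap_gt0 y).
apply Rle_trans with (Rpower K (1 + gamma) * Rpower (K * jap y) (- (1 + gamma))).
- rewrite <- Rpower_mult_distr by lra.
  rewrite <- Rmult_assoc, <- Rpower_plus.
  replace (1 + gamma + - (1 + gamma)) with 0 by ring. rewrite Rpower_O by lra. lra.
- apply Rmult_le_compat_l; [apply Rlt_le, exp_pos|]. apply Rpower_neg_le; lra.
Qed.

Lemma rate_sqr_Lambda gamma x : rate gamma x ^ 2 * Lambda gamma x = 1.
Proof.
unfold rate. set (L := Lambda gamma x). assert (0 < L) by apply exp_pos.
simpl. rewrite Rmult_1_r, <- Rpower_plus. replace (- / 2 + - / 2) with (- (1)) by field.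
rewrite Rpower_Ropp, Rpower_1 by assumption. field. lra.
Qed.

(** The square of the weight is integrable; this is where the exponent
    2 + 2 gamma of Lambda is at least 2. *)
Lemma rate_sqr_le gamma x : 0 < gamma -> rate gamma x ^ 2 <= / (1 + x ^ 2).
Proof.
intros Hg. pose proof (jap_ge_1 x). pose proof (jap_gt0 x).
apply Rle_trans with (Rpower (jap x) (- (1)) * Rpower (jap x) (- (1))).
- rewrite rate_E. simpl. rewrite Rmult_1_r.
  assert (Rpower (jap x) (- (1 + gamma)) <= Rpower (jap x) (- (1))) by (apply Rle_Rpower; lra).
  apply Rmult_le_compat; try assumption; apply Rlt_le, exp_pos.
- rewrite !Rpower_Ropp, !Rpower_1 by assumption. rewrite <- Rinv_mult, jap_sqr. lra.
Qed.

(** * Pointwise decay from the weighted energy *)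
Lemma is_RInt_gen_ge_part F E a b : (forall x, continuous F x) -> (forall x, 0 <= F x) ->
  is_RInt_gen F (Rbar_locally m_infty) (Rbar_locally p_infty) E -> a <= b ->
  RInt F a b <= E.
Proof.
intros C P H Hab.
assert (X : forall a b, ex_RInt F a b)
  by (intros; apply (ex_RInt_continuous (V:=R_CompleteNormedModule)); intros; apply C).
destruct (Rle_or_lt (RInt F a b) E) as [|L]; [assumption|exfalso].
assert (He : 0 < RInt F a b - E) by lra.
destruct (H (ball E (mkposreal _ He)) (locally_ball _ _)) as [Q S [A HA] [B HB] HQS].
set (a1 := Rmin (A - 1) a). set (b1 := Rmax (B + 1) b).
assert (a1 <= a /\ a1 < A) by (unfold a1; pose proof (Rmin_l (A-1) a); pose proof (Rmin_r (A-1) a); lra).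
assert (b <= b1 /\ B < b1) by (unfold b1; pose proof (Rmax_l (B+1) b); pose proof (Rmax_r (B+1) b); lra).
destruct (HQS a1 b1 (HA a1 ltac:(simpl; lra)) (HB b1 ltac:(simpl; lra))) as (y & Hy & By).
simpl in Hy. apply (is_RInt_unique (V:=R_CompleteNormedModule)) in Hy. unfold ball in By; simpl in By. unfold AbsRing_ball, abs, minus, plus, opp in By; simpl in By.
apply Rabs_lt_between in By.
pose proof (RInt_Chasles F a1 a b1 (X _ _) (X _ _)) as E1.
pose proof (RInt_Chasles F a b b1 (X _ _) (X _ _)) as E2.
unfold plus in E1, E2; simpl in E1, E2.
assert (0 <= RInt F a1 a) by (apply RInt_ge_0; [lra|apply X|auto]).
assert (0 <= RInt F b b1) by (apply RInt_ge_0; [lra|apply X|auto]).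
lra.
Qed.

Lemma Lambda_continuous gamma x : continuous (Lambda gamma) x.
Proof.
apply (ex_derive_continuous (Lambda gamma)).
unfold Lambda, jap, Rpower. pose proof (pow2_ge_0 x) as Hx. simpl in Hx.
auto_derive. repeat split; auto; try apply sqrt_lt_R0; lra.
Qed.

Lemma Derive_n_continuous f k x : smooth1 f -> continuous (Derive_n f k) x.
Proof. intros H. apply (ex_derive_continuous (Derive_n f k)). exact (H (S k) x). Qed.

(** For g = f^{(k)}, the primitive - g(s)^2 (x + 1 - s) vanishes at x + 1 and
    equals - g(x)^2 at x, so g(x)^2 is the integral over [x, x+1] of
    g^2 - 2 g g' (x + 1 - s) <= 2 g^2 + g'^2.  On such an interval Lambda varies
    by a bounded factor, and the weighted integrals are bounded by I0. *)
Lemma weighted_sobolev gamma I0 : 0 < gamma ->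
  forall k, exists C, 0 <= C /\ forall f fb, smooth1 f -> smooth1 fb -> energy_bound gamma I0 f fb ->
  forall x, Rabs (Derive_n f k x) <= C * rate gamma x /\ Rabs (Derive_n fb k x) <= C * rate gamma x.
Proof.
intros Hg k.
set (K := Rpower 3 (2 + 2 * gamma)).
exists (sqrt (3 * (K * Rabs I0))). split; [apply sqrt_pos|].
intros f fb Sf Sfb HE x.
assert (HK : 0 < K) by apply exp_pos.
set (F := fun k x => Lambda gamma x * ((Rabs (Derive_n f k x)) ^ 2 + (Rabs (Derive_n fb k x)) ^ 2)).
assert (Fc : forall k x, continuous (F k) x).
{ intros j y. unfold F. apply (continuous_mult (Lambda gamma)); [apply Lambda_continuous|].
  apply (continuous_ext (fun x => Derive_n f j x * Derive_n f j x + Derive_n fb j x * Derive_n fb j x)).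
  { intros z. rewrite !pow2_abs. simpl. ring. }
  apply (continuous_plus (fun x => Derive_n f j x * Derive_n f j x));
    apply (continuous_mult (K:=R_AbsRing)); apply Derive_n_continuous; assumption. }
assert (LP : forall y, 0 < Lambda gamma y) by (intros; apply exp_pos).
assert (Fp : forall k x, 0 <= F k x).
{ intros j y. apply Rmult_le_pos; [apply Rlt_le, LP|]. apply Rplus_le_le_0_compat; apply pow2_ge_0. }
assert (FI : forall j, RInt (F j) x (x + 1) <= Rabs I0).
{ intros j. destruct (HE j) as (E & H1 & H2). pose proof (Rle_abs I0).
  pose proof (is_RInt_gen_ge_part _ _ x (x + 1) (Fc j) (Fp j) H1). lra. }
assert (FX : forall j, ex_RInt (F j) x (x + 1))
  by (intros; apply (ex_RInt_continuous (V:=R_CompleteNormedModule)); intros; apply Fc).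
assert (LL : forall s, x <= s <= x + 1 -> Lambda gamma x <= K * Lambda gamma s).
{ intros s Hs. unfold Lambda, K. rewrite Rpower_mult_distr by (try apply jap_gt0; lra).
  apply Rle_Rpower_l; [lra|]. split; [apply jap_gt0|].
  replace 3 with (1 + 1 + 1) by ring. apply jap_le; try lra.
  replace x with (- (s - x) + s) by ring. eapply Rle_trans; [apply Rabs_triang|].
  rewrite Rabs_Ropp, Rabs_pos_eq by lra. lra. }
assert (main : forall h, smooth1 h ->
   (forall j s, (Derive_n h j s) ^ 2 * Lambda gamma s <= F j s) ->
   Rabs (Derive_n h k x) <= sqrt (3 * (K * Rabs I0)) * rate gamma x).
{ intros h Sh Hh.
  set (g := Derive_n h k). set (g' := Derive_n h (S k)).
  assert (Dg : forall s, is_derive g s (g' s)) by (intros s; apply Derive_correct; exact (Sh (S k) s)).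
  assert (R1 : is_RInt (fun s => (g s ^ 2 - 2 * g s * g' s * (x + 1 - s)))
       x (x + 1) (g x ^ 2)).
  { evar_last.
    - apply (is_RInt_derive (fun s => - (g s ^ 2 * (x + 1 - s)))).
      + intros s _. pose proof (Dg s) as Ds. evar_last.
        * apply (is_derive_opp (fun s => g s ^ 2 * (x + 1 - s))).
          apply (is_derive_mult (fun s => g s ^ 2) (fun s => x + 1 - s));
            [|auto_derive; [exact I|reflexivity]|exact Rmult_comm].
          apply (is_derive_pow g 2 s _ Ds).
        * unfold opp, plus, mult; simpl. ring.
      + intros s _.
        assert (continuous g s) by (apply Derive_n_continuous, Sh).
        assert (continuous g' s) by (apply Derive_n_continuous, Sh).
        apply (continuous_ext (fun s => g s * g s + (-2 * (x + 1 - s)) * (g s * g' s))); [intros; simpl; ring|].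
        apply (continuous_plus (fun s => g s * g s)); apply (continuous_mult (K:=R_AbsRing)); auto.
        * apply (ex_derive_continuous (fun s => -2 * (x + 1 - s))). auto_derive; auto.
        * apply (continuous_mult (K:=R_AbsRing)); auto.
    - unfold minus, plus, opp; simpl. ring. }
  assert (R2 := is_RInt_scal _ _ _ (Lambda gamma x) _ R1). unfold scal in R2; simpl in R2. unfold mult in R2; simpl in R2.
  assert (R3 := is_RInt_scal _ _ _ K _ (is_RInt_plus _ _ _ _ _ _ (is_RInt_scal _ _ _ 2 _ (RInt_correct _ _ _ (FX k))) (RInt_correct _ _ _ (FX (S k))))).
  unfold scal, plus in R3; simpl in R3. unfold mult in R3; simpl in R3.
  assert (A : Lambda gamma x * (g x ^ 2) <= K * (2 * RInt (F k) x (x + 1) + RInt (F (S k)) x (x + 1))).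
  { apply (is_RInt_le _ _ x (x + 1) _ _ ltac:(lra) R2 R3). intros s Hs.
    assert (H1 := Hh k s). assert (H2 := Hh (S k) s). fold g in H1. fold g' in H2.
    apply Rle_trans with (Lambda gamma x * (2 * g s ^ 2 + g' s ^ 2)).
    - apply Rmult_le_compat_l; [apply Rlt_le, LP|].
      assert (- (2 * g s * g' s * (x + 1 - s)) <= g s ^ 2 + g' s ^ 2); [|lra].
      assert (0 <= (x + 1 - s) <= 1) by lra.
      pose proof (pow2_ge_0 (g s + g' s * (x + 1 - s))).
      assert (g' s ^ 2 * (x + 1 - s) ^ 2 <= g' s ^ 2 * 1).
      { apply Rmult_le_compat_l; [apply pow2_ge_0|]. simpl. nra. }
      nra.
    - apply Rle_trans with (K * Lambda gamma s * (2 * g s ^ 2 + g' s ^ 2)).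
      + apply Rmult_le_compat_r; [|apply LL; lra]. pose proof (pow2_ge_0 (g s)). pose proof (pow2_ge_0 (g' s)). lra.
      + rewrite Rmult_assoc. apply Rmult_le_compat_l; [lra|]. lra. }
  assert (B : Lambda gamma x * (g x ^ 2) <= 3 * (K * Rabs I0)).
  { eapply Rle_trans; [apply A|].
    replace (3 * (K * Rabs I0)) with (K * (2 * Rabs I0 + Rabs I0)) by ring.
    apply Rmult_le_compat_l; [lra|]. pose proof (FI k). pose proof (FI (S k)). lra. }
  rewrite <- (Rabs_pos_eq (sqrt _ * rate gamma x)) by (apply Rmult_le_pos; [apply sqrt_pos|apply Rlt_le, rate_pos]).
  apply Rsqr_le_abs_0. rewrite Rsqr_mult, Rsqr_sqrt
    by (apply Rmult_le_pos; [lra|]; apply Rmult_le_pos; [lra|apply Rabs_pos]).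
  unfold Rsqr. fold g. pose proof (rate_sqr_Lambda gamma x) as WL. pose proof (rate_pos gamma x).
  apply Rmult_le_compat_r with (r := rate gamma x ^ 2) in B; [|apply pow2_ge_0].
  replace (Lambda gamma x * g x ^ 2 * rate gamma x ^ 2) with (g x ^ 2 * (rate gamma x ^ 2 * Lambda gamma x)) in B by ring.
  rewrite WL in B. lra. }
split; apply main; auto; intros j s; unfold F; rewrite !pow2_abs; rewrite Rmult_comm;
  apply Rmult_le_compat_l; try (apply Rlt_le, LP).
- pose proof (pow2_ge_0 (Derive_n fb j s)). lra.
- pose proof (pow2_ge_0 (Derive_n f j s)). lra.
Qed.

(** * Characteristic coordinates *)
Definition primitive (h : R -> R) (x : R) : R := RInt h 0 x.

Lemma primitive_derive h x : (forall s, continuous h s) -> is_derive (primitive h) x (h x).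
Proof.
intros H. apply (is_derive_RInt h _ 0); [|apply H].
apply filter_forall. intros b. apply (RInt_correct (V:=R_CompleteNormedModule)).
apply (ex_RInt_continuous (V:=R_CompleteNormedModule)). intros; apply H.
Qed.

Lemma primitive_0 h : primitive h 0 = 0.
Proof. apply (RInt_point (V:=R_CompleteNormedModule)). Qed.

Lemma eq_of_derive (f g d : R -> R) x0 x : (forall s, is_derive f s (d s)) -> (forall s, is_derive g s (d s)) ->
  f x0 = g x0 -> f x = g x.
Proof.
intros Hf Hg E.
pose proof (Rabs_MVT (fun s => f s - g s) (fun _ => 0) 0 x0 x) as A.
assert (Rabs (f x - g x - (f x0 - g x0)) <= 0 * Rabs (x - x0)).
{ apply A; intros s _; [|rewrite Rabs_R0; lra].
  evar_last; [apply (is_derive_minus f g); [apply Hf|apply Hg]|]. unfold minus, plus, opp; simpl; ring. }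
pose proof (Rabs_pos (f x - g x - (f x0 - g x0))).
assert (H1 : Rabs (f x - g x - (f x0 - g x0)) = 0) by lra.
apply Rabs_eq_0 in H1. lra.
Qed.

(** A string is a sum of two null curves: for suitable parameters alpha and beta of
    the two characteristic families, d(phi + Psi) = a d alpha + b d beta,
    d(t - x) = d alpha + b^2 d beta and d(t + x) = d beta + a^2 d alpha.  On the
    line t = 0 this gives d alpha = - [dens a b] dy and d beta = [dens b a] dz. *)
Definition dens (a b : R -> R) (y : R) : R := (1 + b y ^ 2) / (1 - (a y * b y) ^ 2).

(** The values of t - x and t + x at the point with feet y and z. *)
Definition char_u (a b : R -> R) (y z : R) : R :=
  - primitive (dens a b) y + primitive (fun s => b s ^ 2 * dens b a s) z.
Definition char_v (a b : R -> R) (y z : R) : R :=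
  - primitive (fun s => a s ^ 2 * dens a b s) y + primitive (dens b a) z.

Record small_pair (a b : R -> R) : Prop := {
  small_cont_l : forall y, continuous a y;
  small_cont_r : forall y, continuous b y;
  small_bound : exists M, forall y, a y ^ 2 <= M /\ b y ^ 2 <= M;
  small_prod : forall y z, Rabs (a y * b z) <= / 2 }.

Record characteristic_coordinates (a b : R -> R) (Y Z : R -> R -> R) : Prop := {
  cc_u : forall t x, char_u a b (Y t x) (Z t x) = t - x;
  cc_v : forall t x, char_v a b (Y t x) (Z t x) = t + x;
  cc_unique : forall y z t x, char_u a b y z = t - x -> char_v a b y z = t + x ->
    Y t x = y /\ Z t x = z;
  cc_Y : forall t x, null_derive Y t x
    (- / (dens a b (Y t x) * (1 - (a (Y t x) * b (Z t x)) ^ 2)))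
    (b (Z t x) ^ 2 / (dens a b (Y t x) * (1 - (a (Y t x) * b (Z t x)) ^ 2)));
  cc_Z : forall t x, null_derive Z t x
    (- (a (Y t x) ^ 2 / (dens b a (Z t x) * (1 - (a (Y t x) * b (Z t x)) ^ 2))))
    (/ (dens b a (Z t x) * (1 - (a (Y t x) * b (Z t x)) ^ 2)));
  cc_cont_Y : forall t x, continuity_2d_pt Y t x;
  cc_cont_Z : forall t x, continuity_2d_pt Z t x }.

Lemma small_pair_sym a b : small_pair a b -> small_pair b a.
Proof. intros [A B [M K] C]. split; auto.
- exists M. intros y. split; apply K.
- intros. rewrite Rmult_comm. auto.
Qed.

Lemma small_sqr a b y z : small_pair a b -> 0 <= (a y * b z) ^ 2 <= / 4.
Proof.
intros H. pose proof (small_prod _ _ H y z) as S. split; [apply pow2_ge_0|].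
rewrite <- pow2_abs. pose proof (Rabs_pos (a y * b z)). simpl. nra.
Qed.

Lemma dens_ge a b y : small_pair a b -> 1 + b y ^ 2 <= dens a b y.
Proof.
intros H. pose proof (small_sqr a b y y H). pose proof (pow2_ge_0 (b y)). unfold dens.
apply (Rmult_le_reg_r (1 - (a y * b y) ^ 2)); [lra|].
unfold Rdiv. rewrite Rmult_assoc, Rinv_l by lra. nra.
Qed.

Lemma dens_ge_1 a b y : small_pair a b -> 1 <= dens a b y.
Proof. intros H. pose proof (dens_ge a b y H). pose proof (pow2_ge_0 (b y)). lra. Qed.

Lemma continuous_Rmult (f g : R -> R) x : continuous f x -> continuous g x -> continuous (fun s => f s * g s) x.
Proof. apply (continuous_mult (K:=R_AbsRing)). Qed.

Lemma dens_continuous a b y : small_pair a b -> continuous (dens a b) y.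
Proof.
intros H. pose proof (small_cont_l _ _ H y) as Ca. pose proof (small_cont_r _ _ H y) as Cb.
unfold dens, Rdiv. apply continuous_Rmult.
- apply (continuous_plus (fun _ => 1)); [apply continuous_const|].
  apply (continuous_ext (fun s => b s * b s)); [intros; simpl; ring|]. apply continuous_Rmult; exact Cb.
- apply (continuous_comp (fun y => 1 - (a y * b y) ^ 2) Rinv).
  + apply (continuous_minus (fun _ => 1)); [apply continuous_const|].
    apply (continuous_ext (fun s => (a s * b s) * (a s * b s))); [intros; simpl; ring|].
    apply continuous_Rmult; apply continuous_Rmult; assumption.
  + apply (continuous_Rinv). pose proof (small_sqr a b y y H). simpl. simpl in H0. lra.
Qed.

Lemma sqr_dens_continuous a b y : small_pair a b -> continuous (fun s => a s ^ 2 * dens a b s) y.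
Proof.
intros H. apply continuous_Rmult; [|apply dens_continuous, H].
apply (continuous_ext (fun s => a s * a s)); [intros; simpl; ring|].
apply continuous_Rmult; apply (small_cont_l _ _ H).
Qed.

Lemma continuous_comp_2d (k : R -> R) f t x :
  (forall s, continuous k s) -> continuity_2d_pt f t x -> continuity_2d_pt (fun t x => k (f t x)) t x.
Proof.
intros K C. apply continuity_1d_2d_pt_comp; [|exact C].
apply continuity_pt_filterlim, K.
Qed.

Lemma inv_bound A B E M : 1 <= A -> 0 <= B <= M -> 0 <= E <= / 4 ->
  0 <= / (A * (1 - E)) <= 2 /\ 0 <= B / (A * (1 - E)) <= 2 * M.
Proof.
intros HA HB HE.
assert (HAE : 1 * (1 - / 4) <= A * (1 - E)) by (apply Rmult_le_compat; lra).
assert (Q : 0 < / (A * (1 - E))) by (apply Rinv_0_lt_compat; lra).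
assert (R : / (A * (1 - E)) <= 2).
{ apply (Rmult_le_reg_r (A * (1 - E))); [lra|]. rewrite Rinv_l; lra. }
split; [lra|]. unfold Rdiv. split; [apply Rmult_le_pos; lra|].
rewrite Rmult_comm. apply Rmult_le_compat; lra.
Qed.

(** With v = t + x fixed, the second equation gives z as a function of y, and the
    first becomes an equation for y whose slope is dens * (1 - a^2 b^2), which is
    bounded below; this yields the inverse map and its u-derivatives.  The
    v-derivatives come in the same way from eliminating y with u fixed.  The
    two eliminations describe the same map because the solution is unique. *)
Lemma characteristic_coordinates_exist a b : small_pair a b ->
  exists Y Z, characteristic_coordinates a b Y Z.
Proof.
intros H. pose proof (small_pair_sym _ _ H) as H'.
set (c := dens a b). set (e := dens b a).
set (X1 := primitive c). set (X2 := primitive (fun s => b s ^ 2 * e s)).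
set (X3 := primitive (fun s => a s ^ 2 * c s)). set (X4 := primitive e).
assert (c1 : forall y, 1 + b y ^ 2 <= c y) by (intros; apply dens_ge, H).
assert (e1 : forall y, 1 + a y ^ 2 <= e y) by (intros; apply dens_ge, H').
assert (c1' : forall y, 1 <= c y) by (intros; apply dens_ge_1, H).
assert (e1' : forall y, 1 <= e y) by (intros; apply dens_ge_1, H').
assert (D1 : forall y, is_derive X1 y (c y)) by (intros; apply primitive_derive; intros; apply dens_continuous, H).
assert (D4 : forall y, is_derive X4 y (e y)) by (intros; apply primitive_derive; intros; apply dens_continuous, H').
assert (D2 : forall y, is_derive X2 y (b y ^ 2 * e y))
  by (intros; apply (primitive_derive (fun s => b s ^ 2 * e s)); intros; apply sqr_dens_continuous, H').
assert (D3 : forall y, is_derive X3 y (a y ^ 2 * c y))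
  by (intros; apply (primitive_derive (fun s => a s ^ 2 * c s)); intros; apply sqr_dens_continuous, H).
destruct (increasing_inverse X4 e 1 Rlt_0_1 D4 e1') as (Zi & X4Zi & ZiX4 & DZi).
destruct (increasing_inverse X1 c 1 Rlt_0_1 D1 c1') as (Yi & X1Yi & YiX1 & DYi).
assert (sq : forall y z, 0 <= (a y * b z) ^ 2 <= / 4) by (intros; apply small_sqr, H).
(* For fixed v: eliminate z, then invert a monotone function of y. *)
assert (HH : forall v, exists g,
   (forall s, X1 (g s) - X2 (Zi (v + X3 (g s))) = s) /\
   (forall y, g (X1 y - X2 (Zi (v + X3 y))) = y) /\
   forall s, is_derive g s (/ (c (g s) * (1 - (a (g s) * b (Zi (v + X3 (g s)))) ^ 2)))).
{ intros v.
  apply (increasing_inverse (fun y => X1 y - X2 (Zi (v + X3 y)))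
     (fun y => c y * (1 - (a y * b (Zi (v + X3 y))) ^ 2)) (/ 2)); [lra| |].
  - intros y.
    assert (DD : is_derive (fun y => Zi (v + X3 y)) y (a y ^ 2 * c y * / e (Zi (v + X3 y)))).
    { evar_last; [apply (is_derive_comp Zi (fun y => v + X3 y)); [apply DZi|]|].
      - apply (is_derive_plus (fun _ => v) X3); [apply is_derive_const|apply D3].
      - unfold scal, plus, zero; simpl. unfold mult; simpl. ring. }
    evar_last; [apply (is_derive_minus X1 (fun y => X2 (Zi (v + X3 y)))); [apply D1|]|].
    + apply (is_derive_comp X2 (fun y => Zi (v + X3 y))); [apply D2|exact DD].
    + unfold minus, plus, opp, scal; simpl. unfold mult; simpl.
      specialize (e1' (Zi (v + X3 y))). field. lra.
  - intros y. specialize (c1' y). specialize (sq y (Zi (v + X3 y))). nra. }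
assert (KK : forall u, exists g,
   (forall s, X4 (g s) - X3 (Yi (X2 (g s) - u)) = s) /\
   (forall z, g (X4 z - X3 (Yi (X2 z - u))) = z) /\
   forall s, is_derive g s (/ (e (g s) * (1 - (a (Yi (X2 (g s) - u)) * b (g s)) ^ 2)))).
{ intros u.
  apply (increasing_inverse (fun z => X4 z - X3 (Yi (X2 z - u)))
     (fun z => e z * (1 - (a (Yi (X2 z - u)) * b z) ^ 2)) (/ 2)); [lra| |].
  - intros z.
    assert (DD : is_derive (fun z => Yi (X2 z - u)) z (b z ^ 2 * e z * / c (Yi (X2 z - u)))).
    { evar_last; [apply (is_derive_comp Yi (fun z => X2 z - u)); [apply DYi|]|].
      - apply (is_derive_minus X2 (fun _ => u)); [apply D2|apply is_derive_const].
      - unfold scal, minus, plus, opp, zero; simpl. unfold mult; simpl. ring. }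
    evar_last; [apply (is_derive_minus X4 (fun z => X3 (Yi (X2 z - u)))); [apply D4|]|].
    + apply (is_derive_comp X3 (fun z => Yi (X2 z - u))); [apply D3|exact DD].
    + unfold minus, plus, opp, scal; simpl. unfold mult; simpl.
      specialize (c1' (Yi (X2 z - u))). field. lra.
  - intros z. specialize (e1' z). specialize (sq (Yi (X2 z - u)) z). nra. }
destruct (choice _ HH) as (G & HG). destruct (choice _ KK) as (L & HL). clear HH KK.
set (Y := fun u v => G v (- u)). set (Z := fun u v => Zi (v + X3 (Y u v))).
assert (Eu : forall u v, - X1 (Y u v) + X2 (Z u v) = u).
{ intros u v. pose proof (proj1 (HG v) (- u)) as E. fold (Y u v) in E. unfold Z. lra. }
assert (Ev : forall u v, - X3 (Y u v) + X4 (Z u v) = v).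
{ intros u v. unfold Z. rewrite X4Zi. ring. }
assert (Un : forall y z u v, - X1 y + X2 z = u -> - X3 y + X4 z = v -> Y u v = y /\ Z u v = z).
{ intros y z u v Hu Hv.
  assert (Ez : Zi (v + X3 y) = z) by (rewrite <- Hv; rewrite <- (ZiX4 z) at 2; f_equal; ring).
  assert (EY : Y u v = y).
  { unfold Y. rewrite <- (proj1 (proj2 (HG v)) y). f_equal. rewrite Ez. lra. }
  split; [exact EY|]. unfold Z. rewrite EY. exact Ez. }
assert (EY : forall u v, Yi (X2 (Z u v) - u) = Y u v).
{ intros u v. rewrite <- (YiX1 (Y u v)). f_equal. specialize (Eu u v). lra. }
assert (EZ : forall u v, Z u v = L u v).
{ intros u v. rewrite <- (proj1 (proj2 (HL u)) (Z u v)). f_equal. rewrite EY. specialize (Ev u v). lra. }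
set (Q := fun u v => 1 - (a (Y u v) * b (Z u v)) ^ 2).
assert (Yu : forall u v, is_derive (fun s => Y s v) u (- / (c (Y u v) * Q u v))).
{ intros u v. evar_last; [apply (is_derive_comp (G v) (fun s => - s)); [apply HG|auto_derive; [exact I|reflexivity]]|].
  unfold scal; simpl. unfold mult; simpl. unfold Q, Z, Y; simpl; ring. }
assert (Zu : forall u v, is_derive (fun s => Z s v) u (- (a (Y u v) ^ 2 / (e (Z u v) * Q u v)))).
{ intros u v. evar_last; [apply (is_derive_comp Zi (fun s => v + X3 (Y s v))); [apply DZi|]|].
  - apply (is_derive_plus (fun _ => v) (fun s => X3 (Y s v))); [apply is_derive_const|].
    apply (is_derive_comp X3 (fun s => Y s v)); [apply D3|apply Yu].
  - unfold scal, plus, zero; simpl. unfold mult; simpl. change (Zi (v + X3 (Y u v))) with (Z u v).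
    specialize (c1' (Y u v)). specialize (e1' (Z u v)). pose proof (sq (Y u v) (Z u v)) as S.
    unfold Q. simpl in *. field. lra. }
assert (Zv : forall u v, is_derive (fun s => Z u s) v (/ (e (Z u v) * Q u v))).
{ intros u v. apply (is_derive_ext (L u)); [intros; symmetry; apply EZ|].
  evar_last; [apply HL|]. rewrite <- EZ, EY. reflexivity. }
assert (Yv : forall u v, is_derive (fun s => Y u s) v (b (Z u v) ^ 2 / (c (Y u v) * Q u v))).
{ intros u v. apply (is_derive_ext (fun s => Yi (X2 (Z u s) - u))); [intros; apply EY|].
  evar_last; [apply (is_derive_comp Yi (fun s => X2 (Z u s) - u)); [apply DYi|]|].
  - apply (is_derive_minus (fun s => X2 (Z u s)) (fun _ => u)); [|apply is_derive_const].
    apply (is_derive_comp X2 (fun s => Z u s)); [apply D2|apply Zv].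
  - unfold scal, minus, plus, opp, zero; simpl. unfold mult; simpl. rewrite EY.
    specialize (c1' (Y u v)). specialize (e1' (Z u v)). pose proof (sq (Y u v) (Z u v)) as S.
    unfold Q. simpl in *. field. lra. }
destruct (small_bound _ _ H) as [M HM].
assert (bY : forall u v, 0 <= / (c (Y u v) * Q u v) <= 2 /\ 0 <= b (Z u v) ^ 2 / (c (Y u v) * Q u v) <= 2 * M).
{ intros u v. apply inv_bound; [apply c1'| |apply sq]. split; [apply pow2_ge_0|apply HM]. }
assert (bZ : forall u v, 0 <= / (e (Z u v) * Q u v) <= 2 /\ 0 <= a (Y u v) ^ 2 / (e (Z u v) * Q u v) <= 2 * M).
{ intros u v. apply inv_bound; [apply e1'| |apply sq]. split; [apply pow2_ge_0|apply HM]. }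
assert (CY : forall u v, continuity_2d_pt Y u v).
{ intros u v. apply (continuity_2d_of_bounded_partials _ _ _ (2 + 2 * M) u v Yu Yv);
    intros x y; pose proof (bY x y); apply Rabs_le; lra. }
assert (CZ : forall u v, continuity_2d_pt Z u v).
{ intros u v. apply (continuity_2d_of_bounded_partials _ _ _ (2 + 2 * M) u v Zu Zv);
    intros x y; pose proof (bZ x y); apply Rabs_le; lra. }
assert (CcQ : forall u v, continuity_2d_pt (fun u v => / (c (Y u v) * Q u v)) u v /\
                          continuity_2d_pt (fun u v => / (e (Z u v) * Q u v)) u v).
{ intros u v. pose proof (sq (Y u v) (Z u v)) as S.
  assert (CQ : continuity_2d_pt Q u v).
  { unfold Q. apply continuity_2d_pt_minus; [apply continuity_2d_pt_const|].
    apply (continuity_2d_pt_ext (fun u v => (a (Y u v) * b (Z u v)) * (a (Y u v) * b (Z u v)))); [intros; simpl; ring|].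
    apply continuity_2d_pt_mult; apply continuity_2d_pt_mult; apply continuous_comp_2d; auto; apply H. }
  split; apply continuity_2d_pt_inv.
  - apply continuity_2d_pt_mult; [|exact CQ]. apply continuous_comp_2d; auto. intros; apply dens_continuous, H.
  - specialize (c1' (Y u v)). apply Rmult_integral_contrapositive_currified; unfold Q; lra.
  - apply continuity_2d_pt_mult; [|exact CQ]. apply continuous_comp_2d; auto. intros; apply dens_continuous, H'.
  - specialize (e1' (Z u v)). apply Rmult_integral_contrapositive_currified; unfold Q; lra. }
eassert (NY : forall t x, null_derive (fun t x => Y (t - x) (t + x)) t x _ _).
{ intros t x. apply (null_derive_uv Y _ _ t x Yu Yv).
  apply continuity_2d_pt_opp. apply CcQ. }
eassert (NZ : forall t x, null_derive (fun t x => Z (t - x) (t + x)) t x _ _).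
{ intros t x. apply (null_derive_uv Z _ _ t x Zu Zv).
  apply continuity_2d_pt_opp. apply (continuity_2d_pt_mult (fun u v => a (Y u v) ^ 2)); [|apply CcQ].
  apply (continuity_2d_pt_ext (fun u v => a (Y u v) * a (Y u v))); [intros; simpl; ring|].
  apply continuity_2d_pt_mult; apply continuous_comp_2d; auto; apply H. }
exists (fun t x => Y (t - x) (t + x)), (fun t x => Z (t - x) (t + x)).
split.
- intros t x. apply Eu.
- intros t x. apply Ev.
- intros y z t x Hu Hv. apply Un; assumption.
- exact NY.
- exact NZ.
- intros t x.
  apply (continuity_2d_of_bounded_partials _ _ _ (2 + 2 * M) t x (fun t x => proj1 (NY t x)) (fun t x => proj2 (NY t x)));
    clear t x; intros t x; pose proof (bY (t - x) (t + x)); apply Rabs_le; simpl in *; lra.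
- intros t x.
  apply (continuity_2d_of_bounded_partials _ _ _ (2 + 2 * M) t x (fun t x => proj1 (NZ t x)) (fun t x => proj2 (NZ t x)));
    clear t x; intros t x; pose proof (bZ (t - x) (t + x)); apply Rabs_le; simpl in *; lra.
Qed.

(** * The explicit solution *)
Definition char_t a b y z := (char_u a b y z + char_v a b y z) / 2.
Definition char_x a b y z := (char_v a b y z - char_u a b y z) / 2.

Section CharGeometry.
Variables (a b : R -> R).
Hypothesis H : small_pair a b.

Lemma char_u_z y z : is_derive (fun z => char_u a b y z) z (b z ^ 2 * dens b a z).
Proof.
evar_last; [apply (is_derive_plus (fun _ => - primitive (dens a b) y)); [apply is_derive_const|]|].
- apply (primitive_derive (fun s => b s ^ 2 * dens b a s)); intros; apply sqr_dens_continuous, small_pair_sym, H.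
- unfold plus, zero; simpl; ring.
Qed.

Lemma char_v_z y z : is_derive (fun z => char_v a b y z) z (dens b a z).
Proof.
evar_last; [apply (is_derive_plus (fun _ => - primitive (fun s => a s ^ 2 * dens a b s) y)); [apply is_derive_const|]|].
- apply primitive_derive; intros; apply dens_continuous, small_pair_sym, H.
- unfold plus, zero; simpl; ring.
Qed.

Lemma char_u_y y z : is_derive (fun y => char_u a b y z) y (- dens a b y).
Proof.
evar_last; [apply (is_derive_plus (fun y => - primitive (dens a b) y)); [|apply is_derive_const]|].
- apply (is_derive_opp (primitive (dens a b))). apply primitive_derive; intros; apply dens_continuous, H.
- unfold plus, opp, zero; simpl; ring.
Qed.

Lemma char_v_y y z : is_derive (fun y => char_v a b y z) y (- (a y ^ 2 * dens a b y)).
Proof.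
evar_last; [apply (is_derive_plus (fun y => - primitive (fun s => a s ^ 2 * dens a b s) y)); [|apply is_derive_const]|].
- apply (is_derive_opp (primitive (fun s => a s ^ 2 * dens a b s))).
  apply (primitive_derive (fun s => a s ^ 2 * dens a b s)); intros; apply sqr_dens_continuous, H.
- unfold plus, opp, zero; simpl; ring.
Qed.

Lemma half_sum_derive (f g : R -> R) s f' g' : is_derive f s f' -> is_derive g s g' ->
  is_derive (fun s => (f s + g s) / 2) s ((f' + g') / 2).
Proof.
intros F G. apply (is_derive_ext (fun s => / 2 * (f s + g s))); [intros; simpl; field|].
evar_last; [apply (is_derive_scal (fun s => f s + g s) s (/ 2)), (is_derive_plus f g s _ _ F G)|].
unfold plus; simpl. field.
Qed.

Lemma half_diff_derive (f g : R -> R) s f' g' : is_derive f s f' -> is_derive g s g' ->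
  is_derive (fun s => (f s - g s) / 2) s ((f' - g') / 2).
Proof.
intros F G. apply (is_derive_ext (fun s => / 2 * (f s - g s))); [intros; simpl; field|].
evar_last; [apply (is_derive_scal (fun s => f s - g s) s (/ 2)), (is_derive_minus f g s _ _ F G)|].
unfold minus, plus, opp; simpl. field.
Qed.

(** Moving z with y fixed moves the point along the characteristic with foot y,
    in the direction V + b^2 U. *)
Lemma along_z f fu fv y z :
  (forall t x, null_derive f t x (fu t x) (fv t x)) ->
  continuity_2d_pt fu (char_t a b y z) (char_x a b y z) ->
  continuity_2d_pt fv (char_t a b y z) (char_x a b y z) ->
  is_derive (fun z => f (char_t a b y z) (char_x a b y z)) z
   (dens b a z * (b z ^ 2 * fu (char_t a b y z) (char_x a b y z) + fv (char_t a b y z) (char_x a b y z))).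
Proof.
intros Hf Cu Cv.
evar_last; [apply (null_derive_curve f fu fv (fun z => char_t a b y z) (fun z => char_x a b y z) z
  ((b z ^ 2 * dens b a z + dens b a z) / 2) ((dens b a z - b z ^ 2 * dens b a z) / 2) Hf Cu Cv)|].
- apply half_sum_derive; [apply char_u_z|apply char_v_z].
- apply half_diff_derive; [apply char_v_z|apply char_u_z].
- simpl. field.
Qed.

(** Moving y with z fixed is the direction - (U + a^2 V). *)
Lemma along_y f fu fv y z :
  (forall t x, null_derive f t x (fu t x) (fv t x)) ->
  continuity_2d_pt fu (char_t a b y z) (char_x a b y z) ->
  continuity_2d_pt fv (char_t a b y z) (char_x a b y z) ->
  is_derive (fun y => f (char_t a b y z) (char_x a b y z)) y
   (- (dens a b y * (fu (char_t a b y z) (char_x a b y z) + a y ^ 2 * fv (char_t a b y z) (char_x a b y z)))).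
Proof.
intros Hf Cu Cv.
evar_last; [apply (null_derive_curve f fu fv (fun y => char_t a b y z) (fun y => char_x a b y z) y
  ((- dens a b y + - (a y ^ 2 * dens a b y)) / 2) ((- (a y ^ 2 * dens a b y) - - dens a b y) / 2) Hf Cu Cv)|].
- apply half_sum_derive; [apply char_u_y|apply char_v_y].
- apply half_diff_derive; [apply char_v_y|apply char_u_y].
- simpl. field.
Qed.

(** On the diagonal the densities combine to du = - dy and dv = dy: this is the
    normalisation that makes y and z the feet on t = 0. *)
Lemma char_diag y : char_u a b y y = - y /\ char_v a b y y = y.
Proof.
assert (S : forall s, 0 <= (a s * b s) ^ 2 <= / 4) by (intros; apply small_sqr, H).
assert (H' := small_pair_sym _ _ H).
assert (D : forall (f g : R -> R) f' g' s, is_derive f s f' -> is_derive g s g' -> is_derive (fun s => - f s + g s) s (- f' + g')).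
{ intros f g f' g' s F G. exact (is_derive_plus (fun s => - f s) g s _ _ (is_derive_opp f s _ F) G). }
split.
- apply (eq_of_derive (fun y => char_u a b y y) (fun y => - y) (fun _ => -1) 0).
  + intros s. evar_last; [apply D; [apply (primitive_derive (dens a b))|apply (primitive_derive (fun s => b s ^ 2 * dens b a s))]|];
      intros; [apply dens_continuous, H|apply sqr_dens_continuous, H'|].
    unfold dens. rewrite (Rmult_comm (b s) (a s)). specialize (S s). simpl in *. field. lra.
  + intros s. auto_derive; auto; ring.
  + unfold char_u. rewrite !primitive_0. ring.
- apply (eq_of_derive (fun y => char_v a b y y) (fun y => y) (fun _ => 1) 0).
  + intros s. evar_last; [apply D; [apply (primitive_derive (fun s => a s ^ 2 * dens a b s))|apply (primitive_derive (dens b a))]|];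
      intros; [apply sqr_dens_continuous, H|apply dens_continuous, H'|].
    unfold dens. rewrite (Rmult_comm (b s) (a s)). specialize (S s). simpl in *. field. lra.
  + intros s. auto_derive; auto; ring.
  + unfold char_v. rewrite !primitive_0. ring.
Qed.

Lemma char_t_diag y : char_t a b y y = 0.
Proof. unfold char_t. destruct (char_diag y) as [-> ->]. field. Qed.
Lemma char_x_diag y : char_x a b y y = y.
Proof. unfold char_x. destruct (char_diag y) as [-> ->]. field. Qed.

Lemma char_t_increasing y z z' : z < z' -> char_t a b y z < char_t a b y z'.
Proof.
intros L. assert (H' := small_pair_sym _ _ H).
destruct (MVT_gen (fun z => char_t a b y z) z z' (fun z => (b z ^ 2 * dens b a z + dens b a z) / 2)) as (s & _ & E).
- intros s _. apply half_sum_derive; [apply char_u_z|apply char_v_z].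
- intros s _. apply continuity_pt_filterlim, (ex_derive_continuous (fun z => char_t a b y z)).
  eexists. apply half_sum_derive; [apply char_u_z|apply char_v_z].
- pose proof (dens_ge_1 b a s H'). pose proof (pow2_ge_0 (b s)).
  assert (0 < (b s ^ 2 * dens b a s + dens b a s) / 2 * (z' - z)); [|lra].
  apply Rmult_lt_0_compat; [|lra]. nra.
Qed.

(** The half-plane t >= 0 is the half-plane y <= z, because t vanishes on the
    diagonal and increases with z. *)
Lemma char_t_nonneg y z : y <= z <-> 0 <= char_t a b y z.
Proof.
rewrite <- (char_t_diag y) at 1. split; intros L.
- destruct L as [L| ->]; [|lra]. apply Rlt_le, char_t_increasing, L.
- destruct (Rle_or_lt y z) as [|C]; [assumption|]. pose proof (char_t_increasing y z y C). lra.
Qed.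

Variables (Y Z : R -> R -> R).
Hypothesis CC : characteristic_coordinates a b Y Z.

Lemma cc_t t x : char_t a b (Y t x) (Z t x) = t.
Proof. unfold char_t. rewrite (cc_u _ _ _ _ CC), (cc_v _ _ _ _ CC). field. Qed.
Lemma cc_x t x : char_x a b (Y t x) (Z t x) = x.
Proof. unfold char_x. rewrite (cc_u _ _ _ _ CC), (cc_v _ _ _ _ CC). field. Qed.

Lemma cc_initial x : Y 0 x = x /\ Z 0 x = x.
Proof.
destruct (char_diag x) as [E1 E2]. apply (cc_unique _ _ _ _ CC); [rewrite E1|rewrite E2]; ring.
Qed.

Variable Psi : R -> R.
Hypothesis hPsi : smooth1 Psi.
Variable K0 : R.

(** The total field is the integral of a d alpha + b d beta, that is, the sum of two
    null curves; Psi(t - x) is subtracted to get phi. *)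
Definition string_wave (t x : R) : R :=
  K0 - primitive (fun s => a s * dens a b s) (Y t x)
     + primitive (fun s => b s * dens b a s) (Z t x) - Psi (t - x).

Definition wave_p (t x : R) : R := a (Y t x) / (1 + a (Y t x) * b (Z t x)).
Definition wave_r (t x : R) : R := b (Z t x) / (1 + a (Y t x) * b (Z t x)).

Lemma one_plus_ab_pos y z : / 2 <= 1 + a y * b z <= 3 / 2.
Proof. pose proof (small_prod _ _ H y z) as S. apply Rabs_le_between in S. lra. Qed.

(** In the coordinates (alpha, beta) the total field has derivatives a and b;
    solving p + a^2 r = a and b^2 p + r = b gives p = a/(1+ab) and
    r = b/(1+ab). *)
Lemma wave_null t x : null_derive string_wave t x (wave_p t x - Derive Psi (t - x)) (wave_r t x).
Proof.
assert (H' := small_pair_sym _ _ H).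
assert (DA : is_derive (primitive (fun s => a s * dens a b s)) (Y t x) (a (Y t x) * dens a b (Y t x))).
{ apply (primitive_derive (fun s => a s * dens a b s)). intros; apply continuous_Rmult; [apply H|apply dens_continuous, H]. }
assert (DB : is_derive (primitive (fun s => b s * dens b a s)) (Z t x) (b (Z t x) * dens b a (Z t x))).
{ apply (primitive_derive (fun s => b s * dens b a s)). intros; apply continuous_Rmult; [apply H|apply dens_continuous, H']. }
assert (DP : is_derive Psi (t - x) (Derive Psi (t - x))) by (apply Derive_correct; exact (hPsi 1%nat (t - x))).
pose proof (null_derive_comp _ _ _ _ _ _ _ DA (cc_Y _ _ _ _ CC t x)) as NA.
pose proof (null_derive_comp _ _ _ _ _ _ _ DB (cc_Z _ _ _ _ CC t x)) as NB.
pose proof (null_derive_u _ _ _ _ DP) as NP.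
refine (null_derive_eq _ _ _ _ _ _ _ (null_derive_minus _ _ _ _ _ _ _ _ (null_derive_plus _ _ _ _ _ _ _ _
  (null_derive_minus _ _ _ _ _ _ _ _ (null_derive_const K0 t x) NA) NB) NP) _ _);
unfold wave_p, wave_r; pose proof (dens_ge_1 a b (Y t x) H); pose proof (dens_ge_1 b a (Z t x) H');
pose proof (one_plus_ab_pos (Y t x) (Z t x)); pose proof (small_prod _ _ H (Y t x) (Z t x)) as S; apply Rabs_le_between in S;
(replace (1 - (a (Y t x) * b (Z t x)) ^ 2) with ((1 + a (Y t x) * b (Z t x)) * (1 - a (Y t x) * b (Z t x))) by ring);
field; repeat split; lra.
Qed.
End CharGeometry.

(** The string equation is equivalent to the two transport equations; 1 - 4pr is
    the square of (1 - ab)/(1 + ab), which explains the Lorentzian signature. *)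
Lemma invariants_string (al be : R -> R -> R) t x au bv :
  Rabs (al t x * be t x) <= / 2 ->
  null_derive al t x au (- (be t x ^ 2 * au)) ->
  null_derive be t x (- (al t x ^ 2 * bv)) bv ->
  exists puu m rvv,
    null_derive (fun t x => al t x / (1 + al t x * be t x)) t x puu m /\
    null_derive (fun t x => be t x / (1 + al t x * be t x)) t x m rvv /\
    let p := al t x / (1 + al t x * be t x) in
    let r := be t x / (1 + al t x * be t x) in
    0 < 1 - 4 * (p * r) /\
    (1 - 2 * (p * r)) * m + r ^ 2 * puu + p ^ 2 * rvv = 0.
Proof.
intros S HA HB. apply Rabs_le_between in S.
assert (N : 1 + al t x * be t x <> 0) by lra.
assert (HD := null_derive_inv (fun t x => 1 + al t x * be t x) t x _ _ N
  (null_derive_plus _ _ _ _ _ _ _ _ (null_derive_const 1 t x) (null_derive_mult _ _ _ _ _ _ _ _ HA HB))).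
set (A := al t x) in *. set (B := be t x) in *.
exists ((au + A ^ 4 * bv) / (1 + A * B) ^ 2), (- (B ^ 2 * au + A ^ 2 * bv) / (1 + A * B) ^ 2),
  ((bv + B ^ 4 * au) / (1 + A * B) ^ 2).
split; [|split; [|split]].
- refine (null_derive_eq _ _ _ _ _ _ _ (null_derive_mult _ _ _ _ _ _ _ _ HA HD) _ _); fold A B; field; exact N.
- refine (null_derive_eq _ _ _ _ _ _ _ (null_derive_mult _ _ _ _ _ _ _ _ HB HD) _ _); fold A B; field; exact N.
- replace (1 - 4 * (A / (1 + A * B) * (B / (1 + A * B)))) with (((1 - A * B) * / (1 + A * B)) ^ 2) by (field; exact N).
  apply pow2_gt_0. apply Rmult_integral_contrapositive_currified; [lra|]. apply Rinv_neq_0_compat, N.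
- cbv zeta. field. exact N.
Qed.

Lemma wave_p_r_string a b Y Z t x : small_pair a b -> characteristic_coordinates a b Y Z ->
  (forall s, ex_derive a s) -> (forall s, ex_derive b s) ->
  exists puu m rvv, null_derive (wave_p a b Y Z) t x puu m /\ null_derive (wave_r a b Y Z) t x m rvv /\
    0 < 1 - 4 * (wave_p a b Y Z t x * wave_r a b Y Z t x) /\
    (1 - 2 * (wave_p a b Y Z t x * wave_r a b Y Z t x)) * m + wave_r a b Y Z t x ^ 2 * puu + wave_p a b Y Z t x ^ 2 * rvv = 0.
Proof.
intros H CC Ea Eb. assert (H' := small_pair_sym _ _ H).
pose proof (dens_ge_1 a b (Y t x) H); pose proof (dens_ge_1 b a (Z t x) H'). pose proof (small_sqr a b (Y t x) (Z t x) H) as S.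
pose proof (null_derive_comp _ _ _ _ _ _ _ (Derive_correct _ _ (Ea (Y t x))) (cc_Y _ _ _ _ CC t x)) as NA.
pose proof (null_derive_comp _ _ _ _ _ _ _ (Derive_correct _ _ (Eb (Z t x))) (cc_Z _ _ _ _ CC t x)) as NB.
apply (invariants_string (fun t x => a (Y t x)) (fun t x => b (Z t x)) t x
  (Derive a (Y t x) * (- / (dens a b (Y t x) * (1 - (a (Y t x) * b (Z t x)) ^ 2))))
  (Derive b (Z t x) * (/ (dens b a (Z t x) * (1 - (a (Y t x) * b (Z t x)) ^ 2))))).
- apply H.
- refine (null_derive_eq _ _ _ _ _ _ _ NA eq_refl _). unfold Rdiv; simpl; ring.
- refine (null_derive_eq _ _ _ _ _ _ _ NB _ eq_refl). unfold Rdiv; simpl; ring.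
Qed.

Lemma wave_cont a b Y Z t x : small_pair a b -> characteristic_coordinates a b Y Z ->
  continuity_2d_pt (wave_p a b Y Z) t x /\ continuity_2d_pt (wave_r a b Y Z) t x.
Proof.
intros H CC.
assert (Ca : continuity_2d_pt (fun t x => a (Y t x)) t x) by (apply continuous_comp_2d; [apply H|apply CC]).
assert (Cb : continuity_2d_pt (fun t x => b (Z t x)) t x) by (apply continuous_comp_2d; [apply H|apply CC]).
assert (Ci : continuity_2d_pt (fun t x => / (1 + a (Y t x) * b (Z t x))) t x).
{ apply continuity_2d_pt_inv.
  - apply continuity_2d_pt_plus; [apply continuity_2d_pt_const|]. apply continuity_2d_pt_mult; assumption.
  - pose proof (one_plus_ab_pos a b H (Y t x) (Z t x)). lra. }
split; apply continuity_2d_pt_mult; assumption.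
Qed.

Lemma string_solution Psi a b Y Z F G : smooth1 Psi -> small_pair a b -> characteristic_coordinates a b Y Z ->
  (forall s, ex_derive a s) -> (forall s, ex_derive b s) ->
  (forall x, is_derive F x (b x / (1 + a x * b x) - a x / (1 + a x * b x) + Derive Psi (- x))) ->
  (forall x, G x = a x / (1 + a x * b x) + b x / (1 + a x * b x) - Derive Psi (- x)) ->
  let phi := string_wave a b Y Z Psi (F 0 + Psi 0) in
  (forall t x, lorentzian Psi phi t x /\ box_g Psi phi t x = S0 Psi phi t x) /\
  (forall x, phi 0 x = F x /\ Dt phi 0 x = G x).
Proof.
intros hPsi H CC Ea Eb HF HG phi.
assert (N := wave_null a b H Y Z CC Psi hPsi (F 0 + Psi 0)). fold phi in N.
assert (H' := small_pair_sym _ _ H).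
split.
- intros t x.
  destruct (wave_p_r_string a b Y Z t x H CC Ea Eb) as (puu & m & rvv & NP & NR & P & E).
  destruct (wave_cont a b Y Z t x H CC) as [Cp Cr].
  split.
  + apply (lorentzian_phi _ _ _ _ N). exact P.
  + apply Rminus_diag_uniq.
    rewrite (box_minus_source Psi phi _ _ hPsi N t x _ _ _ NP NR Cp Cr P), E. ring.
- intros x. split.
  + apply (eq_of_derive (fun x => phi 0 x) F
      (fun x => b x / (1 + a x * b x) - a x / (1 + a x * b x) + Derive Psi (- x)) 0).
    * intros s. evar_last; [apply N|].
      unfold wave_p, wave_r. destruct (cc_initial a b H Y Z CC s) as [-> ->].
      replace (0 - s) with (- s) by ring. ring.
    * exact HF.
    * unfold phi, string_wave. destruct (cc_initial a b H Y Z CC 0) as [-> ->].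
      rewrite !primitive_0. replace (0 - 0) with 0 by ring. ring.
  + rewrite (Dt_null _ _ _ _ _ (N 0 x)), HG.
    unfold wave_p, wave_r. destruct (cc_initial a b H Y Z CC x) as [-> ->].
    replace (0 - x) with (- x) by ring. ring.
Qed.

(** * Bounds on compact triangles *)
Lemma continuity_2d_pt_comp2 N g h x y :
  continuity_2d_pt N (g x y) (h x y) -> continuity_2d_pt g x y -> continuity_2d_pt h x y ->
  continuity_2d_pt (fun x y => N (g x y) (h x y)) x y.
Proof.
intros CN Cg Ch eps. destruct (CN eps) as [d Hd].
apply (locally_2d_impl _ _ _ _) with (2 := locally_2d_and _ _ _ _ (Cg d) (Ch d)).
apply locally_2d_forall. intros u v [A B]. apply Hd; assumption.
Qed.

(** By uniform continuity each of n equal steps from a corner to (x, y)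
    changes M by less than 1, with the same n for all points. *)
Lemma bounded_on_rectangle M a b c d : a <= b -> c <= d ->
  (forall x y, a <= x <= b -> c <= y <= d -> continuity_2d_pt M x y) ->
  exists K, forall x y, a <= x <= b -> c <= y <= d -> Rabs (M x y) <= K.
Proof.
intros Hab Hcd C.
destruct (uniform_continuity_2d M a b c d C (mkposreal 1 Rlt_0_1)) as [dl Hd]. simpl in Hd.
destruct (nfloor_ex ((b - a + (d - c)) / dl)) as [n0 [_ Hn]].
{ apply Rmult_le_pos; [lra|apply Rlt_le, Rinv_0_lt_compat, cond_pos]. }
set (n := S n0). pose proof (cond_pos dl) as Pd.
assert (Hn' : b - a + (d - c) < INR n * dl).
{ unfold n. rewrite S_INR. apply (Rmult_lt_compat_r dl) in Hn; [|exact Pd].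
  unfold Rdiv in Hn. rewrite Rmult_assoc, Rinv_l in Hn by lra. lra. }
assert (Pn : 0 < INR n) by (apply lt_0_INR; unfold n; lia).
exists (Rabs (M a c) + INR n). intros x y Hx Hy.
assert (St : forall k, (k <= n)%nat ->
  Rabs (M (a + INR k / INR n * (x - a)) (c + INR k / INR n * (y - c))) <= Rabs (M a c) + INR k).
{ intros k. induction k as [|k IH]; intros Hk.
  - simpl. unfold Rdiv. rewrite !Rmult_0_l, !Rplus_0_r. lra.
  - assert (Hk' : (k <= n)%nat) by lia. specialize (IH Hk').
    assert (B : forall j, (j <= n)%nat -> 0 <= INR j / INR n <= 1).
    { intros j Hj. apply le_INR in Hj. split.
      - apply Rmult_le_pos; [apply pos_INR|apply Rlt_le, Rinv_0_lt_compat, Pn].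
      - apply (Rmult_le_reg_r (INR n)); [exact Pn|]. unfold Rdiv. rewrite Rmult_assoc, Rinv_l by lra. lra. }
    assert (R : forall j w lo hi, (j <= n)%nat -> lo <= w <= hi -> lo <= lo + INR j / INR n * (w - lo) <= hi).
    { intros j w lo hi Hj Hw. specialize (B j Hj).
      assert (0 <= INR j / INR n * (w - lo) <= 1 * (w - lo)); [|lra].
      split; [apply Rmult_le_pos; lra|apply Rmult_le_compat_r; lra]. }
    assert (Q : forall w lo hi, lo <= w <= hi -> hi - lo <= b - a + (d - c) ->
       Rabs (lo + INR (S k) / INR n * (w - lo) - (lo + INR k / INR n * (w - lo))) < dl).
    { intros w lo hi Hw Hh. rewrite S_INR.
      replace (lo + (INR k + 1) / INR n * (w - lo) - (lo + INR k / INR n * (w - lo))) with ((w - lo) / INR n) by (field; lra).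
      rewrite Rabs_pos_eq by (apply Rmult_le_pos; [lra|apply Rlt_le, Rinv_0_lt_compat, Pn]).
      apply (Rmult_lt_reg_r (INR n)); [exact Pn|]. unfold Rdiv. rewrite Rmult_assoc, Rinv_l by lra. lra. }
    assert (D := Hd _ _ _ _ (R k x a b Hk' Hx) (R k y c d Hk' Hy) (R (S k) x a b Hk Hx) (R (S k) y c d Hk Hy)
        (Q x a b Hx ltac:(lra)) (Q y c d Hy ltac:(lra))).
    rewrite S_INR at 3.
    pose proof (Rabs_triang_inv (M (a + INR (S k) / INR n * (x - a)) (c + INR (S k) / INR n * (y - c)))
      (M (a + INR k / INR n * (x - a)) (c + INR k / INR n * (y - c)))). lra. }
specialize (St n (le_n n)). unfold Rdiv in St. rewrite Rinv_r in St by lra.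
replace (a + 1 * (x - a)) with x in St by ring. replace (c + 1 * (y - c)) with y in St by ring. exact St.
Qed.

(** The map (l, w) -> (y0 + l (w - y0), w) sends a rectangle onto the triangle,
    so that continuity on the triangle alone suffices. *)
Lemma bounded_on_triangle N y0 z0 : y0 <= z0 ->
  (forall y z, y0 <= y -> y <= z -> z <= z0 -> continuity_2d_pt N y z) ->
  exists K, forall y z, y0 <= y -> y <= z -> z <= z0 -> Rabs (N y z) <= K.
Proof.
intros H C.
assert (tri : forall l w, 0 <= l <= 1 -> y0 <= w <= z0 -> y0 <= y0 + l * (w - y0) <= w).
{ intros l w Hl Hw. assert (0 <= l * (w - y0) <= 1 * (w - y0)); [|lra].
  split; [apply Rmult_le_pos; lra|apply Rmult_le_compat_r; lra]. }
destruct (bounded_on_rectangle (fun l w => N (y0 + l * (w - y0)) w) 0 1 y0 z0) as [K HK]; [lra|exact H| |].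
- intros l w Hl Hw. apply (continuity_2d_pt_comp2 N (fun l w => y0 + l * (w - y0)) (fun l w => w)).
  + apply C; try apply tri; auto; lra.
  + apply continuity_2d_pt_plus; [apply continuity_2d_pt_const|]. apply continuity_2d_pt_mult; [apply continuity_2d_pt_id1|].
    apply continuity_2d_pt_minus; [apply continuity_2d_pt_id2|apply continuity_2d_pt_const].
  + apply continuity_2d_pt_id2.
- exists K. intros y z Hy Hyz Hz. destruct (Req_dec z y0) as [->|Nz].
  + assert (y = y0) by lra. subst y. specialize (HK 0 y0 ltac:(lra) ltac:(lra)). simpl in HK.
    replace (y0 + 0 * (y0 - y0)) with y0 in HK by ring. exact HK.
  + specialize (HK ((y - y0) / (z - y0)) z). simpl in HK.
    replace (y0 + (y - y0) / (z - y0) * (z - y0)) with y in HK by (field; lra). apply HK; [|lra].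
    split; [apply Rmult_le_pos; [lra|apply Rlt_le, Rinv_0_lt_compat; lra]|].
    apply (Rmult_le_reg_r (z - y0)); [lra|]. unfold Rdiv. rewrite Rmult_assoc, Rinv_l by lra. lra.
Qed.

Lemma le_0_of_halving x M : (forall j : nat, x <= M * (/ 2) ^ j) -> x <= 0.
Proof.
intros H. destruct (Rle_or_lt x 0) as [|L]; [assumption|exfalso].
assert (0 < M) by (specialize (H O); simpl in H; lra).
destruct (pow_lt_1_zero (/ 2)) with (y := x / M) as [n Hn].
- rewrite Rabs_pos_eq; lra.
- apply Rdiv_lt_0_compat; assumption.
- specialize (Hn n (le_n n)). rewrite Rabs_pos_eq in Hn by (apply pow_le; lra).
  apply (Rmult_lt_compat_l M) in Hn; [|assumption].
  replace (M * (x / M)) with x in Hn by (field; lra). specialize (H n). lra.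
Qed.

(** * Riemann invariants *)
Definition inv_a (p r : R) : R := 2 * p / (1 + sqrt (1 - 4 * (p * r))).
Definition inv_b (p r : R) : R := 2 * r / (1 + sqrt (1 - 4 * (p * r))).

Lemma inv_ab_swap p r : inv_b p r = inv_a r p.
Proof. unfold inv_a, inv_b. rewrite (Rmult_comm r p). reflexivity. Qed.

(** For f(p,q) = 2p/(1 + s) with s = sqrt(1 - 4pq) the partial derivatives are
    1/s and f^2/s. *)
Lemma inv_a_derive (P Q : R -> R) s P' Q' : is_derive P s P' -> is_derive Q s Q' ->
  0 < 1 - 4 * (P s * Q s) ->
  is_derive (fun s => inv_a (P s) (Q s)) s
    ((P' + inv_a (P s) (Q s) ^ 2 * Q') / sqrt (1 - 4 * (P s * Q s))).
Proof.
intros HP HQ G.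
assert (HS := sqrt_sqrt (1 - 4 * (P s * Q s)) (Rlt_le _ _ G)).
assert (S : 0 < sqrt (1 - 4 * (P s * Q s))) by (apply sqrt_lt_R0; exact G).
unfold inv_a. evar_last.
- auto_derive; [|reflexivity].
  split; [eexists; exact HP|]. split; [eexists; exact HP|]. split; [eexists; exact HQ|].
  repeat split; auto. unfold Rminus in *. lra.
- assert (E1 : Derive (fun x : R => P x) s = P') by exact (is_derive_unique _ _ _ HP).
  assert (E2 : Derive (fun x : R => Q x) s = Q') by exact (is_derive_unique _ _ _ HQ).
  rewrite E1, E2.
  change (1 + - (4 * (P s * Q s))) with (1 - 4 * (P s * Q s)).
  revert HS S. generalize (P s) (Q s). clear. intros p q HS HS0.
  generalize dependent (sqrt (1 - 4 * (p * q))). intros S HS HS0.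
  transitivity ((P' * (2 * S * (1 + S) + 4 * (p * q)) + 4 * p ^ 2 * Q') / (S * (1 + S) ^ 2)).
  + field. lra.
  + replace (4 * (p * q)) with (1 - S * S) by lra. field. lra.
Qed.

Lemma inv_of_ab A B : Rabs (A * B) <= / 2 ->
  sqrt (1 - 4 * (A / (1 + A * B) * (B / (1 + A * B)))) = (1 - A * B) / (1 + A * B).
Proof.
intros H. apply Rabs_le_between in H.
replace (1 - 4 * (A / (1 + A * B) * (B / (1 + A * B)))) with (Rsqr ((1 - A * B) / (1 + A * B)))
  by (unfold Rsqr; field; lra).
apply sqrt_Rsqr, Rmult_le_pos; [lra|]. apply Rlt_le, Rinv_0_lt_compat. lra.
Qed.

Lemma inv_a_of_ab A B : Rabs (A * B) <= / 2 -> inv_a (A / (1 + A * B)) (B / (1 + A * B)) = A.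
Proof. intros H. unfold inv_a. rewrite inv_of_ab by exact H. apply Rabs_le_between in H. field. lra. Qed.

(** With s = sqrt(1 - 4pr), 1 + ab = 2/(1 + s). *)
Lemma state_of_inv p r : 0 < 1 - 4 * (p * r) ->
  p = inv_a p r / (1 + inv_a p r * inv_b p r) /\ r = inv_b p r / (1 + inv_a p r * inv_b p r).
Proof.
intros G. assert (HS := sqrt_sqrt _ (Rlt_le _ _ G)). assert (S : 0 < sqrt (1 - 4 * (p * r))) by (apply sqrt_lt_R0; exact G).
unfold inv_a, inv_b. revert HS S. generalize (sqrt (1 - 4 * (p * r))). intros s HS S.
assert (E : 1 + 2 * p / (1 + s) * (2 * r / (1 + s)) = 2 / (1 + s)).
{ replace (2 * p / (1 + s) * (2 * r / (1 + s))) with ((4 * (p * r)) / (1 + s) ^ 2) by (field; lra).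
  replace (4 * (p * r)) with (1 - s * s) by lra. field. lra. }
rewrite E. split; field; lra.
Qed.

(** By [inv_a_derive], up to the common factor 1/sqrt(1 - 4pr), the left side is
    V a and the factor on the right is U a: the string equation is the transport
    equation V a = - b^2 U a. *)
Lemma transport_algebra p r puu m rvv : 0 < 1 - 4 * (p * r) ->
  (1 - 2 * (p * r)) * m + r ^ 2 * puu + p ^ 2 * rvv = 0 ->
  m + inv_a p r ^ 2 * rvv = - inv_b p r ^ 2 * (puu + inv_a p r ^ 2 * m).
Proof.
intros G E. assert (HS := sqrt_sqrt _ (Rlt_le _ _ G)). assert (S : 0 < sqrt (1 - 4 * (p * r))) by (apply sqrt_lt_R0; exact G).
unfold inv_a, inv_b. revert HS S. generalize (sqrt (1 - 4 * (p * r))). intros s HS S.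
apply Rminus_diag_uniq.
replace (m + (2 * p / (1 + s)) ^ 2 * rvv - - (2 * r / (1 + s)) ^ 2 * (puu + (2 * p / (1 + s)) ^ 2 * m))
 with (m + 4 * (p ^ 2 * rvv + r ^ 2 * puu) / (1 + s) ^ 2 + (4 * (p * r)) ^ 2 * m / (1 + s) ^ 4) by (field; lra).
replace (p ^ 2 * rvv + r ^ 2 * puu) with (- (1 - 2 * (p * r)) * m) by lra.
replace (p * r) with ((1 - s * s) / 4) by lra. field. lra.
Qed.

(** * Uniqueness *)

(** [a], [b], [Y], [Z] describe the explicit solution and [f] is a competitor with the
    same data; its state is ([p], [r]). *)
Section Uniqueness.
Variables (Psi a b : R -> R) (Y Z : R -> R -> R) (F G : R -> R) (f : R -> R -> R).
Hypothesis hPsi : smooth1 Psi.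
Hypothesis H : small_pair a b.
Hypothesis CC : characteristic_coordinates a b Y Z.
Hypothesis Ea : forall s, ex_derive a s.
Hypothesis Eb : forall s, ex_derive b s.
Hypothesis HF : forall x, is_derive F x (b x / (1 + a x * b x) - a x / (1 + a x * b x) + Derive Psi (- x)).
Hypothesis HG : forall x, G x = a x / (1 + a x * b x) + b x / (1 + a x * b x) - Derive Psi (- x).
Hypothesis Hgr : forall y z s, Rabs (Derive Psi s * (2 * (b z / (1 + a y * b z)))) <= / 2.
Hypothesis sol : cauchy_solution Psi F G f.

Let T := char_t a b.
Let X := char_x a b.
Let fs : smooth2 f := proj1 sol.
Let p t x := U f t x + Derive Psi (t - x).
Let r t x := V f t x.
Let puu t x := U (U f) t x + Derive_n Psi 2 (t - x).
Let m t x := U (V f) t x.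
Let rvv t x := V (V f) t x.

Lemma sol_null t x : null_derive f t x (p t x - Derive Psi (t - x)) (r t x).
Proof.
refine (null_derive_eq _ _ _ _ _ _ _ (smooth2_null_derive f t x fs) _ _); unfold p, r; ring.
Qed.

Lemma sol_p_null t x : null_derive p t x (puu t x) (m t x).
Proof.
refine (null_derive_eq _ _ _ _ _ _ _ (null_derive_plus _ _ _ _ _ _ _ _
  (smooth2_null_derive _ t x (smooth2_U f fs)) (null_derive_psi Psi hPsi t x)) _ _).
- reflexivity.
- rewrite smooth2_VU by exact fs. unfold m. ring.
Qed.

Lemma sol_r_null t x : null_derive r t x (m t x) (rvv t x).
Proof. exact (smooth2_null_derive _ t x (smooth2_V f fs)). Qed.

Lemma psi_cont k t x : continuity_2d_pt (fun t x => Derive_n Psi k (t - x)) t x.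
Proof.
apply (continuous_comp_2d (Derive_n Psi k) (fun t x => t - x)).
- intros s. apply Derive_n_continuous, hPsi.
- apply continuity_2d_pt_minus; [apply continuity_2d_pt_id1|apply continuity_2d_pt_id2].
Qed.

Lemma sol_p_cont t x : continuity_2d_pt p t x.
Proof. apply continuity_2d_pt_plus; [apply smooth2_cont, smooth2_U, fs|apply (psi_cont 1)]. Qed.
Lemma sol_r_cont t x : continuity_2d_pt r t x.
Proof. apply smooth2_cont, smooth2_V, fs. Qed.
Lemma sol_puu_cont t x : continuity_2d_pt puu t x.
Proof. apply continuity_2d_pt_plus; [apply smooth2_cont, smooth2_U, smooth2_U, fs|apply (psi_cont 2)]. Qed.
Lemma sol_m_cont t x : continuity_2d_pt m t x.
Proof. apply smooth2_cont, smooth2_U, smooth2_V, fs. Qed.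
Lemma sol_rvv_cont t x : continuity_2d_pt rvv t x.
Proof. apply smooth2_cont, smooth2_V, smooth2_V, fs. Qed.

Lemma sol_lorentz t x : 0 <= t -> 0 < 1 - 4 * (p t x * r t x).
Proof. intros Ht. apply (lorentzian_phi _ _ _ _ sol_null), (proj1 (proj2 sol) t x Ht). Qed.

(** Away from the zeros of 1 - 2 Psi' r the degenerate factor can be
    divided out. *)
Lemma sol_string t x : 0 <= t -> Rabs (Derive Psi (t - x) * (2 * r t x)) < 1 ->
  (1 - 2 * (p t x * r t x)) * m t x + r t x ^ 2 * puu t x + p t x ^ 2 * rvv t x = 0.
Proof.
intros Ht Hs. apply Rabs_lt_between in Hs.
pose proof (sol_lorentz t x Ht) as L.
pose proof (box_minus_source Psi f p r hPsi sol_null t x _ _ _ (sol_p_null t x) (sol_r_null t x)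
  (sol_p_cont t x) (sol_r_cont t x) L) as E.
rewrite (proj2 (proj1 (proj2 sol) t x Ht)), Rminus_diag in E by reflexivity.
symmetry in E. apply Rmult_integral in E. destruct E as [E|E]; [exfalso|exact E].
apply Ropp_eq_0_compat in E. rewrite Ropp_involutive in E. revert E.
apply Rmult_integral_contrapositive_currified; [|apply Rinv_neq_0_compat, pow_nonzero; lra].
apply Rmult_integral_contrapositive_currified; [lra|]. apply pow_nonzero. lra.
Qed.

(* The invariants of f at the point with feet y, z of the explicit solution. *)
Let A y z := inv_a (p (T y z) (X y z)) (r (T y z) (X y z)).
Let B y z := inv_b (p (T y z) (X y z)) (r (T y z) (X y z)).
Let root t x := sqrt (1 - 4 * (p t x * r t x)).
(* The quantity 2 Psi' r, which has to stay away from 1. *)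
Let theta t x := Derive Psi (t - x) * (2 * r t x).
Let ka y z := dens b a z * ((b z + B y z) *
   ((puu (T y z) (X y z) + A y z ^ 2 * m (T y z) (X y z)) * / root (T y z) (X y z))).
Let kb y z := dens a b y * ((a y + A y z) *
   ((rvv (T y z) (X y z) + B y z ^ 2 * m (T y z) (X y z)) * / root (T y z) (X y z))).

(** The characteristics of the explicit solution have slope b^2, those of f
    have slope B^2; the mismatch is what remains of the transport equation
    for A. *)
Lemma A_derive_z y z : y <= z -> Rabs (theta (T y z) (X y z)) < 1 ->
  is_derive (fun z => A y z) z (ka y z * (b z - B y z)).
Proof.
intros Hyz Hth. apply (char_t_nonneg a b H) in Hyz.
pose proof (along_z a b H p _ _ y z sol_p_null (sol_puu_cont _ _) (sol_m_cont _ _)) as DP.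
pose proof (along_z a b H r _ _ y z sol_r_null (sol_m_cont _ _) (sol_rvv_cont _ _)) as DR.
pose proof (sol_lorentz _ (X y z) Hyz) as L.
evar_last; [exact (inv_a_derive _ _ _ _ _ DP DR L)|].
pose proof (transport_algebra _ _ _ _ _ L (sol_string _ _ Hyz Hth)) as E.
cbv beta. fold (T y z) (X y z) in *. fold (A y z) (B y z) in *. unfold ka, root, Rdiv.
replace (dens b a z * (b z ^ 2 * puu (T y z) (X y z) + m (T y z) (X y z)) +
  A y z ^ 2 * (dens b a z * (b z ^ 2 * m (T y z) (X y z) + rvv (T y z) (X y z))))
with (dens b a z * (b z ^ 2 * (puu (T y z) (X y z) + A y z ^ 2 * m (T y z) (X y z)) +
   (m (T y z) (X y z) + A y z ^ 2 * rvv (T y z) (X y z)))) by ring.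
rewrite E. ring.
Qed.

Lemma B_derive_y y z : y <= z -> Rabs (theta (T y z) (X y z)) < 1 ->
  is_derive (fun y => B y z) y (- (kb y z * (a y - A y z))).
Proof.
intros Hyz Hth. apply (char_t_nonneg a b H) in Hyz.
pose proof (along_y a b H p _ _ y z sol_p_null (sol_puu_cont _ _) (sol_m_cont _ _)) as DP.
pose proof (along_y a b H r _ _ y z sol_r_null (sol_m_cont _ _) (sol_rvv_cont _ _)) as DR.
pose proof (sol_lorentz _ (X y z) Hyz) as L.
fold (T y z) (X y z) in *.
assert (L' : 0 < 1 - 4 * (r (T y z) (X y z) * p (T y z) (X y z))) by (rewrite (Rmult_comm (r _ _)); exact L).
apply (is_derive_ext (fun y => inv_a (r (T y z) (X y z)) (p (T y z) (X y z))));
  [intros; unfold B; symmetry; apply inv_ab_swap|].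
evar_last; [exact (inv_a_derive _ _ _ _ _ DR DP L')|].
assert (Es : (1 - 2 * (r (T y z) (X y z) * p (T y z) (X y z))) * m (T y z) (X y z) + p (T y z) (X y z) ^ 2 * rvv (T y z) (X y z)
   + r (T y z) (X y z) ^ 2 * puu (T y z) (X y z) = 0).
{ rewrite <- (sol_string _ _ Hyz Hth). fold (X y z). ring. }
pose proof (transport_algebra _ _ _ _ _ L' Es) as E.
rewrite inv_ab_swap, <- (inv_ab_swap (p _ _)) in E.
cbv beta. fold (T y z) (X y z). rewrite <- (inv_ab_swap (p (T y z) (X y z)) (r (T y z) (X y z))).
fold (A y z) (B y z) in *. unfold kb, root, Rdiv.
rewrite (Rmult_comm (r (T y z) (X y z)) (p (T y z) (X y z))).
replace (- (dens a b y * (m (T y z) (X y z) + a y ^ 2 * rvv (T y z) (X y z))) +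
  B y z ^ 2 * - (dens a b y * (puu (T y z) (X y z) + a y ^ 2 * m (T y z) (X y z))))
with (- (dens a b y * (a y ^ 2 * (rvv (T y z) (X y z) + B y z ^ 2 * m (T y z) (X y z)) +
   (m (T y z) (X y z) + B y z ^ 2 * puu (T y z) (X y z))))) by ring.
rewrite E. ring.
Qed.

Lemma T_cont y z : continuity_2d_pt T y z /\ continuity_2d_pt X y z.
Proof.
assert (H' := small_pair_sym _ _ H).
assert (Pc : forall h, (forall s, continuous h s) -> forall s, continuous (primitive h) s).
{ intros h Hh s. apply (ex_derive_continuous (primitive h)). eexists. apply primitive_derive, Hh. }
assert (Cu : continuity_2d_pt (char_u a b) y z).
{ unfold char_u. apply continuity_2d_pt_plus; [apply continuity_2d_pt_opp|].
  - apply (continuous_comp_2d (primitive _) (fun y _ => y)); [apply Pc; intros; apply dens_continuous, H|apply continuity_2d_pt_id1].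
  - apply (continuous_comp_2d (primitive _) (fun _ z => z)); [apply Pc; intros; apply sqr_dens_continuous, H'|apply continuity_2d_pt_id2]. }
assert (Cv : continuity_2d_pt (char_v a b) y z).
{ unfold char_v. apply continuity_2d_pt_plus; [apply continuity_2d_pt_opp|].
  - apply (continuous_comp_2d (primitive _) (fun y _ => y)); [apply Pc; intros; apply sqr_dens_continuous, H|apply continuity_2d_pt_id1].
  - apply (continuous_comp_2d (primitive _) (fun _ z => z)); [apply Pc; intros; apply dens_continuous, H'|apply continuity_2d_pt_id2]. }
split; apply continuity_2d_pt_mult; try apply continuity_2d_pt_const;
 [apply continuity_2d_pt_plus|apply continuity_2d_pt_minus]; assumption.
Qed.

Lemma on_char_cont N y z : continuity_2d_pt N (T y z) (X y z) -> continuity_2d_pt (fun y z => N (T y z) (X y z)) y z.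
Proof. intros C. apply continuity_2d_pt_comp2; [exact C|apply T_cont|apply T_cont]. Qed.

Lemma inv_cont t x : 0 <= t ->
  continuity_2d_pt (fun t x => inv_a (p t x) (r t x)) t x /\
  continuity_2d_pt (fun t x => inv_b (p t x) (r t x)) t x /\
  continuity_2d_pt (fun t x => / root t x) t x.
Proof.
intros Ht. pose proof (sol_lorentz t x Ht) as L.
assert (Cp := sol_p_cont t x). assert (Cr := sol_r_cont t x).
assert (CS : continuity_2d_pt root t x).
{ apply (continuous_comp_2d sqrt (fun t x => 1 - 4 * (p t x * r t x))); [apply continuous_sqrt|].
  apply continuity_2d_pt_minus; [apply continuity_2d_pt_const|].
  apply continuity_2d_pt_mult; [apply continuity_2d_pt_const|apply continuity_2d_pt_mult; assumption]. }
assert (PS : 0 < root t x) by (apply sqrt_lt_R0, L).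
assert (Ci : continuity_2d_pt (fun t x => / (1 + root t x)) t x).
{ apply continuity_2d_pt_inv; [apply continuity_2d_pt_plus; [apply continuity_2d_pt_const|exact CS]|lra]. }
split; [|split].
- apply continuity_2d_pt_mult; [apply continuity_2d_pt_mult; [apply continuity_2d_pt_const|exact Cp]|exact Ci].
- apply continuity_2d_pt_mult; [apply continuity_2d_pt_mult; [apply continuity_2d_pt_const|exact Cr]|exact Ci].
- apply continuity_2d_pt_inv; [exact CS|lra].
Qed.

Let sq_cont h y z : continuity_2d_pt h y z -> continuity_2d_pt (fun y z => h y z ^ 2) y z.
Proof.
intros C. apply (continuity_2d_pt_ext (fun y z => h y z * h y z)); [intros; simpl; ring|].
apply continuity_2d_pt_mult; exact C.
Qed.

Lemma ka_kb_cont y z : y <= z -> continuity_2d_pt ka y z /\ continuity_2d_pt kb y z.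
Proof.
intros Hyz. apply (char_t_nonneg a b H) in Hyz. fold (T y z) in Hyz.
destruct (inv_cont _ (X y z) Hyz) as (C1 & C2 & C3).
apply on_char_cont in C1, C2, C3. fold A B in C1, C2.
assert (H' := small_pair_sym _ _ H).
split.
- apply (continuity_2d_pt_mult (fun y z => dens b a z)); [|apply (continuity_2d_pt_mult (fun y z => b z + B y z))].
  + apply (continuous_comp_2d (dens b a) (fun y z => z)); [intros; apply dens_continuous, H'|apply continuity_2d_pt_id2].
  + apply continuity_2d_pt_plus; [|exact C2].
    apply (continuous_comp_2d b (fun y z => z)); [apply H|apply continuity_2d_pt_id2].
  + apply continuity_2d_pt_mult; [|exact C3].
    apply continuity_2d_pt_plus; [apply on_char_cont, sol_puu_cont|].
    apply continuity_2d_pt_mult; [apply sq_cont, C1|apply on_char_cont, sol_m_cont].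
- apply (continuity_2d_pt_mult (fun y z => dens a b y)); [|apply (continuity_2d_pt_mult (fun y z => a y + A y z))].
  + apply (continuous_comp_2d (dens a b) (fun y z => y)); [intros; apply dens_continuous, H|apply continuity_2d_pt_id1].
  + apply continuity_2d_pt_plus; [|exact C1].
    apply (continuous_comp_2d a (fun y z => y)); [apply H|apply continuity_2d_pt_id1].
  + apply continuity_2d_pt_mult; [|exact C3].
    apply continuity_2d_pt_plus; [apply on_char_cont, sol_rvv_cont|].
    apply continuity_2d_pt_mult; [apply sq_cont, C2|apply on_char_cont, sol_m_cont].
Qed.

Let theta_u t x := Derive_n Psi 2 (t - x) * (2 * r t x) + Derive Psi (t - x) * (2 * m t x).
Let theta_v t x := Derive Psi (t - x) * (2 * rvv t x).
Let kt y z := dens b a z * (b z ^ 2 * theta_u (T y z) (X y z) + theta_v (T y z) (X y z)).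

Lemma theta_u_cont t x : continuity_2d_pt theta_u t x.
Proof.
apply continuity_2d_pt_plus; (apply continuity_2d_pt_mult; [apply (psi_cont 2) || apply (psi_cont 1)|]);
  (apply continuity_2d_pt_mult; [apply continuity_2d_pt_const|]); [apply sol_r_cont|apply sol_m_cont].
Qed.

Lemma theta_v_cont t x : continuity_2d_pt theta_v t x.
Proof.
apply continuity_2d_pt_mult; [apply (psi_cont 1)|].
apply continuity_2d_pt_mult; [apply continuity_2d_pt_const|apply sol_rvv_cont].
Qed.

Lemma theta_derive_z y z : is_derive (fun z => theta (T y z) (X y z)) z (kt y z).
Proof.
apply (along_z a b H theta theta_u theta_v); [|apply theta_u_cont|apply theta_v_cont].
intros t x. refine (null_derive_eq _ _ _ _ _ _ _ (null_derive_mult _ _ _ _ _ _ _ _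
  (null_derive_psi Psi hPsi t x) (null_derive_scal 2 _ _ _ _ _ (sol_r_null t x))) _ _).
- reflexivity.
- unfold theta_v. ring.
Qed.

Lemma kt_cont y z : continuity_2d_pt kt y z.
Proof.
assert (H' := small_pair_sym _ _ H).
apply (continuity_2d_pt_mult (fun y z => dens b a z)); [|apply continuity_2d_pt_plus; [apply continuity_2d_pt_mult|]].
- apply (continuous_comp_2d (dens b a) (fun y z => z)); [intros; apply dens_continuous, H'|apply continuity_2d_pt_id2].
- apply (sq_cont (fun y z => b z)), (continuous_comp_2d b (fun y z => z)); [apply H|apply continuity_2d_pt_id2].
- apply on_char_cont, theta_u_cont.
- apply on_char_cont, theta_v_cont.
Qed.

Lemma initial_invariants y : A y y = a y /\ B y y = b y.
Proof.
assert (Ef : forall x, f 0 x = F x /\ Dt f 0 x = G x) by (intros; apply sol).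
assert (EX : Dx f 0 y = Derive F y).
{ unfold Dx. apply Derive_ext. intros; apply Ef. }
rewrite (is_derive_unique _ _ _ (HF y)) in EX.
assert (Ep : p 0 y = a y / (1 + a y * b y)).
{ unfold p, U. rewrite EX, (proj2 (Ef y)), HG. replace (0 - y) with (- y) by ring. field.
  pose proof (one_plus_ab_pos a b H y y). lra. }
assert (Er : r 0 y = b y / (1 + a y * b y)).
{ unfold r, V. rewrite EX, (proj2 (Ef y)), HG. field.
  pose proof (one_plus_ab_pos a b H y y). lra. }
unfold A, B, T, X. rewrite (char_t_diag a b H), (char_x_diag a b H), Ep, Er.
pose proof (small_prod _ _ H y y) as Hs. split.
- apply inv_a_of_ab, Hs.
- rewrite inv_ab_swap, (Rmult_comm (a y)). apply inv_a_of_ab. rewrite Rmult_comm. exact Hs.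
Qed.

(** Induction over strips z - y <= n eta.  If the invariants agree on one strip,
    then theta is at most 1/2 there and, its z-derivative being bounded, less
    than 1 on the next strip; so the transport equations hold on it.
    Integrating them from the known strip over a length at most eta, with
    coefficients bounded by K and K eta = 1/4, every bound on the two
    differences can be halved, so they vanish. *)
Lemma invariants_agree y0 z0 y z : y0 <= y -> y <= z -> z <= z0 -> A y z = a y /\ B y z = b z.
Proof.
intros Hy0 Hyz0 Hz0.
assert (H0 : y0 <= z0) by lra.
destruct (bounded_on_triangle ka y0 z0 H0) as [K1 HK1]; [intros; apply ka_kb_cont; assumption|].
destruct (bounded_on_triangle kb y0 z0 H0) as [K2 HK2]; [intros; apply ka_kb_cont; assumption|].
destruct (bounded_on_triangle kt y0 z0 H0) as [K3 HK3]; [intros; apply kt_cont|].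
destruct (bounded_on_triangle (fun y z => a y - A y z) y0 z0 H0) as [M1 HM1].
{ intros y1 z1 _ h _. apply (char_t_nonneg a b H) in h. apply continuity_2d_pt_minus.
  - apply (continuous_comp_2d a (fun y z => y)); [apply H|apply continuity_2d_pt_id1].
  - apply (on_char_cont (fun t x => inv_a (p t x) (r t x))), inv_cont, h. }
destruct (bounded_on_triangle (fun y z => b z - B y z) y0 z0 H0) as [M2 HM2].
{ intros y1 z1 _ h _. apply (char_t_nonneg a b H) in h. apply continuity_2d_pt_minus.
  - apply (continuous_comp_2d b (fun y z => z)); [apply H|apply continuity_2d_pt_id2].
  - apply (on_char_cont (fun t x => inv_b (p t x) (r t x))), inv_cont, h. }
set (K := 1 + Rabs K1 + Rabs K2 + Rabs K3).
assert (HKp : 1 <= K) by (unfold K; pose proof (Rabs_pos K1); pose proof (Rabs_pos K2); pose proof (Rabs_pos K3); lra).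
assert (HK : forall y z, y0 <= y -> y <= z -> z <= z0 -> Rabs (ka y z) <= K /\ Rabs (kb y z) <= K /\ Rabs (kt y z) <= K).
{ intros y1 z1 h1 h2 h3. specialize (HK1 _ _ h1 h2 h3). specialize (HK2 _ _ h1 h2 h3). specialize (HK3 _ _ h1 h2 h3).
  unfold K. pose proof (Rle_abs K1). pose proof (Rle_abs K2). pose proof (Rle_abs K3).
  pose proof (Rabs_pos K1). pose proof (Rabs_pos K2). pose proof (Rabs_pos K3). lra. }
set (M := Rabs M1 + Rabs M2).
set (eta := / (4 * K)).
assert (Peta : 0 < eta) by (apply Rinv_0_lt_compat; lra).
assert (EK : K * eta = / 4) by (unfold eta; field; lra).
assert (Strip : forall n : nat, forall y z, y0 <= y -> y <= z -> z <= z0 -> z - y <= INR n * eta -> A y z = a y /\ B y z = b z).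
{ intros n. induction n as [|n IH]; clear y z Hy0 Hyz0 Hz0; intros y z Hy Hyz Hz Hn.
  - simpl in Hn. assert (z = y) by lra. subst z. apply initial_invariants.
  - assert (Near : forall y z, y0 <= y -> y <= z -> z <= z0 -> z - y <= INR (S n) * eta ->
       exists z1, y <= z1 <= z /\ z - z1 <= eta /\ A y z1 = a y /\ B y z1 = b z1).
    { clear y z Hy Hyz Hz Hn. intros y z Hy Hyz Hz Hn. rewrite S_INR in Hn.
      exists (Rmax y (z - eta)). pose proof (Rmax_l y (z - eta)). pose proof (Rmax_r y (z - eta)).
      assert (Rmax y (z - eta) <= z) by (apply Rmax_lub; lra).
      assert (Rmax y (z - eta) <= y + INR n * eta).
      { apply Rmax_lub; [|lra]. assert (0 <= INR n * eta) by (apply Rmult_le_pos; [apply pos_INR|lra]). lra. }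
      split; [lra|]. split; [lra|]. apply IH; lra. }
    assert (Near' : forall y z, y0 <= y -> y <= z -> z <= z0 -> z - y <= INR (S n) * eta ->
       exists y1, y <= y1 <= z /\ y1 - y <= eta /\ A y1 z = a y1 /\ B y1 z = b z).
    { clear y z Hy Hyz Hz Hn. intros y z Hy Hyz Hz Hn. rewrite S_INR in Hn.
      exists (Rmin z (y + eta)). pose proof (Rmin_l z (y + eta)). pose proof (Rmin_r z (y + eta)).
      assert (y <= Rmin z (y + eta)) by (apply Rmin_glb; lra).
      assert (z - INR n * eta <= Rmin z (y + eta)).
      { apply Rmin_glb; [|lra]. assert (0 <= INR n * eta) by (apply Rmult_le_pos; [apply pos_INR|lra]). lra. }
      split; [lra|]. split; [lra|]. apply IH; lra. }
    (* theta at (y, z) differs by at most 1/4 from its value on the known strip. *)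
    assert (Th : forall y z, y0 <= y -> y <= z -> z <= z0 -> z - y <= INR (S n) * eta ->
       Rabs (theta (T y z) (X y z)) < 1).
    { clear y z Hy Hyz Hz Hn. intros y z Hy Hyz Hz Hn.
      destruct (Near y z Hy Hyz Hz Hn) as (z1 & Hz1 & Hd & EA & EB).
      assert (T1 : Rabs (theta (T y z1) (X y z1)) <= / 2).
      { assert (ht : 0 <= T y z1) by (apply (proj1 (char_t_nonneg a b H _ _)); lra).
        destruct (state_of_inv _ _ (sol_lorentz _ (X y z1) ht)) as [_ E].
        fold (A y z1) (B y z1) in E. rewrite EA, EB in E. unfold theta. rewrite E. apply Hgr. }
      pose proof (Rabs_MVT (fun z => theta (T y z) (X y z)) (fun z => kt y z) K z1 z) as D. simpl in D.
      rewrite Rmin_left, Rmax_right in D by lra.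
      specialize (D (fun s _ => theta_derive_z y s)).
      assert (D' : Rabs (theta (T y z) (X y z) - theta (T y z1) (X y z1)) <= K * Rabs (z - z1)).
      { apply D. intros s Hs. apply HK; lra. }
      rewrite (Rabs_pos_eq (z - z1)) in D' by lra.
      assert (K * (z - z1) <= K * eta) by (apply Rmult_le_compat_l; lra).
      pose proof (Rabs_triang_inv (theta (T y z) (X y z)) (theta (T y z1) (X y z1))). lra. }
    assert (Halve : forall j : nat, forall y z, y0 <= y -> y <= z -> z <= z0 -> z - y <= INR (S n) * eta ->
       Rabs (a y - A y z) <= M * (/ 2) ^ j /\ Rabs (b z - B y z) <= M * (/ 2) ^ j).
    { clear y z Hy Hyz Hz Hn. intros j. induction j as [|j IHj]; intros y z Hy Hyz Hz Hn.
      - specialize (HM1 y z Hy Hyz Hz). specialize (HM2 y z Hy Hyz Hz). simpl in *. unfold M.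
        pose proof (Rle_abs M1). pose proof (Rle_abs M2). pose proof (Rabs_pos M1). pose proof (Rabs_pos M2). lra.
      - set (Mj := M * (/ 2) ^ j) in *.
        assert (PMj : 0 <= Mj) by (eapply Rle_trans; [apply Rabs_pos|apply (IHj y z Hy Hyz Hz Hn)]).
        replace (M * (/ 2) ^ S j) with (Mj * / 2) by (unfold Mj; simpl; ring).
        assert (Fin : forall w, w <= eta -> (K * Mj) * w <= Mj * / 2).
        { intros w Hw. apply Rle_trans with (K * Mj * eta).
          - apply Rmult_le_compat_l; [apply Rmult_le_pos; lra|exact Hw].
          - replace (K * Mj * eta) with (Mj * (K * eta)) by ring. rewrite EK. lra. }
        split.
        + destruct (Near y z Hy Hyz Hz Hn) as (z1 & Hz1 & Hd & EA & _).
          pose proof (Rabs_MVT (fun z => A y z) (fun z => ka y z * (b z - B y z)) (K * Mj) z1 z) as D. simpl in D.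
          rewrite Rmin_left, Rmax_right in D by lra.
          rewrite EA in D. rewrite Rabs_minus_sym. eapply Rle_trans; [apply D|].
          * intros s Hs. apply A_derive_z; [lra|apply Th; lra].
          * intros s Hs. rewrite Rabs_mult. apply Rmult_le_compat; try apply Rabs_pos; [apply HK; lra|apply IHj; lra].
          * rewrite Rabs_pos_eq by lra. apply Fin, Hd.
        + destruct (Near' y z Hy Hyz Hz Hn) as (y1 & Hy1 & Hd & _ & EB).
          pose proof (Rabs_MVT (fun y => B y z) (fun y => - (kb y z * (a y - A y z))) (K * Mj) y y1) as D. simpl in D.
          rewrite Rmin_left, Rmax_right in D by lra.
          rewrite EB in D. eapply Rle_trans; [apply D|].
          * intros s Hs. apply B_derive_y; [lra|apply Th; lra].
          * intros s Hs. rewrite Rabs_Ropp, Rabs_mult. apply Rmult_le_compat; try apply Rabs_pos; [apply HK; lra|apply IHj; lra].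
          * rewrite Rabs_pos_eq by lra. apply Fin, Hd. }
    assert (Z1 : Rabs (a y - A y z) <= 0) by (apply (le_0_of_halving _ M); intros j; apply Halve; assumption).
    assert (Z2 : Rabs (b z - B y z) <= 0) by (apply (le_0_of_halving _ M); intros j; apply Halve; assumption).
    apply Rabs_le_between in Z1. apply Rabs_le_between in Z2. lra. }
destruct (nfloor_ex ((z - y) / eta)) as [n [_ Hn]].
{ apply Rmult_le_pos; [lra|apply Rlt_le, Rinv_0_lt_compat, Peta]. }
apply (Strip (S n)); auto. rewrite S_INR.
apply (Rmult_lt_compat_r eta) in Hn; [|exact Peta].
unfold Rdiv in Hn. rewrite Rmult_assoc, Rinv_l in Hn by lra. lra.
Qed.

(** Equal invariants mean equal first derivatives along the characteristic from
    the foot (0, y) to (t, x), and the two functions agree at the foot. *)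
Lemma string_unique t x : 0 <= t -> f t x = string_wave a b Y Z Psi (F 0 + Psi 0) t x.
Proof.
intros Ht. set (phi := string_wave a b Y Z Psi (F 0 + Psi 0)).
assert (N := wave_null a b H Y Z CC Psi hPsi (F 0 + Psi 0)). fold phi in N.
pose proof (cc_t a b Y Z CC t x) as ET. pose proof (cc_x a b Y Z CC t x) as EX.
assert (Hyz : Y t x <= Z t x) by (apply (proj2 (char_t_nonneg a b H _ _)); rewrite ET; exact Ht).
revert Hyz ET EX. generalize (Y t x) (Z t x). intros y z Hyz ET EX.
assert (Cw := fun t x => wave_cont a b Y Z t x H CC).
assert (YZ : forall s, Y (T y s) (X y s) = y /\ Z (T y s) (X y s) = s).
{ intros s. apply (cc_unique _ _ _ _ CC); unfold T, X, char_t, char_x; field. }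
assert (D : forall s, y <= s -> is_derive (fun s => f (T y s) (X y s) - phi (T y s) (X y s)) s 0).
{ intros s Hs.
  assert (Cps : forall t x, continuity_2d_pt (fun t x => p t x - Derive Psi (t - x)) t x)
    by (intros; apply continuity_2d_pt_minus; [apply sol_p_cont|apply (psi_cont 1)]).
  assert (Cws : forall t x, continuity_2d_pt (fun t x => wave_p a b Y Z t x - Derive Psi (t - x)) t x)
    by (intros; apply continuity_2d_pt_minus; [apply Cw|apply (psi_cont 1)]).
  pose proof (along_z a b H f _ _ y s sol_null (Cps _ _) (sol_r_cont _ _)) as D1.
  pose proof (along_z a b H phi _ _ y s N (Cws _ _) (proj2 (Cw _ _))) as D2.
  fold (T y s) (X y s) in *.
  assert (hs : 0 <= T y s) by (apply (proj1 (char_t_nonneg a b H _ _)); exact Hs).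
  destruct (state_of_inv _ _ (sol_lorentz _ (X y s) hs)) as [E1 E2].
  fold (A y s) (B y s) in *.
  destruct (invariants_agree y s y s) as [EA EB]; try lra. rewrite EA, EB in E1, E2.
  unfold wave_p, wave_r in D2. destruct (YZ s) as [EY EZ]. rewrite EY, EZ in D2.
  rewrite <- E1, <- E2 in D2.
  evar_last; [exact (is_derive_minus _ _ _ _ _ D1 D2)|]. unfold minus, plus, opp; simpl; ring. }
pose proof (Rabs_MVT (fun s => f (T y s) (X y s) - phi (T y s) (X y s)) (fun _ => 0) 0 y z) as MV. simpl in MV.
rewrite Rmin_left, Rmax_right in MV by lra.
assert (MV' := MV (fun s Hs => D s (proj1 Hs)) (fun s _ => Req_le _ _ Rabs_R0)). clear MV.
unfold T, X in MV'. rewrite ET, EX, (char_t_diag a b H), (char_x_diag a b H) in MV'.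
assert (E0 : f 0 y = phi 0 y).
{ rewrite (proj1 (proj2 (proj2 sol) y)). symmetry.
  apply (string_solution Psi a b Y Z F G hPsi H CC Ea Eb HF HG). }
rewrite E0, Rminus_diag, Rminus_0_r, Rmult_0_l in MV' by reflexivity. apply Rabs_le_between in MV'. lra.
Qed.
End Uniqueness.

(** * Distance between the feet and the coordinates *)

(** Comparison with C * atan, whose derivative is C / (1 + s^2). *)
Lemma primitive_bound h C x : (forall s, continuous h s) ->
  (forall s, Rabs (h s) <= C / (1 + s ^ 2)) -> Rabs (primitive h x) <= 2 * C.
Proof.
intros Hc Hb.
assert (HC : 0 <= C).
{ specialize (Hb 0). pose proof (Rabs_pos (h 0)). simpl in Hb. lra. }
assert (Dat : forall s, is_derive (fun s => C * atan s) s (C / (1 + s ^ 2))).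
{ intros s. evar_last; [apply is_derive_scal, is_derive_Reals, derivable_pt_lim_atan|].
  unfold Rsqr; simpl. rewrite Rmult_1_r. unfold Rdiv. ring. }
assert (mono : forall g g' : R -> R, (forall s, is_derive g s (g' s)) -> (forall s, 0 <= g' s) -> forall u v, u <= v -> g u <= g v).
{ intros g g' Dg Pg u v Huv. destruct (MVT_gen g u v g') as (c & _ & E).
  - intros; apply Dg.
  - intros s _. apply continuity_pt_filterlim, (ex_derive_continuous g). eexists. apply Dg.
  - assert (0 <= g' c * (v - u)) by (apply Rmult_le_pos; [apply Pg|lra]). lra. }
assert (M1 := mono (fun s => C * atan s - primitive h s) (fun s => C / (1 + s ^ 2) - h s)
  (fun s => is_derive_minus _ _ _ _ _ (Dat s) (primitive_derive h s Hc))).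
assert (M2 := mono (fun s => C * atan s + primitive h s) (fun s => C / (1 + s ^ 2) + h s)
  (fun s => is_derive_plus _ _ _ _ _ (Dat s) (primitive_derive h s Hc))).
assert (B1 : forall s, 0 <= C / (1 + s ^ 2) - h s) by (intros s; specialize (Hb s); apply Rabs_le_between in Hb; lra).
assert (B2 : forall s, 0 <= C / (1 + s ^ 2) + h s) by (intros s; specialize (Hb s); apply Rabs_le_between in Hb; lra).
specialize (M1 B1). specialize (M2 B2).
assert (At : -2 <= atan x <= 2) by (pose proof (atan_bound x); pose proof PI_4; lra).
assert (C * atan x <= 2 * C /\ - (2 * C) <= C * atan x) by nra.
apply Rabs_le. destruct (Rle_or_lt 0 x) as [Hx|Hx].
- specialize (M1 0 x Hx). specialize (M2 0 x Hx). simpl in M1, M2.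
  rewrite atan_0, primitive_0 in M1, M2. lra.
- specialize (M1 x 0 (Rlt_le _ _ Hx)). specialize (M2 x 0 (Rlt_le _ _ Hx)). simpl in M1, M2.
  rewrite atan_0, primitive_0 in M1, M2. lra.
Qed.

Lemma primitive_near_id h C x : (forall s, continuous h s) ->
  (forall s, Rabs (h s - 1) <= C / (1 + s ^ 2)) -> Rabs (primitive h x - x) <= 2 * C.
Proof.
intros Hc Hb.
assert (Hc' : forall s, continuous (fun s => h s - 1) s).
{ intros s. apply (continuous_minus h (fun _ => 1)); [apply Hc|apply continuous_const]. }
pose proof (primitive_bound (fun s => h s - 1) C x Hc' Hb) as B.
replace (primitive h x - x) with (primitive (fun s => h s - 1) x); [exact B|].
apply (eq_of_derive (primitive (fun s => h s - 1)) (fun x => primitive h x - x) (fun s => h s - 1) 0).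
- intros s. apply (primitive_derive (fun s => h s - 1)), Hc'.
- intros s. apply (is_derive_minus (primitive h) (fun x => x)); [apply primitive_derive, Hc|].
  apply (is_derive_id (K:=R_AbsRing)).
- rewrite !primitive_0. ring.
Qed.

(** The characteristic map of each member [d] of the family is ([Y d], [Z d]). *)
Section Decay.
Context {D : Type}.
Variables (gamma : R) (dl : D -> R) (a b : D -> R -> R) (Y Z : D -> R -> R -> R) (Psi : R -> R).
Hypothesis hg : 0 < gamma.
Hypothesis hdl : forall d, 0 < dl d <= 1.
Hypothesis hPsi : smooth1 Psi.

Definition weight_a (d : D) (x : R) : R := rate gamma x.
Definition weight_b (d : D) (x : R) : R := dl d * rate gamma x.

Hypothesis Ha : dominated weight_a a.
Hypothesis Hb : dominated weight_b b.
Hypothesis HP : dominated weight_a (fun _ => Derive Psi).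
Hypothesis Hs : forall d, small_pair (a d) (b d).
Hypothesis CC : forall d, characteristic_coordinates (a d) (b d) (Y d) (Z d).

Lemma weight_a_le_1 d x : 0 <= weight_a d x <= 1.
Proof. split; [apply Rlt_le, rate_pos|apply rate_le_1, hg]. Qed.
Lemma weight_b_le_a d x : 0 <= weight_b d x <= weight_a d x.
Proof.
unfold weight_b, weight_a. pose proof (hdl d). pose proof (rate_pos gamma x). split.
- apply Rmult_le_pos; lra.
- rewrite <- (Rmult_1_l (rate gamma x)) at 2. apply Rmult_le_compat_r; lra.
Qed.

Lemma dominated_a_unit h : dominated weight_a h -> dominated unit_weight h.
Proof.
apply (dominated_le _ _ 1); [lra|]. intros d x. unfold unit_weight. pose proof (weight_a_le_1 d x). lra.
Qed.
Lemma dominated_b_unit h : dominated weight_b h -> dominated unit_weight h.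
Proof.
apply (dominated_le _ _ 1); [lra|]. intros d x. unfold unit_weight.
pose proof (weight_a_le_1 d x). pose proof (weight_b_le_a d x). lra.
Qed.

Lemma dominated_sqr h : dominated unit_weight h -> dominated unit_weight (fun (d : D) x => h d x ^ 2).
Proof.
intros H. replace (fun d x => h d x ^ 2) with (fun (d : D) x => h d x * h d x).
- apply dominated_mult_l; exact H.
- do 2 (apply functional_extensionality; intro). ring.
Qed.

Lemma dominated_inv_dens (f g : D -> R -> R) : (forall d, small_pair (f d) (g d)) ->
  dominated unit_weight f -> dominated unit_weight g ->
  dominated unit_weight (fun d x => / dens (f d) (g d) x).
Proof.
intros S Hf Hg.
replace (fun d x => / dens (f d) (g d) x) with
  (fun (d : D) x => (1 + -1 * (f d x * g d x) ^ 2) * / (1 + g d x ^ 2)).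
- apply dominated_mult_l.
  + apply dominated_plus; [apply dominated_const|]. apply (dominated_scal _ (-1)), dominated_sqr, dominated_mult_l; assumption.
  + apply (dominated_inv _ 1); [lra| |].
    * intros d x. pose proof (pow2_ge_0 (g d x)). lra.
    * apply dominated_plus; [apply dominated_const|apply dominated_sqr, Hg].
- apply functional_extensionality; intro d. apply functional_extensionality; intro x. unfold dens.
  pose proof (pow2_ge_0 (g d x)). pose proof (small_sqr _ _ x x (S d)). simpl in *. field. lra.
Qed.

Lemma inv_dens_a : dominated unit_weight (fun d x => / dens (a d) (b d) x).
Proof. apply dominated_inv_dens; [exact Hs|apply dominated_a_unit, Ha|apply dominated_b_unit, Hb]. Qed.
Lemma inv_dens_b : dominated unit_weight (fun d x => / dens (b d) (a d) x).
Proof.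
apply dominated_inv_dens; [intros; apply small_pair_sym, Hs|apply dominated_b_unit, Hb|apply dominated_a_unit, Ha].
Qed.

Lemma sqr_bound (f : D -> R -> R) : (exists C, 0 <= C /\ forall d x, Rabs (f d x) <= C * rate gamma x) ->
  exists C, 0 <= C /\ forall d x, f d x ^ 2 <= C / (1 + x ^ 2) /\ f d x ^ 2 <= C.
Proof.
intros (C & HC & B). exists (C ^ 2). split; [apply pow2_ge_0|]. intros d x.
specialize (B d x). pose proof (Rabs_pos (f d x)). pose proof (rate_sqr_le gamma x hg).
assert (E : f d x ^ 2 <= C ^ 2 * rate gamma x ^ 2).
{ rewrite <- pow2_abs, <- Rpow_mult_distr. apply pow_incr. lra. }
pose proof (rate_le_1 gamma x hg). pose proof (rate_pos gamma x). pose proof (pow2_ge_0 C).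
split; (eapply Rle_trans; [exact E|]).
- apply Rmult_le_compat_l; auto.
- rewrite <- (Rmult_1_r (C ^ 2)) at 2. apply Rmult_le_compat_l; [auto|]. simpl. nra.
Qed.

(** dens f g - 1 = g^2 (1 + f^2) / (1 - f^2 g^2) and f^2 dens f g are both
    dominated by 1 / (1 + s^2), whose integral over the line is finite. *)
Lemma dens_bounds (f g : D -> R -> R) : (forall d, small_pair (f d) (g d)) ->
  (exists C, 0 <= C /\ forall d x, Rabs (f d x) <= C * rate gamma x) ->
  (exists C, 0 <= C /\ forall d x, Rabs (g d x) <= C * rate gamma x) ->
  exists C, 0 <= C /\ forall d x, Rabs (primitive (dens (f d) (g d)) x - x) <= C /\
    Rabs (primitive (fun s => f d s ^ 2 * dens (f d) (g d) s) x) <= C.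
Proof.
intros S Hf Hg. destruct (sqr_bound f Hf) as (C1 & P1 & B1), (sqr_bound g Hg) as (C2 & P2 & B2).
assert (inv : forall d x, 1 <= / (1 - (f d x * g d x) ^ 2) <= 2).
{ intros d x. pose proof (small_sqr _ _ x x (S d)) as Q. split.
  - rewrite <- Rinv_1 at 1. apply Rinv_le_contravar; lra.
  - apply (Rmult_le_reg_r (1 - (f d x * g d x) ^ 2)); [lra|]. rewrite Rinv_l; lra. }
assert (pd : forall x, 0 < / (1 + x ^ 2)) by (intros x; apply Rinv_0_lt_compat; pose proof (pow2_ge_0 x); lra).
set (C := (1 + C1) * (1 + C2) * 2).
exists (2 * C). split; [unfold C; nra|]. intros d x. split.
- apply primitive_near_id; [intros; apply dens_continuous, S|]. intros s.
  destruct (B1 d s) as [Q1 Q2], (B2 d s) as [R1 R2]. specialize (inv d s). pose proof (small_sqr _ _ s s (S d)) as Q.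
  replace (dens (f d) (g d) s - 1) with (g d s ^ 2 * ((1 + f d s ^ 2) * / (1 - (f d s * g d s) ^ 2)))
    by (unfold dens; simpl in *; field; lra).
  pose proof (pow2_ge_0 (f d s)). pose proof (pow2_ge_0 (g d s)).
  rewrite Rabs_pos_eq by (apply Rmult_le_pos; [lra|apply Rmult_le_pos; lra]).
  apply Rle_trans with (C2 / (1 + s ^ 2) * ((1 + C1) * 2)).
  + apply Rmult_le_compat; try lra; [apply Rmult_le_pos; lra|]. apply Rmult_le_compat; lra.
  + unfold Rdiv. specialize (pd s). replace (C2 * / (1 + s ^ 2) * ((1 + C1) * 2)) with ((C2 * ((1 + C1) * 2)) * / (1 + s ^ 2)) by ring.
    apply Rmult_le_compat_r; [lra|]. unfold C. nra.
- apply primitive_bound; [intros; apply sqr_dens_continuous, S|]. intros s.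
  destruct (B1 d s) as [Q1 Q2], (B2 d s) as [R1 R2]. specialize (inv d s).
  unfold dens, Rdiv at 1.
  pose proof (pow2_ge_0 (f d s)). pose proof (pow2_ge_0 (g d s)).
  rewrite Rabs_pos_eq by (apply Rmult_le_pos; [lra|apply Rmult_le_pos; lra]).
  apply Rle_trans with (C1 / (1 + s ^ 2) * ((1 + C2) * 2)).
  + apply Rmult_le_compat; try lra; [apply Rmult_le_pos; lra|]. apply Rmult_le_compat; lra.
  + unfold Rdiv. specialize (pd s). replace (C1 * / (1 + s ^ 2) * ((1 + C2) * 2)) with ((C1 * ((1 + C2) * 2)) * / (1 + s ^ 2)) by ring.
    apply Rmult_le_compat_r; [lra|]. unfold C. nra.
Qed.

Lemma bound_a : exists C, 0 <= C /\ forall d x, Rabs (a d x) <= C * rate gamma x.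
Proof. exact (dominated_bound _ _ Ha). Qed.
Lemma bound_b : exists C, 0 <= C /\ forall d x, Rabs (b d x) <= C * rate gamma x.
Proof.
destruct (dominated_bound _ _ Hb) as (C & P & B). exists C. split; [exact P|]. intros d x.
eapply Rle_trans; [apply B|]. apply Rmult_le_compat_l; [exact P|]. apply weight_b_le_a.
Qed.

(** |u + y| and |2 ub - z| are bounded by the integrals controlled above and that
    of Psi'^2, and the weight changes by a bounded factor under bounded
    translations and under halving the argument. *)
Lemma rate_feet : exists C, 0 <= C /\ forall d t x,
  rate gamma (Y d t x) <= C * rate gamma (u_ t x) /\ rate gamma (Z d t x) <= C * rate gamma (ub_ Psi t x).
Proof.
destruct (dens_bounds a b Hs bound_a bound_b) as (C1 & P1 & B1).
destruct (dens_bounds b a (fun d => small_pair_sym _ _ (Hs d)) bound_b bound_a) as (C2 & P2 & B2).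
destruct (sqr_bound (fun _ => Derive Psi) (dominated_bound _ _ HP)) as (C3 & P3 & B3).
assert (BP : forall d : D, forall x, Rabs (primitive (fun s => Derive Psi s ^ 2) x) <= 2 * C3).
{ intros d x. apply primitive_bound.
  - intros s. apply (continuous_ext (fun s => Derive Psi s * Derive Psi s)); [intros; simpl; ring|].
    apply continuous_Rmult; apply (Derive_n_continuous Psi 1); exact hPsi.
  - intros s. rewrite Rabs_pos_eq by apply pow2_ge_0. apply (B3 d s). }
set (C := C1 + C2 + 2 * C3).
exists (Rpower (1 + C + 1) (1 + gamma)). split; [apply Rlt_le, exp_pos|]. intros d t x.
pose proof (cc_u _ _ _ _ (CC d) t x) as Eu. pose proof (cc_v _ _ _ _ (CC d) t x) as Ev.
unfold char_u in Eu. unfold char_v in Ev. revert Eu Ev. generalize (Y d t x) (Z d t x). intros y z Eu Ev.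
destruct (B1 d y) as [A1 A2], (B2 d z) as [A3 A4]. specialize (BP d (t - x)).
apply Rabs_le_between in A1, A2, A3, A4, BP.
split; (apply rate_comparable; [exact hg|unfold C; lra|]); (apply jap_le; [unfold C; lra|lra|]).
- unfold u_. rewrite Rmult_1_l.
  replace (t - x) with ((t - x + y) + - y) by ring. eapply Rle_trans; [apply Rabs_triang|].
  rewrite Rabs_Ropp. apply Rplus_le_compat_r, Rabs_le. unfold C. lra.
- rewrite Rmult_1_l. unfold ub_. unfold primitive in BP.
  set (J := RInt (fun s => Derive Psi s ^ 2) 0 (t - x)) in *.
  replace ((t + x) / 2 - / 2 * J) with ((t + x - z - J) / 2 + z / 2) by field.
  eapply Rle_trans; [apply Rabs_triang|]. apply Rplus_le_compat.
  + apply Rabs_le. unfold C. lra.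
  + unfold Rdiv. rewrite Rabs_mult, (Rabs_pos_eq (/ 2)) by lra. pose proof (Rabs_pos z). lra.
Qed.

(** * The algebra of decaying functions *)
Definition inv_jac (d : D) (t x : R) : R := / (1 - (a d (Y d t x) * b d (Z d t x)) ^ 2).

(** The flags say which factors are known: the first one a factor
    Lambda^{-1/2}(u), the second one a factor delta Lambda^{-1/2}(ub).  The
    generators are chosen so that their derivatives stay in the algebra.  Functions
    of z enter only when they are dominated with the factor delta: the density
    [dens b a] is not, as it contains a(z), but it only ever occurs multiplied by a
    derivative of b. *)
Inductive decaying : bool -> bool -> (D -> R -> R -> R) -> Prop :=
| decaying_y k : dominated weight_a k -> decaying true false (fun d t x => k d (Y d t x))
| decaying_z k : dominated weight_b k -> decaying false true (fun d t x => k d (Z d t x))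
| decaying_u k : dominated weight_a k -> decaying true false (fun d t x => k d (t - x))
| decaying_jac : decaying false false inv_jac
| decaying_const c : decaying false false (fun _ _ _ => c)
| decaying_plus i j h1 h2 : decaying i j h1 -> decaying i j h2 ->
    decaying i j (fun d t x => h1 d t x + h2 d t x)
| decaying_mult i1 j1 i2 j2 h1 h2 : decaying i1 j1 h1 -> decaying i2 j2 h2 ->
    decaying (i1 || i2) (j1 || j2) (fun d t x => h1 d t x * h2 d t x)
| decaying_weak_l j h : decaying true j h -> decaying false j h
| decaying_weak_r i h : decaying i true h -> decaying i false h.

Definition decay_weight (i j : bool) (d : D) (t x : R) : R :=
  (if i then rate gamma (u_ t x) else 1) * (if j then dl d * rate gamma (ub_ Psi t x) else 1).

Lemma decay_weight_factors (i j : bool) d t x :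
  0 <= (if i then rate gamma (u_ t x) else 1) <= 1 /\
  0 <= (if j then dl d * rate gamma (ub_ Psi t x) else 1) <= 1.
Proof.
pose proof (rate_pos gamma (u_ t x)). pose proof (rate_le_1 gamma (u_ t x) hg).
pose proof (rate_pos gamma (ub_ Psi t x)). pose proof (rate_le_1 gamma (ub_ Psi t x) hg). pose proof (hdl d).
split; [destruct i; lra|]. destruct j; [|lra]. split; [apply Rmult_le_pos; lra|].
rewrite <- (Rmult_1_l 1). apply Rmult_le_compat; lra.
Qed.

(** The factors of the weight are at most 1, so a repeated factor can be
    dropped. *)
Lemma decay_weight_mult i1 j1 i2 j2 d t x :
  decay_weight i1 j1 d t x * decay_weight i2 j2 d t x <= decay_weight (i1 || i2) (j1 || j2) d t x.
Proof.
unfold decay_weight.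
destruct (decay_weight_factors i1 j1 d t x) as [A1 B1]. destruct (decay_weight_factors i2 j2 d t x) as [A2 B2].
set (p1 := if i1 then _ else _) in *. set (q1 := if j1 then _ else _) in *.
set (p2 := if i2 then rate _ _ else _) in *. set (q2 := if j2 then dl d * _ else _) in *.
replace (p1 * q1 * (p2 * q2)) with ((p1 * p2) * (q1 * q2)) by ring.
assert (Hp : p1 * p2 <= if (i1 || i2)%bool then rate gamma (u_ t x) else 1).
{ unfold p1, p2 in *. destruct i1, i2; simpl; nra. }
assert (Hq : q1 * q2 <= if (j1 || j2)%bool then dl d * rate gamma (ub_ Psi t x) else 1).
{ unfold q1, q2 in *. destruct j1, j2; simpl; nra. }
apply Rmult_le_compat; auto; apply Rmult_le_pos; lra.
Qed.

Lemma decaying_bound i j h : decaying i j h ->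
  exists C, 0 <= C /\ forall d t x, Rabs (h d t x) <= C * decay_weight i j d t x.
Proof.
destruct rate_feet as (CW & PW & BW).
intros Hh. induction Hh as [k Hk|k Hk|k Hk| |c|i j h1 h2 _ [C1 [P1 B1]] _ [C2 [P2 B2]]
  |i1 j1 i2 j2 h1 h2 _ [C1 [P1 B1]] _ [C2 [P2 B2]]|j h _ [C [P B]]|i h _ [C [P B]]].
- destruct (dominated_bound _ _ Hk) as (C & P & B). exists (C * CW). split; [apply Rmult_le_pos; auto|].
  intros d t x. eapply Rle_trans; [apply B|]. unfold weight_a, decay_weight. rewrite Rmult_1_r, Rmult_assoc.
  apply Rmult_le_compat_l; [exact P|]. apply BW.
- destruct (dominated_bound _ _ Hk) as (C & P & B). exists (C * CW). split; [apply Rmult_le_pos; auto|].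
  intros d t x. eapply Rle_trans; [apply B|]. unfold weight_b, decay_weight. rewrite Rmult_1_l, Rmult_assoc.
  apply Rmult_le_compat_l; [exact P|].
  replace (CW * (dl d * rate gamma (ub_ Psi t x))) with (dl d * (CW * rate gamma (ub_ Psi t x))) by ring.
  apply Rmult_le_compat_l; [pose proof (hdl d); lra|]. apply BW.
- destruct (dominated_bound _ _ Hk) as (C & P & B). exists C. split; [exact P|].
  intros d t x. eapply Rle_trans; [apply B|]. unfold weight_a, decay_weight, u_. lra.
- exists 2. split; [lra|]. intros d t x. unfold decay_weight, inv_jac.
  pose proof (small_sqr _ _ (Y d t x) (Z d t x) (Hs d)) as S.
  rewrite Rabs_pos_eq by (apply Rlt_le, Rinv_0_lt_compat; lra).
  apply (Rmult_le_reg_r (1 - (a d (Y d t x) * b d (Z d t x)) ^ 2)); [lra|]. rewrite Rinv_l; lra.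
- exists (Rabs c). split; [apply Rabs_pos|]. intros. unfold decay_weight. lra.
- exists (C1 + C2). split; [lra|]. intros d t x. specialize (B1 d t x). specialize (B2 d t x).
  pose proof (Rabs_triang (h1 d t x) (h2 d t x)). lra.
- exists (C1 * C2). split; [apply Rmult_le_pos; auto|]. intros d t x. rewrite Rabs_mult.
  apply Rle_trans with ((C1 * decay_weight i1 j1 d t x) * (C2 * decay_weight i2 j2 d t x)).
  + apply Rmult_le_compat; auto using Rabs_pos.
  + replace (C1 * decay_weight i1 j1 d t x * (C2 * decay_weight i2 j2 d t x)) with
      (C1 * C2 * (decay_weight i1 j1 d t x * decay_weight i2 j2 d t x)) by ring.
    apply Rmult_le_compat_l; [apply Rmult_le_pos; auto|apply decay_weight_mult].
- exists C. split; [exact P|]. intros d t x. eapply Rle_trans; [apply B|]. apply Rmult_le_compat_l; [exact P|].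
  unfold decay_weight. destruct (decay_weight_factors true j d t x). apply Rmult_le_compat_r; lra.
- exists C. split; [exact P|]. intros d t x. eapply Rle_trans; [apply B|]. apply Rmult_le_compat_l; [exact P|].
  unfold decay_weight. destruct (decay_weight_factors i true d t x). apply Rmult_le_compat_l; lra.
Qed.

Lemma decaying_cont i j h d t x : decaying i j h -> continuity_2d_pt (h d) t x.
Proof.
assert (Dc : forall w (k : D -> R -> R) s, dominated w k -> continuous (k d) s).
{ intros w k s Hk. apply (ex_derive_continuous (k d)). apply (dominated_ex_derive _ _ _ _ Hk). }
intros Hh. induction Hh.
- apply continuous_comp_2d; [intros; eapply Dc; eassumption|apply CC].
- apply continuous_comp_2d; [intros; eapply Dc; eassumption|apply CC].
- apply (continuous_comp_2d (k d) (fun t x => t - x)); [intros; eapply Dc; eassumption|].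
  apply continuity_2d_pt_minus; [apply continuity_2d_pt_id1|apply continuity_2d_pt_id2].
- assert (C : continuity_2d_pt (fun t x => a d (Y d t x) * b d (Z d t x)) t x).
  { apply continuity_2d_pt_mult; (apply continuous_comp_2d; [intros; eapply Dc; eassumption|apply CC]). }
  unfold inv_jac. apply continuity_2d_pt_inv.
  + apply continuity_2d_pt_minus; [apply continuity_2d_pt_const|].
    apply (continuity_2d_pt_ext (fun t x => (a d (Y d t x) * b d (Z d t x)) * (a d (Y d t x) * b d (Z d t x))));
      [intros; simpl; ring|]. apply continuity_2d_pt_mult; exact C.
  + pose proof (small_sqr _ _ (Y d t x) (Z d t x) (Hs d)). lra.
- apply continuity_2d_pt_const.
- apply continuity_2d_pt_plus; assumption.
- apply continuity_2d_pt_mult; assumption.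
- assumption.
- assumption.
Qed.

(** The null derivatives are recovered from the coordinate derivatives through
    d_u = U + Psi'^2 V and d_ub = 2 V. *)
Definition frame_derive (h hu hb : D -> R -> R -> R) : Prop := forall d t x,
  null_derive (h d) t x (hu d t x - Derive Psi (t - x) ^ 2 * (hb d t x / 2)) (hb d t x / 2).

Lemma frame_derive_eq h hu hb d : frame_derive h hu hb -> d_u Psi (h d) = hu d /\ d_ub (h d) = hb d.
Proof.
intros F. split; do 2 (apply functional_extensionality; intro).
- rewrite (d_u_null _ _ _ _ _ _ (F d x x0)). field.
- rewrite (d_ub_null _ _ _ _ _ (F d x x0)). field.
Qed.

Lemma decaying_weaken i j h : decaying true true h -> decaying i j h.
Proof. destruct i, j; intros; repeat (assumption || apply decaying_weak_l || apply decaying_weak_r). Qed.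

Lemma decaying_bounded i j h : decaying i j h -> decaying false false h.
Proof. destruct i, j; auto using decaying_weak_l, decaying_weak_r. Qed.

Let dpsi := decaying_u _ HP.
Let da := decaying_y _ Ha.
Let db := decaying_z _ Hb.

(** With J = 1 - a^2 b^2, d_u y = (-1 + Psi'^2 b^2) / (dens J) and
    d_ub y = 2 b^2 / (dens J): the transversal derivative of a function of y gains
    two factors b, hence a factor that decays in ub. *)
Lemma frame_y k : dominated weight_a k -> exists hu hb,
  decaying true false hu /\ decaying true true hb /\ frame_derive (fun d t x => k d (Y d t x)) hu hb.
Proof.
intros Hk.
assert (Hkc : dominated weight_a (fun d x => / dens (a d) (b d) x * Derive (k d) x))
  by (apply dominated_mult_l; [apply inv_dens_a|apply dominated_derive, Hk]).
assert (q := decaying_y _ Hkc). simpl in q.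
exists (fun d t x => ((/ dens (a d) (b d) (Y d t x) * Derive (k d) (Y d t x)) * inv_jac d t x) *
   (-1 + (Derive Psi (t - x) * Derive Psi (t - x)) * (b d (Z d t x) * b d (Z d t x)))).
exists (fun d t x => ((/ dens (a d) (b d) (Y d t x) * Derive (k d) (Y d t x)) * inv_jac d t x) *
   (2 * (b d (Z d t x) * b d (Z d t x)))).
split; [|split].
- apply (decaying_mult true false false false).
  + apply (decaying_mult true false false false); [exact q|exact decaying_jac].
  + apply decaying_plus; [apply (decaying_const (-1))|].
    apply decaying_weak_l, decaying_weak_r, (decaying_mult true false false true).
    * exact (decaying_mult true false true false _ _ dpsi dpsi).
    * exact (decaying_mult false true false true _ _ db db).
- apply (decaying_mult true false false true).
  + apply (decaying_mult true false false false); [exact q|exact decaying_jac].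
  + apply (decaying_mult false false false true); [apply (decaying_const 2)|].
    exact (decaying_mult false true false true _ _ db db).
- intros d t x.
  pose proof (dens_ge_1 (a d) (b d) (Y d t x) (Hs d)). pose proof (small_sqr _ _ (Y d t x) (Z d t x) (Hs d)) as S.
  refine (null_derive_eq _ _ _ _ _ _ _ (null_derive_comp (k d) _ _ _ _ _ _
    (Derive_correct _ _ (dominated_ex_derive _ _ d (Y d t x) Hk)) (cc_Y _ _ _ _ (CC d) t x)) _ _);
  unfold inv_jac; simpl in *; field; split; lra.
Qed.

(** With J = 1 - a^2 b^2, d_u z = (Psi'^2 - a^2) / (dens J) and d_ub z = 2 / (dens J): the
    transversal derivative gains a factor that decays in u. *)
Lemma frame_z k : dominated weight_b k -> exists hu hb,
  decaying true true hu /\ decaying false true hb /\ frame_derive (fun d t x => k d (Z d t x)) hu hb.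
Proof.
intros Hk.
assert (Hkc : dominated weight_b (fun d x => / dens (b d) (a d) x * Derive (k d) x))
  by (apply dominated_mult_l; [apply inv_dens_b|apply dominated_derive, Hk]).
assert (q := decaying_z _ Hkc). simpl in q.
exists (fun d t x => ((/ dens (b d) (a d) (Z d t x) * Derive (k d) (Z d t x)) * inv_jac d t x) *
   ((Derive Psi (t - x) * Derive Psi (t - x)) + (-1) * (a d (Y d t x) * a d (Y d t x)))).
exists (fun d t x => ((/ dens (b d) (a d) (Z d t x) * Derive (k d) (Z d t x)) * inv_jac d t x) * 2).
split; [|split].
- apply (decaying_mult false true true false).
  + apply (decaying_mult false true false false); [exact q|exact decaying_jac].
  + apply decaying_plus; [exact (decaying_mult true false true false _ _ dpsi dpsi)|].
    apply (decaying_mult false false true false); [apply (decaying_const (-1))|].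
    exact (decaying_mult true false true false _ _ da da).
- apply (decaying_mult false true false false).
  + apply (decaying_mult false true false false); [exact q|exact decaying_jac].
  + apply (decaying_const 2).
- intros d t x.
  pose proof (dens_ge_1 (b d) (a d) (Z d t x) (small_pair_sym _ _ (Hs d))). pose proof (small_sqr _ _ (Y d t x) (Z d t x) (Hs d)) as S.
  refine (null_derive_eq _ _ _ _ _ _ _ (null_derive_comp (k d) _ _ _ _ _ _
    (Derive_correct _ _ (dominated_ex_derive _ _ d (Z d t x) Hk)) (cc_Z _ _ _ _ (CC d) t x)) _ _);
  unfold inv_jac; simpl in *; field; split; lra.
Qed.

Lemma frame_mult h1 h2 h1u h1b h2u h2b : frame_derive h1 h1u h1b -> frame_derive h2 h2u h2b ->
  frame_derive (fun d t x => h1 d t x * h2 d t x)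
    (fun d t x => h1u d t x * h2 d t x + h1 d t x * h2u d t x)
    (fun d t x => h1b d t x * h2 d t x + h1 d t x * h2b d t x).
Proof.
intros F1 F2 d t x.
refine (null_derive_eq _ _ _ _ _ _ _ (null_derive_mult _ _ _ _ _ _ _ _ (F1 d t x) (F2 d t x)) _ _); field.
Qed.

(** The heart of the decay estimates: differentiating along u gains decay
    in u and along ub gains decay in ub, whatever the function, and the other
    factor is kept. *)
Lemma decaying_frame i j h : decaying i j h -> exists hu hb,
  decaying true j hu /\ decaying i true hb /\ frame_derive h hu hb.
Proof.
assert (Z0 : forall i j, decaying i j (fun d t x => 0 * (a d (Y d t x) * b d (Z d t x)))).
{ intros. apply decaying_weaken, (decaying_mult false false true true); [apply decaying_const|].
  exact (decaying_mult true false false true _ _ da db). }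
intros Hh. induction Hh as [k Hk|k Hk|k Hk| |c|i j h1 h2 _ (u1 & b1 & U1 & B1 & F1) _ (u2 & b2 & U2 & B2 & F2)
  |i1 j1 i2 j2 h1 h2 D1 (u1 & b1 & U1 & B1 & F1) D2 (u2 & b2 & U2 & B2 & F2)|j h _ (hu & hb & Hu & Hb' & Fh)|i h _ (hu & hb & Hu & Hb' & Fh)].
- apply frame_y, Hk.
- apply frame_z, Hk.
- exists (fun d t x => Derive (k d) (t - x)), (fun d t x => 0 * (a d (Y d t x) * b d (Z d t x))).
  split; [exact (decaying_u _ (dominated_derive _ _ Hk))|]. split; [apply Z0|].
  intros d t x. refine (null_derive_eq _ _ _ _ _ _ _ (null_derive_u (k d) t x _
    (Derive_correct _ _ (dominated_ex_derive _ _ d (t - x) Hk))) _ _); field.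
- destruct (frame_y _ Ha) as (au & ab & Ua & Ba & Fa). destruct (frame_z _ Hb) as (bu & bb & Ub & Bb & Fb).
  assert (Fab := frame_mult _ _ _ _ _ _ Fa Fb).
  set (pr := fun d t x => 2 * ((inv_jac d t x * inv_jac d t x) * (a d (Y d t x) * b d (Z d t x)))).
  assert (Hpr : decaying true true pr).
  { apply (decaying_mult false false true true); [apply (decaying_const 2)|].
    apply (decaying_mult false false true true).
    - exact (decaying_mult false false false false _ _ decaying_jac decaying_jac).
    - exact (decaying_mult true false false true _ _ da db). }
  exists (fun d t x => pr d t x * (au d t x * b d (Z d t x) + a d (Y d t x) * bu d t x)).
  exists (fun d t x => pr d t x * (ab d t x * b d (Z d t x) + a d (Y d t x) * bb d t x)).
  split; [|split].
  + apply decaying_weak_r, (decaying_mult true true false false); [exact Hpr|].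
    apply decaying_plus.
    * exact (decaying_bounded _ _ _ (decaying_mult _ _ _ _ _ _ Ua db)).
    * exact (decaying_bounded _ _ _ (decaying_mult _ _ _ _ _ _ da Ub)).
  + apply decaying_weak_l, (decaying_mult true true false false); [exact Hpr|].
    apply decaying_plus.
    * exact (decaying_bounded _ _ _ (decaying_mult _ _ _ _ _ _ Ba db)).
    * exact (decaying_bounded _ _ _ (decaying_mult _ _ _ _ _ _ da Bb)).
  + intros d t x. pose proof (small_sqr _ _ (Y d t x) (Z d t x) (Hs d)) as S.
    assert (N : (fun t x => 1 - (a d (Y d t x) * b d (Z d t x)) * (a d (Y d t x) * b d (Z d t x))) t x <> 0) by (simpl in *; lra).
    unfold inv_jac.
    apply (null_derive_ext (fun t x => / (1 - (a d (Y d t x) * b d (Z d t x)) * (a d (Y d t x) * b d (Z d t x)))));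
      [intros; f_equal; simpl; ring|].
    refine (null_derive_eq _ _ _ _ _ _ _ (null_derive_inv _ _ _ _ _ N (null_derive_minus _ _ _ _ _ _ _ _
      (null_derive_const 1 t x) (null_derive_mult _ _ _ _ _ _ _ _ (Fab d t x) (Fab d t x)))) _ _);
    unfold pr, inv_jac; simpl in *; field; lra.
- exists (fun d t x => 0 * (a d (Y d t x) * b d (Z d t x))), (fun d t x => 0 * (a d (Y d t x) * b d (Z d t x))).
  split; [apply Z0|]. split; [apply Z0|]. intros d t x.
  refine (null_derive_eq _ _ _ _ _ _ _ (null_derive_const c t x) _ _); field.
- exists (fun d t x => u1 d t x + u2 d t x), (fun d t x => b1 d t x + b2 d t x).
  split; [apply decaying_plus; assumption|]. split; [apply decaying_plus; assumption|]. intros d t x.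
  refine (null_derive_eq _ _ _ _ _ _ _ (null_derive_plus _ _ _ _ _ _ _ _ (F1 d t x) (F2 d t x)) _ _); field.
- eexists _, _. split; [|split; [|exact (frame_mult _ _ _ _ _ _ F1 F2)]].
  + apply decaying_plus.
    * exact (decaying_mult _ _ _ _ _ _ U1 D2).
    * rewrite <- (orb_true_r i1). exact (decaying_mult _ _ _ _ _ _ D1 U2).
  + apply decaying_plus.
    * exact (decaying_mult _ _ _ _ _ _ B1 D2).
    * rewrite <- (orb_true_r j1). exact (decaying_mult _ _ _ _ _ _ D1 B2).
- exists hu, hb. auto using decaying_weak_l.
- exists hu, hb. auto using decaying_weak_r.
Qed.

Lemma decaying_iter_u n i j h : decaying i j h -> exists i' g, decaying i' j g /\ (n = O \/ i' = true) /\ (i = true -> i' = true) /\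
  forall d, Nat.iter n (d_u Psi) (h d) = g d.
Proof.
intros Hh. induction n as [|n (i' & g & Hg & _ & Hi & E)]; [exists i, h; auto|].
destruct (decaying_frame _ _ _ Hg) as (gu & gb & Hu & Hb' & Fg).
exists true, gu. split; [exact Hu|]. split; [auto|]. split; [auto|].
intros d. simpl. rewrite E. apply (frame_derive_eq _ _ _ d Fg).
Qed.

Lemma decaying_iter_ub n i h : decaying i true h -> exists g, decaying i true g /\
  forall d, Nat.iter n d_ub (h d) = g d.
Proof.
intros Hh. induction n as [|n (g & Hg & E)]; [exists h; auto|].
destruct (decaying_frame _ _ _ Hg) as (gu & gb & Hu & Hb' & Fg).
exists gb. split; [exact Hb'|]. intros d. simpl. rewrite E. apply (frame_derive_eq _ _ _ d Fg).
Qed.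

(** * Smoothness and decay of the solution *)
Section Solution.
Variable K0 : D -> R.
Let phi d := string_wave (a d) (b d) (Y d) (Z d) Psi (K0 d).

(** 1/(1+ab) is written (1 - ab)/(1 - a^2 b^2) in order to use the generator
    [inv_jac]. *)
Definition phi_u (d : D) (t x : R) : R :=
  ((a d (Y d t x) + -1 * (a d (Y d t x) * (a d (Y d t x) * b d (Z d t x)))) * inv_jac d t x + -1 * Derive Psi (t - x))
  + (Derive Psi (t - x) * Derive Psi (t - x)) *
    ((b d (Z d t x) + -1 * (b d (Z d t x) * (a d (Y d t x) * b d (Z d t x)))) * inv_jac d t x).
Definition phi_ub (d : D) (t x : R) : R :=
  2 * ((b d (Z d t x) + -1 * (b d (Z d t x) * (a d (Y d t x) * b d (Z d t x)))) * inv_jac d t x).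

Lemma decaying_r : decaying false true (fun d t x =>
  (b d (Z d t x) + -1 * (b d (Z d t x) * (a d (Y d t x) * b d (Z d t x)))) * inv_jac d t x).
Proof.
apply (decaying_mult false true false false); [|exact decaying_jac].
apply decaying_plus; [exact db|]. apply (decaying_mult false false false true); [apply (decaying_const (-1))|].
apply decaying_weak_l, (decaying_mult false true true true); [exact db|].
exact (decaying_mult true false false true _ _ da db).
Qed.

Lemma decaying_phi_u : decaying true false phi_u.
Proof.
apply decaying_plus; [apply decaying_plus|].
- apply (decaying_mult true false false false); [|exact decaying_jac].
  apply decaying_plus; [exact da|]. apply (decaying_mult false false true false); [apply (decaying_const (-1))|].
  apply decaying_weak_r, (decaying_mult true false true true); [exact da|].
  exact (decaying_mult true false false true _ _ da db).
- apply (decaying_mult false false true false); [apply (decaying_const (-1))|exact dpsi].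
- apply decaying_weak_r, (decaying_mult true false false true); [|apply decaying_r].
  exact (decaying_mult true false true false _ _ dpsi dpsi).
Qed.

Lemma decaying_phi_ub : decaying false true phi_ub.
Proof. apply (decaying_mult false false false true); [apply (decaying_const 2)|apply decaying_r]. Qed.

Lemma frame_phi : frame_derive phi phi_u phi_ub.
Proof.
intros d t x.
pose proof (one_plus_ab_pos _ _ (Hs d) (Y d t x) (Z d t x)) as O.
refine (null_derive_eq _ _ _ _ _ _ _ (wave_null _ _ (Hs d) _ _ (CC d) Psi hPsi (K0 d) t x) _ _);
unfold phi_u, phi_ub, wave_p, wave_r, inv_jac;
(replace (1 - (a d (Y d t x) * b d (Z d t x)) ^ 2) with ((1 + a d (Y d t x) * b d (Z d t x)) * (1 - a d (Y d t x) * b d (Z d t x))) by ring);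
field; repeat split; lra.
Qed.

(** The algebra is stable under d_t and d_x, so its members are smooth; phi itself
    need not belong to it, but its first derivatives do. *)
Lemma phi_smooth2 d : smooth2 (phi d).
Proof.
assert (lin : forall hu hb, (exists i j, decaying i j hu) -> (exists i j, decaying i j hb) -> forall c1 c2,
   exists i j, decaying i j (fun d t x => c1 * (hu d t x + -1 * ((Derive Psi (t - x) * Derive Psi (t - x)) * (/ 2 * hb d t x))) + c2 * (/ 2 * hb d t x))).
{   intros hu hb (i1 & j1 & A1) (i2 & j2 & A2) c1 c2. apply decaying_bounded in A1, A2.
  assert (A3 := decaying_mult _ _ _ _ _ _ (decaying_const (/ 2)) A2). simpl in A3.
  exists false, false. apply decaying_plus.
  - apply (decaying_mult false false false false); [apply decaying_const|].
    apply decaying_plus; [exact A1|]. apply (decaying_mult false false false false); [apply decaying_const|].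
    exact (decaying_bounded _ _ _ (decaying_mult _ _ _ _ _ _ (decaying_mult _ _ _ _ _ _ dpsi dpsi) A3)).
  - apply (decaying_mult false false false false); [apply decaying_const|exact A3]. }
assert (fr : forall h hu hb d, frame_derive h hu hb -> (exists i j, decaying i j hu) -> (exists i j, decaying i j hb) ->
  exists ft fx, (exists h i j, decaying i j h /\ ft = h d) /\ (exists h i j, decaying i j h /\ fx = h d) /\ forall t x,
     is_derive (fun s => h d s x) t (ft t x) /\ is_derive (fun y => h d t y) x (fx t x)).
{ intros h hu hb d' F A1 A2.
  destruct (lin hu hb A1 A2 1 1) as (i1 & j1 & L1). destruct (lin hu hb A1 A2 (-1) 1) as (i2 & j2 & L2).
  eexists _, _. split; [eexists _, _, _; split; [exact L1|reflexivity]|].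
  split; [eexists _, _, _; split; [exact L2|reflexivity]|].
  intros t x. destruct (F d' t x) as [F1 F2]. split.
  - evar_last; [exact F1|]. simpl. field.
  - evar_last; [exact F2|]. simpl. field. }
apply (smooth2_by_class (fun f => (exists h i j, decaying i j h /\ f = h d) \/ f = phi d)); [|auto].
intros f [(h & i & j & Hh & ->)| ->].
- split; [intros; apply (decaying_cont _ _ _ _ _ _ Hh)|].
  destruct (decaying_frame _ _ _ Hh) as (hu & hb & Hu & Hb' & Fh).
  destruct (fr h hu hb d Fh) as (ft & fx & A1 & A2 & A3); eauto.
  exists ft, fx. auto.
- destruct (fr phi phi_u phi_ub d frame_phi) as (ft & fx & A1 & A2 & A3);
    [eexists _, _; apply decaying_phi_u|eexists _, _; apply decaying_phi_ub|].
  split; [|exists ft, fx; auto].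
  intros t x. unfold phi, string_wave.
  assert (Pc : forall h, (forall s, continuous h s) -> forall s, continuous (primitive h) s).
  { intros h Hh s. apply (ex_derive_continuous (primitive h)). eexists. apply primitive_derive, Hh. }
  apply continuity_2d_pt_minus; [apply continuity_2d_pt_plus; [apply continuity_2d_pt_minus; [apply continuity_2d_pt_const|]|]|].
  + apply continuous_comp_2d; [|apply CC]. apply Pc. intros. apply continuous_Rmult; [apply Hs|apply dens_continuous, Hs].
  + apply continuous_comp_2d; [|apply CC]. apply Pc. intros. apply continuous_Rmult; [apply Hs|apply dens_continuous, small_pair_sym, Hs].
  + apply (continuous_comp_2d Psi (fun t x => t - x)); [intros; apply (Derive_n_continuous Psi 0), hPsi|].
    apply continuity_2d_pt_minus; [apply continuity_2d_pt_id1|apply continuity_2d_pt_id2].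
Qed.

(** All derivatives considered, except d_u phi and d_ub phi, are derivatives of a
    member of the algebra. *)
Lemma phi_decay i j : exists C, 0 <= C /\ forall d t x,
  Rabs (d_u Psi (Nat.iter i (d_u Psi) (Nat.iter j d_ub (phi d))) t x) <= C * rate gamma (u_ t x) /\
  Rabs (d_ub (Nat.iter i (d_u Psi) (Nat.iter j d_ub (phi d))) t x) <= C * (dl d * rate gamma (ub_ Psi t x)).
Proof.
assert (E := fun d => frame_derive_eq _ _ _ d frame_phi).
assert (X : exists hu hb, decaying true false hu /\ decaying false true hb /\ forall d,
   d_u Psi (Nat.iter i (d_u Psi) (Nat.iter j d_ub (phi d))) = hu d /\
   d_ub (Nat.iter i (d_u Psi) (Nat.iter j d_ub (phi d))) = hb d).
{ assert (Y' : (i = O /\ j = O) \/ exists i' j' h, decaying i' j' h /\ (j = O -> i' = true) /\ forall d, Nat.iter i (d_u Psi) (Nat.iter j d_ub (phi d)) = h d).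
  { destruct j as [|j].
    - destruct i as [|i]; [auto|right].
      destruct (decaying_iter_u i _ _ _ decaying_phi_u) as (i' & g & Hg & _ & Hi & Eg).
      exists i', false, g. split; [exact Hg|]. split; [auto|]. intros d. rewrite Nat.iter_succ_r. simpl.
      rewrite (proj1 (E d)). apply Eg.
    - right. destruct (decaying_iter_ub j _ _ decaying_phi_ub) as (g & Hg & Eg).
      destruct (decaying_iter_u i _ _ _ Hg) as (i' & g' & Hg' & _ & _ & Eg').
      exists i', true, g'. split; [exact Hg'|]. split; [discriminate|]. intros d.
      rewrite Nat.iter_succ_r, (proj2 (E d)), Eg. apply Eg'. }
  destruct Y' as [[-> ->]|(i' & j' & h & Hh & _ & Eh)].
  - exists phi_u, phi_ub. split; [apply decaying_phi_u|]. split; [apply decaying_phi_ub|]. intros d. apply E.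
  - destruct (decaying_frame _ _ _ Hh) as (hu & hb & Hu & Hb' & Fh).
    exists hu, hb. split; [destruct j'; auto using decaying_weak_r|]. split; [destruct i'; auto using decaying_weak_l|].
    intros d. rewrite Eh. apply (frame_derive_eq _ _ _ d Fh). }
destruct X as (hu & hb & Hu & Hb' & EX).
destruct (decaying_bound _ _ _ Hu) as (C1 & P1 & B1). destruct (decaying_bound _ _ _ Hb') as (C2 & P2 & B2).
exists (C1 + C2). split; [lra|]. intros d t x. rewrite (proj1 (EX d)), (proj2 (EX d)).
specialize (B1 d t x). specialize (B2 d t x). unfold decay_weight in *.
destruct (decay_weight_factors true true d t x) as [[Q1 _] [Q2 _]]. simpl in *.
assert (0 <= C2 * rate gamma (u_ t x)) by (apply Rmult_le_pos; auto).
assert (0 <= C1 * (dl d * rate gamma (ub_ Psi t x))) by (apply Rmult_le_pos; auto).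
split; lra.
Qed.
End Solution.
End Decay.

(** * From the Cauchy data to the Riemann invariants *)
Record cauchy_data (gamma I0 delta0 : R) (Psi : R -> R) : Type := {
  data_delta : R; data_f : R -> R; data_fb : R -> R; data_F : R -> R; data_G : R -> R;
  data_small : 0 < data_delta < delta0;
  data_smooth_f : smooth1 data_f; data_smooth_fb : smooth1 data_fb;
  data_energy : energy_bound gamma I0 data_f data_fb;
  data_admissible : admissible_data Psi data_delta data_f data_fb data_F data_G }.

Arguments data_delta {gamma I0 delta0 Psi}.
Arguments data_f {gamma I0 delta0 Psi}.
Arguments data_fb {gamma I0 delta0 Psi}.
Arguments data_F {gamma I0 delta0 Psi}.
Arguments data_G {gamma I0 delta0 Psi}.
Arguments data_small {gamma I0 delta0 Psi}.
Arguments data_smooth_f {gamma I0 delta0 Psi}.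
Arguments data_smooth_fb {gamma I0 delta0 Psi}.
Arguments data_energy {gamma I0 delta0 Psi}.
Arguments data_admissible {gamma I0 delta0 Psi}.

Lemma dominated_constants {D : Type} (w : D -> R -> R) (c : D -> R) :
  (forall d x, Rabs (c d) <= w d x) -> dominated w (fun d _ => c d).
Proof.
intros H n. revert c H. induction n as [|n IH]; intros c H; split; try exact I.
3:{ split; [intros; apply ex_derive_const|].
  replace (fun d => Derive (fun _ : R => c d)) with (fun (_ : D) (_ : R) => 0).
  - apply (IH (fun _ => 0)). intros d x. rewrite Rabs_R0. eapply Rle_trans; [apply Rabs_pos|apply H].
  - do 2 (apply functional_extensionality; intro). symmetry. apply Derive_const. }
all: exists 1; split; [lra|]; intros d x; rewrite Rmult_1_l; apply H.
Qed.

Lemma dominated_reflect {D : Type} (w h : D -> R -> R) : (forall d x, w d (- x) = w d x) ->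
  dominated w h -> dominated w (fun d x => h d (- x)).
Proof.
intros Hw H n. revert h H. induction n as [|n IH]; intros h H; split; try exact I.
3:{ assert (Dh : forall d x, is_derive (fun x => h d (- x)) x (-1 * Derive (h d) (- x))).
  { intros d x. evar_last; [apply (is_derive_comp (h d) (fun x => - x));
      [apply Derive_correct, (dominated_ex_derive _ _ _ _ H)|auto_derive; [exact I|reflexivity]]|].
    unfold scal; simpl; unfold mult; simpl. ring. }
  split; [intros d x; eexists; apply Dh|].
  replace (fun d => Derive (fun x => h d (- x))) with (fun d x => (-1) * Derive (h d) (- x)).
  - apply (dominated_upto_mult unit_weight w); [intros; unfold unit_weight; lra|apply dominated_const|].
    apply (IH (fun d => Derive (h d))), dominated_derive, H.
  - do 2 (apply functional_extensionality; intro). symmetry. apply is_derive_unique, Dh. }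
all: destruct (dominated_bound _ _ H) as (C & P & B); exists C; split; [exact P|]; intros d x; rewrite <- Hw; apply B.
Qed.

Lemma rate_even gamma x : rate gamma (- x) = rate gamma x.
Proof. unfold rate, Lambda, jap. replace ((- x) ^ 2) with (x ^ 2) by ring. reflexivity. Qed.

(** The additional decay <u>^{-(1+eps)/2} is bounded by 1. *)
Lemma decay_dominated {D : Type} gamma eps Psi : 0 < gamma -> 0 < eps -> smooth1 Psi -> decay gamma eps Psi ->
  dominated (weight_a (D := D) gamma) (fun _ => Derive Psi).
Proof.
intros hg he hP hd. apply dominated_intro.
- intros d k x. change (ex_derive_n (Derive_n Psi 1) k x).
  destruct k as [|k]; [exact I|]. simpl.
  apply (ex_derive_ext (Derive_n Psi (k + 1))); [intros; symmetry; apply (Derive_n_comp Psi k 1)|].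
  replace (k + 1)%nat with (S k) by lia. exact (hP (S (S k)) x).
- intros k. destruct (hd k) as (C & HC & B). exists C. split; [lra|]. intros d x.
  change (Derive_n (Derive Psi) k x) with (Derive_n (Derive_n Psi 1) k x). rewrite Derive_n_comp.
  replace (k + 1)%nat with (S k) by lia. eapply Rle_trans; [apply B|].
  apply Rmult_le_compat_l; [lra|]. unfold weight_a. fold (rate gamma x).
  rewrite <- (Rmult_1_r (rate gamma x)) at 2. apply Rmult_le_compat_l; [apply Rlt_le, rate_pos|].
  apply Rle_trans with (Rpower 1 (- ((1 + eps) / 2))); [|rewrite Rpower_1_l; lra].
  apply Rpower_neg_le; [pose proof (jap_ge_1 x); lra|lra].
Qed.

Lemma inv_sqrt_bounds q : Rabs q <= / 8 -> 0 < 1 - 4 * q /\ 0 < / (1 + sqrt (1 - 4 * q)) <= 1.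
Proof.
intros H. apply Rabs_le_between in H. split; [lra|]. pose proof (sqrt_pos (1 - 4 * q)). split.
- apply Rinv_0_lt_compat. lra.
- apply Rle_trans with (/ 1); [apply Rinv_le_contravar; lra|lra].
Qed.

Lemma inv_a_bound p r : Rabs (p * r) <= / 8 -> Rabs (inv_a p r) <= 2 * Rabs p /\ Rabs (inv_b p r) <= 2 * Rabs r.
Proof.
intros H. destruct (inv_sqrt_bounds _ H) as [_ [P Q]]. unfold inv_a, inv_b, Rdiv.
split; rewrite !Rabs_mult, (Rabs_pos_eq 2), (Rabs_pos_eq (/ _)) by lra;
  rewrite <- (Rmult_1_r (2 * _)) at 2; apply Rmult_le_compat_l; auto;
  (apply Rmult_le_pos; [lra|apply Rabs_pos]).
Qed.

(** sqrt h is written as h * (1 / sqrt h), the second factor being covered by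
    [dominated_inv_sqrt]. *)
Lemma dominated_invariant_factor {D : Type} (p r : D -> R -> R) :
  dominated unit_weight p -> dominated unit_weight r -> (forall d x, Rabs (p d x * r d x) <= / 8) ->
  dominated unit_weight (fun d x => / (1 + sqrt (1 - 4 * (p d x * r d x)))).
Proof.
intros Hp Hr Hq.
assert (HG : dominated unit_weight (fun d x => 1 + (-4) * (p d x * r d x))).
{ apply dominated_plus; [apply dominated_const|]. apply (dominated_scal _ (-4)), dominated_mult_l; assumption. }
assert (Gp : forall d x, / 2 <= 1 + (-4) * (p d x * r d x)).
{ intros d x. specialize (Hq d x). apply Rabs_le_between in Hq. lra. }
assert (HI := dominated_inv_sqrt _ (/ 2) ltac:(lra) Gp HG).
replace (fun d x => / (1 + sqrt (1 - 4 * (p d x * r d x)))) with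
  (fun d x => / (1 + (1 + (-4) * (p d x * r d x)) * / sqrt (1 + (-4) * (p d x * r d x)))).
- apply (dominated_inv _ 1); [lra| |].
  + intros d x. specialize (Gp d x).
    assert (0 <= (1 + (-4) * (p d x * r d x)) * / sqrt (1 + (-4) * (p d x * r d x))); [|lra].
    apply Rmult_le_pos; [lra|]. apply Rlt_le, Rinv_0_lt_compat, sqrt_lt_R0. lra.
  + apply dominated_plus; [apply dominated_const|]. apply dominated_mult_l; assumption.
- apply functional_extensionality; intro d. apply functional_extensionality; intro x. specialize (Gp d x).
  assert (S : 0 < sqrt (1 + (-4) * (p d x * r d x))) by (apply sqrt_lt_R0; lra).
  rewrite <- (sqrt_sqrt (1 + (-4) * (p d x * r d x))) at 1 by lra.
  rewrite Rmult_assoc, Rinv_r, Rmult_1_r by lra. do 3 f_equal. ring.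
Qed.

Theorem theorem1p2
  (gamma eps : R) (hgamma : 0 < gamma < 1) (heps : 0 < eps)
  (Psi : R -> R) (hPsi : smooth1 Psi) (hdecay : decay gamma eps Psi)
  (I0 : R) :
  exists delta0 : R, 0 < delta0 /\
  exists C : nat -> nat -> R, (forall i j : nat, 0 < C i j) /\
  forall delta : R, 0 < delta < delta0 ->
  forall f fb F G : R -> R,
    smooth1 f -> smooth1 fb ->
    energy_bound gamma I0 f fb ->
    admissible_data Psi delta f fb F G ->
    exists phi : R -> R -> R,
      cauchy_solution Psi F G phi /\
      (forall phi' : R -> R -> R, cauchy_solution Psi F G phi' ->
         forall t x : R, 0 <= t -> phi' t x = phi t x) /\
      (forall (i j : nat) (t x : R), 0 <= t ->
         Rabs (d_u Psi (Nat.iter i (d_u Psi) (Nat.iter j d_ub phi)) t x)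
           <= C i j * Rpower (Lambda gamma (u_ t x)) (- / 2) /\
         Rabs (d_ub (Nat.iter i (d_u Psi) (Nat.iter j d_ub phi)) t x)
           <= C i j * (delta * Rpower (Lambda gamma (ub_ Psi t x)) (- / 2))).
Proof.
assert (hg : 0 < gamma) by lra.
destruct (dominated_bound _ _ (decay_dominated (D := unit) gamma eps Psi hg heps hPsi hdecay)) as (M1 & PM1 & BM1).
destruct (weighted_sobolev gamma I0 hg 0) as (M2 & PM2 & BM2).
assert (bPsi : forall x, Rabs (Derive Psi x) <= M1).
{ intros x. eapply Rle_trans; [apply (BM1 tt)|]. unfold weight_a. pose proof (rate_le_1 gamma x hg). pose proof (rate_pos gamma x). nra. }
set (M := 1 + M1 + M2 + M1 ^ 2 * M2).
assert (HM : 1 <= M) by (unfold M; pose proof (Rmult_le_pos _ _ (pow2_ge_0 M1) PM2); lra).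
(* M bounds |Psi'| and the state p; r is bounded by delta M / 2.  With delta M^2 <= 1/16 one gets
   |p r| <= 1/32, |a| <= 2 M, |b| <= delta M, so |a b| <= 1/8 and |Psi' 2 r| <= 1/4. *)
set (delta0 := / (16 * M ^ 2)).
assert (HM2 : 1 <= M ^ 2) by (simpl; nra).
assert (Pd0 : 0 < delta0) by (apply Rinv_0_lt_compat; lra).
assert (Ed0 : delta0 * M ^ 2 = / 16) by (unfold delta0; field; lra).
set (D := cauchy_data gamma I0 delta0 Psi).
set (dl := fun d : D => data_delta d).
assert (hdl : forall d, 0 < dl d <= 1).
{ intros d. pose proof (data_small d) as S. fold (dl d) in S. split; [lra|].
  assert (delta0 <= 1); [|lra]. unfold delta0. rewrite <- Rinv_1. apply Rinv_le_contravar; lra. }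
assert (hdM : forall d, dl d * M ^ 2 <= / 16).
{ intros d. pose proof (data_small d) as S. fold (dl d) in S. rewrite <- Ed0. apply Rmult_le_compat_r; lra. }
(* The initial state (p, r), read off from F' + G = delta f = 2 r and G - F' = 2 (p - Psi'(-x)). *)
set (p0 := fun (d : D) x => Derive Psi (- x) + data_fb d x + (- / 2) * ((dl d * data_f d x) * (Derive Psi (- x) * Derive Psi (- x)))).
set (r0 := fun (d : D) x => / 2 * (dl d * data_f d x)).
set (wa := weight_a (D := D) gamma). set (wb := weight_b (D := D) gamma dl).
assert (HP : dominated wa (fun _ => Derive Psi)) by exact (decay_dominated gamma eps Psi hg heps hPsi hdecay).
assert (HPr : dominated wa (fun _ x => Derive Psi (- x))).
{ apply (dominated_reflect wa (fun _ => Derive Psi)); [intros; apply rate_even|exact HP]. }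
assert (Sob : forall k, exists C, 0 <= C /\ forall (d : D) x, Rabs (Derive_n (data_f d) k x) <= C * wa d x /\ Rabs (Derive_n (data_fb d) k x) <= C * wa d x).
{ intros k. destruct (weighted_sobolev gamma I0 hg k) as (C & PC & BC). exists C. split; [exact PC|]. intros d x.
  exact (BC _ _ (data_smooth_f d) (data_smooth_fb d) (data_energy d) x). }
assert (Hf : dominated wa (fun d => data_f d)).
{ apply dominated_intro; [intros; apply data_smooth_f|]. intros k. destruct (Sob k) as (C & PC & BC). exists C. split; [exact PC|apply BC]. }
assert (Hfb : dominated wa (fun d => data_fb d)).
{ apply dominated_intro; [intros; apply data_smooth_fb|]. intros k. destruct (Sob k) as (C & PC & BC). exists C. split; [exact PC|apply BC]. }
assert (Hdf : dominated wb (fun d x => dl d * data_f d x)).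
{ apply (dominated_mult (fun d _ => dl d) wa wb (fun d _ => dl d)); [intros; unfold wa, wb, weight_a, weight_b; lra| |exact Hf].
  apply dominated_constants. intros d _. rewrite Rabs_pos_eq; pose proof (hdl d); lra. }
assert (Hr : dominated wb r0) by (apply dominated_scal, Hdf).
assert (Hdfu := dominated_b_unit gamma dl hg hdl _ Hdf).
assert (Hp : dominated wa p0).
{ apply dominated_plus; [apply dominated_plus; assumption|]. apply dominated_scal. apply dominated_mult_l; [exact Hdfu|].
  apply dominated_mult_l; [apply (dominated_a_unit gamma hg _ HPr)|exact HPr]. }
assert (bf : forall (d : D) x, Rabs (data_f d x) <= M2 /\ Rabs (data_fb d x) <= M2).
{ intros d x. pose proof (BM2 _ _ (data_smooth_f d) (data_smooth_fb d) (data_energy d) x) as B. simpl in B.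
  pose proof (rate_le_1 gamma x hg). pose proof (rate_pos gamma x). nra. }
assert (br : forall d x, Rabs (r0 d x) <= / 2 * (dl d * M)).
{ intros d x. unfold r0. rewrite !Rabs_mult, !Rabs_pos_eq by (pose proof (hdl d); lra).
  apply Rmult_le_compat_l; [lra|]. apply Rmult_le_compat_l; [pose proof (hdl d); lra|].
  apply Rle_trans with M2; [apply bf|]. unfold M. pose proof (Rmult_le_pos _ _ (pow2_ge_0 M1) PM2). lra. }
assert (bp : forall d x, Rabs (p0 d x) <= M).
{ intros d x. unfold p0. pose proof (hdl d). destruct (bf d x) as [B1 B2].
  eapply Rle_trans; [apply Rabs_triang|]. apply Rle_trans with (M1 + M2 + M1 ^ 2 * M2); [|unfold M; lra].
  apply Rplus_le_compat.
  - eapply Rle_trans; [apply Rabs_triang|]. apply Rplus_le_compat; auto.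
  - rewrite !Rabs_mult, Rabs_Ropp, (Rabs_pos_eq (/ 2)), (Rabs_pos_eq (dl d)) by lra.
    assert (Q : Rabs (Derive Psi (- x)) * Rabs (Derive Psi (- x)) <= M1 * M1) by (apply Rmult_le_compat; auto using Rabs_pos).
    assert (Q2 : Rabs (data_f d x) * (Rabs (Derive Psi (- x)) * Rabs (Derive Psi (- x))) <= M2 * (M1 * M1)).
    { apply Rmult_le_compat; auto using Rabs_pos. apply Rmult_le_pos; apply Rabs_pos. }
    assert (Q3 : 0 <= Rabs (data_f d x) * (Rabs (Derive Psi (- x)) * Rabs (Derive Psi (- x)))).
    { repeat apply Rmult_le_pos; apply Rabs_pos. }
    simpl. nra. }
assert (bpr : forall d x y, Rabs (p0 d x * r0 d y) <= / 32).
{ intros d x y. rewrite Rabs_mult. apply Rle_trans with (M * (/ 2 * (dl d * M))).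
  - apply Rmult_le_compat; auto using Rabs_pos.
  - pose proof (hdM d). simpl in *. lra. }
assert (bpr8 : forall d x, Rabs (p0 d x * r0 d x) <= / 8) by (intros; eapply Rle_trans; [apply bpr|lra]).
set (a := fun d x => inv_a (p0 d x) (r0 d x)). set (b := fun d x => inv_b (p0 d x) (r0 d x)).
assert (HJ := dominated_invariant_factor p0 r0 (dominated_a_unit gamma hg _ Hp) (dominated_b_unit gamma dl hg hdl _ Hr) bpr8).
assert (Ha : dominated wa a).
{ replace a with (fun d x => / (1 + sqrt (1 - 4 * (p0 d x * r0 d x))) * (2 * p0 d x)).
  - apply dominated_mult_l; [exact HJ|apply dominated_scal, Hp].
  - do 2 (apply functional_extensionality; intro). unfold a, inv_a, Rdiv. ring. }
assert (Hb : dominated wb b).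
{ replace b with (fun d x => / (1 + sqrt (1 - 4 * (p0 d x * r0 d x))) * (2 * r0 d x)).
  - apply dominated_mult_l; [exact HJ|apply dominated_scal, Hr].
  - do 2 (apply functional_extensionality; intro). unfold b, inv_b, Rdiv. ring. }
assert (ba : forall d x, Rabs (a d x) <= 2 * M).
{ intros d x. eapply Rle_trans; [apply inv_a_bound, bpr8|]. specialize (bp d x). lra. }
assert (bb : forall d x, Rabs (b d x) <= dl d * M).
{ intros d x. eapply Rle_trans; [apply inv_a_bound, bpr8|]. specialize (br d x). lra. }
assert (bab : forall d y z, Rabs (a d y * b d z) <= / 8).
{ intros d y z. rewrite Rabs_mult. apply Rle_trans with (2 * M * (dl d * M)).
  - apply Rmult_le_compat; auto using Rabs_pos.
  - pose proof (hdM d). simpl in *. lra. }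
assert (Ea : forall d s, ex_derive (a d) s) by (intros; apply (dominated_ex_derive _ _ _ _ Ha)).
assert (Eb : forall d s, ex_derive (b d) s) by (intros; apply (dominated_ex_derive _ _ _ _ Hb)).
assert (Hs : forall d, small_pair (a d) (b d)).
{ intros d. split.
  - intros y. apply (ex_derive_continuous (a d)), Ea.
  - intros y. apply (ex_derive_continuous (b d)), Eb.
  - exists ((2 * M) ^ 2). intros y. rewrite <- (pow2_abs (a d y)), <- (pow2_abs (b d y)). split; apply pow_incr; (split; [apply Rabs_pos|]).
    + apply ba.
    + eapply Rle_trans; [apply bb|]. pose proof (hdl d). nra.
  - intros y z. eapply Rle_trans; [apply bab|lra]. }
assert (CCex : forall d, exists YZ : (R -> R -> R) * (R -> R -> R), characteristic_coordinates (a d) (b d) (fst YZ) (snd YZ)).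
{ intros d. destruct (characteristic_coordinates_exist _ _ (Hs d)) as (Y & Z & H). exists (Y, Z). exact H. }
destruct (choice _ CCex) as (YZ & CC).
set (Y := fun d => fst (YZ d)). set (Z := fun d => snd (YZ d)).
set (K0 := fun d : D => data_F d 0 + Psi 0).
set (phi := fun d => string_wave (a d) (b d) (Y d) (Z d) Psi (K0 d)).
destruct (choice _ (fun i => choice _ (fun j => phi_decay gamma dl a b Y Z Psi hg hdl hPsi Ha Hb HP Hs CC K0 i j))) as (C0 & HC0).
exists delta0. split; [exact Pd0|].
exists (fun i j => C0 i j + 1). split; [intros i j; destruct (HC0 i j); lra|].
intros delta Hdelta f fb F G Sf Sfb HE HA.
set (d := Build_cauchy_data gamma I0 delta0 Psi delta f fb F G Hdelta Sf Sfb HE HA : D).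
assert (St : forall x, a d x / (1 + a d x * b d x) = p0 d x /\ b d x / (1 + a d x * b d x) = r0 d x).
{ intros x. destruct (state_of_inv (p0 d x) (r0 d x)) as [E1 E2]; [apply inv_sqrt_bounds, bpr8|]. split; symmetry; assumption. }
assert (HF : forall x, is_derive F x (b d x / (1 + a d x * b d x) - a d x / (1 + a d x * b d x) + Derive Psi (- x))).
{ intros x. destruct (HA x) as (A1 & A2 & A3). evar_last; [apply Derive_correct, A1|].
  destruct (St x) as [-> ->]. unfold p0, r0, dl; simpl. simpl in A3. lra. }
assert (HG : forall x, G x = a d x / (1 + a d x * b d x) + b d x / (1 + a d x * b d x) - Derive Psi (- x)).
{ intros x. destruct (HA x) as (A1 & A2 & A3).
  destruct (St x) as [-> ->]. unfold p0, r0, dl; simpl. simpl in A3. lra. }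
destruct (string_solution Psi (a d) (b d) (Y d) (Z d) F G hPsi (Hs d) (CC d) (Ea d) (Eb d) HF HG) as [S1 S2].
exists (phi d). split; [|split].
- split; [exact (phi_smooth2 gamma dl a b Y Z Psi hg hdl hPsi Ha Hb HP Hs CC K0 d)|]. split; [|exact S2].
  intros t x _. apply S1.
- intros phi' sol t x Ht.
  apply (string_unique Psi (a d) (b d) (Y d) (Z d) F G phi' hPsi (Hs d) (CC d) (Ea d) (Eb d) HF HG); [|exact sol|exact Ht].
  intros y z s. pose proof (bab d y z) as Q. apply Rabs_le_between in Q.
  rewrite !Rabs_mult, (Rabs_pos_eq 2) by lra. unfold Rdiv. rewrite Rabs_mult, (Rabs_pos_eq (/ _)) by (apply Rlt_le, Rinv_0_lt_compat; lra).
  assert (I2 : / (1 + a d y * b d z) <= 2).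
  { apply (Rmult_le_reg_r (1 + a d y * b d z)); [lra|]. rewrite Rinv_l; lra. }
  assert (I1 : 0 < / (1 + a d y * b d z)) by (apply Rinv_0_lt_compat; lra).
  apply Rle_trans with (M * (2 * (dl d * M * 2))).
  + apply Rmult_le_compat.
    * apply Rabs_pos.
    * apply Rmult_le_pos; [lra|apply Rmult_le_pos; [apply Rabs_pos|lra]].
    * eapply Rle_trans; [apply bPsi|]. unfold M. pose proof (Rmult_le_pos _ _ (pow2_ge_0 M1) PM2). lra.
    * apply Rmult_le_compat_l; [lra|]. apply Rmult_le_compat; [apply Rabs_pos|lra|apply bb|exact I2].
  + pose proof (hdM d). simpl in *. lra.
- intros i j t x _. destruct (HC0 i j) as [PC BC]. destruct (BC d t x) as [B1 B2].
  fold (rate gamma (u_ t x)) (rate gamma (ub_ Psi t x)).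
  pose proof (rate_pos gamma (u_ t x)). pose proof (rate_pos gamma (ub_ Psi t x)). pose proof (hdl d) as hd.
  change (dl d) with delta in *.
  assert (0 < delta * rate gamma (ub_ Psi t x)) by (apply Rmult_lt_0_compat; lra).
  fold (phi d) in B1, B2. split; [lra|].
  eapply Rle_trans; [exact B2|]. lra.
Qed.
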